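(* Let $M$ and $N$ be injective von Neumann algebras, let $X$ and $Y$ be operator spaces such that the Haagerup tensor product $X \otimes^h Y$ is reflexive, and let $\boldsymbol{x}, \boldsymbol{y} \in M \bar{\otimes} N$ be such that: (a) $\mathcal{T}_{M,N}\boldsymbol{x}$ factors completely boundedly through $X$; (b) $\mathcal{T}_{M,N}\boldsymbol{y}$ factors completely boundedly through $Y$. Then $\mathcal{T}_{M,N}(\boldsymbol{x}\boldsymbol{y})$ factors completely boundedly through $X \otimes^h Y$.
   Context: $M \bar{\otimes} N$ is the von Neumann algebra tensor product, $M_\ast$ is the predual of $M$ with its canonical operator space structure, and $\mathcal{CB}(E,F)$ is the space of completely bounded maps from $E$ to $F$. $\mathcal{T}_{M,N} : M \bar{\otimes} N \to \mathcal{CB}(M_\ast,N)$ is the canonical completely isometric isomorphism $(\mathcal{T}_{M,N}\boldsymbol{x})f = (f \otimes \mathrm{id})(\boldsymbol{x})$ for $f \in M_\ast$, where $f \otimes \mathrm{id} : M \bar{\otimes} N \to N$ is the normal (Tomiyama) slice map. A map $T \in \mathcal{CB}(E,F)$ factors completely boundedly through an operator space $X$ if there are $R \in \mathcal{CB}(E,X)$ and $S \in \mathcal{CB}(X,F)$ with $T = SR$. $\otimes^h$ is the (completed) Haagerup tensor product of operator spaces; an operator space is reflexive if it is reflexive as a Banach space. *)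

(* Defs.v *)
From HB Require Import structures.
From mathcomp Require Import all_boot all_order all_algebra.
From mathcomp Require Import complex mxtens.
From mathcomp Require Import all_classical all_reals all_analysis.

Set Implicit Arguments.
Unset Strict Implicit.
Unset Printing Implicit Defensive.

Import Order.TTheory GRing.Theory Num.Theory.
Import numFieldNormedType.Exports.

Local Open Scope classical_set_scope.
Local Open Scope ring_scope.

(* Bounded (i.e. continuous) linear maps between normed spaces. *)
Section BoundedLinear.
Context (F : numFieldType) (V W : normedModType F).

Definition blin_pred : {pred V -> W} :=
  fun f => `[< linear f /\ continuous f >].

Record blin := Blin { blin_fun :> V -> W; blinP : blin_fun \in blin_pred }.

Lemma blin_pred_submod : submod_closed blin_pred.
Proof.
split=> [|c f g /asboolP[lf cf] /asboolP[lg cg]]; apply/asboolP; split.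
- by move=> a u v /=; rewrite scaler0 addr0.
- by move=> x; exact: cvg_cst.
- move=> a u v; rewrite !fctE lf lg !scalerDr !scalerA mulrC.
  by rewrite -!addrA; congr (_ + _); rewrite addrCA.
- by move=> x; apply: cvgD; [apply: cvgZl_tmp; exact: cf|exact: cg].
Qed.

HB.instance Definition _ :=
  GRing.isSubmodClosed.Build F (V -> W) blin_pred blin_pred_submod.
HB.instance Definition _ := [isSub for blin_fun].
HB.instance Definition _ := [Choice of blin by <:].
HB.instance Definition _ := [SubChoice_isSubLmodule of blin by <:].
End BoundedLinear.
Arguments blin_pred {F} V W.

Lemma blin_comp_subproof (F : numFieldType) (U V W : normedModType F)
  (g : blin V W) (f : blin U V) : g \o f \in blin_pred U W.
Proof.
have /asboolP[lf cf] := blinP f; have /asboolP[lg cg] := blinP g.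
apply/asboolP; split=> [a u v|x] /=; first by rewrite lf lg.
exact: (continuous_comp (cf x) (cg (f x))).
Qed.

Definition blin_comp (F : numFieldType) (U V W : normedModType F)
  (g : blin V W) (f : blin U V) : blin U W := Blin (blin_comp_subproof g f).

(* The norm of a complex normed space takes its values in R[i]. *)
Definition rnorm (R : realType) (V : normedModType R[i]) (v : V) : R :=
  complex.Re `|v|.

Definition l2norm (R : realType) (V : normedModType R[i]) (n : nat)
  (v : 'I_n -> V) : R := Num.sqrt (\sum_i rnorm (v i) ^+ 2).

(* Every bounded functional on the dual is an evaluation; k ranges over the
   bounds for f, so that c is a bound for phi in terms of the dual norm. *)
Definition reflexive_space (R : realType) (V : normedModType R[i]) : Prop :=
  forall phi : blin V R[i]^o -> R[i],
    scalar phi ->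
    (exists c : R, forall (f : blin V R[i]^o) (k : R),
        (forall v, rnorm (f v) <= k * rnorm v) -> complex.Re `|phi f| <= c * k) ->
  exists v : V, forall f, phi f = f v.

(* Operator norm of a scalar matrix between the spaces l^2_n and l^2_m. *)
Definition scalar_opnorm (R : realType) (m n : nat) (a : 'M[R[i]]_(m, n)) : R :=
  sup [set l2norm (fun i => \sum_j a i j * xi j : R[i]^o) |
        xi in [set xi : 'I_n -> R[i]^o | l2norm xi <= 1]].

Definition smulmx (R : realType) (V : lmodType R[i]) (p m n q : nat)
    (a : 'M[R[i]]_(p, m)) (v : 'M[V]_(m, n)) (b : 'M[R[i]]_(n, q)) :
    'M[V]_(p, q) :=
  \matrix_(i, j) \sum_k \sum_l (a i k * b l j) *: v k l.

(* Bare data, used for spaces (a von Neumann algebra, its predual) whose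
   operator space structure is concrete. *)
Record matNormed (R : realType) := MatNormed {
  mn_space :> lmodType R[i];
  mnorm : forall m n : nat, 'M[mn_space]_(m, n) -> R }.

(* Complete abstract operator spaces, by Ruan's axioms. The norms are given on
   all rectangular matrices; those on square ones determine the others by
   padding with zeros. *)
Record opSpace (R : realType) := OpSpace {
  os_space :> completeNormedModType R[i];
  os_norm : forall m n : nat, 'M[os_space]_(m, n) -> R;
  os_norm1 : forall v : os_space, os_norm (const_mx v : 'M[os_space]_1) = rnorm v;
  os_norm0_eq0 : forall m n (v : 'M[os_space]_(m, n)), os_norm v = 0 -> v = 0;
  os_normZ : forall m n (c : R[i]) (v : 'M[os_space]_(m, n)),
    os_norm (map_mx (GRing.scale c) v) = complex.Re `|c| * os_norm v;
  os_normD : forall m n (v w : 'M[os_space]_(m, n)),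
    os_norm (v + w) <= os_norm v + os_norm w;
  os_norm_smul : forall p m n q (a : 'M[R[i]]_(p, m))
      (v : 'M[os_space]_(m, n)) (b : 'M[R[i]]_(n, q)),
    os_norm (smulmx a v b) <= scalar_opnorm a * os_norm v * scalar_opnorm b;
  os_norm_block : forall m n p q
      (v : 'M[os_space]_(m, n)) (w : 'M[os_space]_(p, q)),
    os_norm (block_mx v 0 0 w) = Num.max (os_norm v) (os_norm w) }.

Definition opSpace_matNormed (R : realType) (X : opSpace R) : matNormed R :=
  MatNormed (@os_norm R X).
Coercion opSpace_matNormed : opSpace >-> matNormed.

Section CompletelyBounded.
Context (R : realType).

Definition completely_bounded (E F : matNormed R) (T : E -> F) : Prop :=
  linear T /\
  exists c : R, forall n (v : 'M[E]_n), mnorm (map_mx T v) <= c * mnorm v.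

Definition completely_contractive (E F : matNormed R) (T : E -> F) : Prop :=
  linear T /\ forall n (v : 'M[E]_n), mnorm (map_mx T v) <= mnorm v.

Definition completely_isometric (E F : matNormed R) (T : E -> F) : Prop :=
  linear T /\ forall n (v : 'M[E]_n), mnorm (map_mx T v) = mnorm v.

Arguments completely_bounded : clear implicits.
Arguments completely_contractive : clear implicits.
Arguments completely_isometric : clear implicits.

Definition factors_cb (E F : matNormed R) (T : E -> F) (X : opSpace R) : Prop :=
  exists (r : E -> X) (s : X -> F),
    [/\ completely_bounded E X r, completely_bounded X F s & T = s \o r].

(* Injective object for operator spaces and complete contractions. *)
Definition injective_matNormed (V : matNormed R) : Prop :=
  forall (W0 W : opSpace R) (iota : W0 -> W) (T : W0 -> V),
    completely_isometric W0 W iota -> completely_contractive W0 V T ->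
  exists T' : W -> V, completely_contractive W V T' /\ T' \o iota = T.

End CompletelyBounded.

Definition haagerup_mul (R : realType) (X Y Z : opSpace R) (t : X -> Y -> Z)
    (m r n : nat) (v : 'M[X]_(m, r)) (w : 'M[Y]_(r, n)) : 'M[Z]_(m, n) :=
  \matrix_(i, j) \sum_k t (v i k) (w k j).

(* A model of the completed Haagerup tensor product: a complete operator space
   in which the algebraic tensor product of X and Y embeds as a dense subspace
   carrying the Haagerup matrix norms. It is unique up to complete isometry. *)
Record haagerup_tensor (R : realType) (X Y : opSpace R) := HaagerupTensor {
  ht_space :> opSpace R;
  ht_tens : {bilinear X -> Y -> ht_space};
  ht_inj : forall n (x : 'I_n -> X) (y : 'I_n -> Y),
    (forall c : 'I_n -> R[i], \sum_i c i *: x i = 0 -> forall i, c i = 0) ->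
    \sum_i ht_tens (x i) (y i) = 0 -> forall i, y i = 0;
  ht_dense : dense [set z : ht_space | exists n (x : 'I_n -> X) (y : 'I_n -> Y),
    z = \sum_i ht_tens (x i) (y i)];
  ht_norm : forall m n r0 (v0 : 'M[X]_(m, r0)) (w0 : 'M[Y]_(r0, n)),
    os_norm (haagerup_mul ht_tens v0 w0) =
    inf [set s : R | exists r (v : 'M[X]_(m, r)) (w : 'M[Y]_(r, n)),
      haagerup_mul ht_tens v w = haagerup_mul ht_tens v0 w0 /\
      s = os_norm v * os_norm w] }.

Record hilbert (R : realType) := Hilbert {
  hspace :> completeNormedModType R[i];
  hdot : {dot hspace for Num.conj};
  hdotE : forall x : hspace, hdot x x = `|x| ^+ 2 }.

(* A model of the Hilbert space tensor product, unique up to unitaries. *)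
Record hilbert_tensor (R : realType) (H K : hilbert R) := HilbertTensor {
  hit_space :> hilbert R;
  hit_tens : {bilinear H -> K -> hit_space};
  hit_dot : forall (h h' : H) (k k' : K),
    hdot hit_space (hit_tens h k) (hit_tens h' k') =
    hdot H h h' * hdot K k k';
  hit_dense : dense [set z : hit_space | exists n (h : 'I_n -> H) (k : 'I_n -> K),
    z = \sum_i hit_tens (h i) (k i)] }.

Section VonNeumann.
Context (R : realType).

Definition is_adjoint (H : hilbert R) (a b : blin H H) : Prop :=
  forall xi eta, hdot H (a xi) eta = hdot H xi (b eta).

Definition commutant (H : hilbert R) (A : set (blin H H)) : set (blin H H) :=
  [set b : blin H H | forall a, A a -> forall xi, a (b xi) = b (a xi)].

(* Concrete von Neumann algebras on H. *)
Record vnAlg (H : hilbert R) := VNAlg {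
  vn_set : set (blin H H);
  vn_star : forall a b, vn_set a -> is_adjoint a b -> vn_set b;
  vn_bicommutant : commutant (commutant vn_set) = vn_set }.

Definition vn_pred (H : hilbert R) (M : vnAlg H) : {pred blin H H} :=
  fun a => `[< vn_set M a >].

Record vn_elt (H : hilbert R) (M : vnAlg H) :=
  VNElt { vn_val :> blin H H; vn_eltP : vn_val \in vn_pred M }.

Section Elements.
Context (H : hilbert R) (M : vnAlg H).

Lemma vn_pred_submod : submod_closed (vn_pred M).
Proof.
split=> [|c a b /asboolP Ma /asboolP Mb]; apply/asboolP.
- rewrite -vn_bicommutant => d _ xi /=.
  have /asboolP[ld _] := blinP d.
  by move: (ld (-1) 0 0); rewrite scaler0 addr0 scaleN1r addNr.
- move: Ma Mb; rewrite -vn_bicommutant => Ma Mb d Md xi.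
  have /asboolP[ld _] := blinP d.
  by rewrite [LHS]ld Ma // Mb.
Qed.

HB.instance Definition _ :=
  GRing.isSubmodClosed.Build R[i] (blin H H) (vn_pred M) vn_pred_submod.
HB.instance Definition _ := [isSub for @vn_val H M].
HB.instance Definition _ := [Choice of vn_elt M by <:].
HB.instance Definition _ := [SubChoice_isSubLmodule of vn_elt M by <:].

Lemma vn_mul_subproof (x y : vn_elt M) : blin_comp x y \in vn_pred M.
Proof.
have /asboolP := vn_eltP x; have /asboolP := vn_eltP y.
rewrite -vn_bicommutant => My Mx; apply/asboolP.
by rewrite -vn_bicommutant => d Md xi /=; rewrite Mx // My.
Qed.

Definition vn_mul (x y : vn_elt M) : vn_elt M := VNElt (vn_mul_subproof x y).

Definition vn_norm (m n : nat) (a : 'M[vn_elt M]_(m, n)) : R :=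
  sup [set l2norm (fun i => \sum_j a i j (xi j)) |
        xi in [set xi : 'I_n -> H | l2norm xi <= 1]].

Definition vn_matNormed : matNormed R := MatNormed vn_norm.

(* The sigma-weak topology is the initial topology for the functionals
   a |-> \sum_n <a (xi n), eta n> with xi and eta square summable. *)
Definition sq_summable (xi : nat -> H) : Prop :=
  cvgn (series (fun n => `|xi n| ^+ 2 : R[i]^o)).

Definition vec_functional (xi eta : nat -> H) (a : vn_elt M) : R[i]^o :=
  limn (series (fun n => hdot H (a (xi n)) (eta n) : R[i]^o)).

Definition sigma_weak_cvg (F : set_system (vn_elt M)) (a : vn_elt M) : Prop :=
  forall xi eta, sq_summable xi -> sq_summable eta ->
    vec_functional xi eta @ F --> vec_functional xi eta a.

Definition normal_functional (f : vn_elt M -> R[i]^o) : Prop :=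
  forall (F : set_system (vn_elt M)) (a : vn_elt M),
    ProperFilter F -> sigma_weak_cvg F a -> f @ F --> f a.

Definition predual_pred : {pred vn_elt M -> R[i]^o} :=
  fun f => `[< linear f /\ normal_functional f >].

Record predual :=
  Predual { predual_fun :> vn_elt M -> R[i]^o;
            predualP : predual_fun \in predual_pred }.

Lemma predual_pred_submod : submod_closed predual_pred.
Proof.
split=> [|c f g /asboolP[lf nf] /asboolP[lg ng]]; apply/asboolP; split.
- by move=> a u v /=; rewrite scaler0 addr0.
- by move=> F a FF _; exact: cvg_cst.
- move=> a u v; rewrite !fctE lf lg !scalerDr !scalerA mulrC.
  by rewrite -!addrA; congr (_ + _); rewrite addrCA.
- move=> F a FF Fa; apply: cvgD; last exact: ng.
  by apply: cvgZl_tmp; exact: nf.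
Qed.

HB.instance Definition _ :=
  GRing.isSubmodClosed.Build R[i] (vn_elt M -> R[i]^o) predual_pred
    predual_pred_submod.
HB.instance Definition _ := [isSub for predual_fun].
HB.instance Definition _ := [Choice of predual by <:].
HB.instance Definition _ := [SubChoice_isSubLmodule of predual by <:].

(* Matrices over the predual are normed as completely bounded maps from M to
   scalar matrices. *)
Definition predual_norm (p q : nat) (f : 'M[predual]_(p, q)) : R :=
  sup [set s : R | exists n (a : 'M[vn_elt M]_n), vn_norm a <= 1 /\
    s = scalar_opnorm (\matrix_(u < p * n, v < q * n)
      (f (mxtens_unindex u).1 (mxtens_unindex v).1
         (a (mxtens_unindex u).2 (mxtens_unindex v).2) : R[i]))].

Definition predual_matNormed : matNormed R := MatNormed predual_norm.

End Elements.

Definition normal_map (H K : hilbert R) (M : vnAlg H) (N : vnAlg K)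
    (E : vn_elt M -> vn_elt N) : Prop :=
  forall (F : set_system (vn_elt M)) (a : vn_elt M),
    ProperFilter F -> sigma_weak_cvg F a -> sigma_weak_cvg (E @ F) (E a).

Section Generated.
Context (H : hilbert R) (S : set (blin H H)).

Definition gen_set : set (blin H H) :=
  [set a | forall A : vnAlg H, S `<=` vn_set A -> vn_set A a].

Lemma gen_star a b : gen_set a -> is_adjoint a b -> gen_set b.
Proof. by move=> Sa ab A SA; exact: vn_star (Sa _ SA) ab. Qed.

Lemma gen_bicommutant : commutant (commutant gen_set) = gen_set.
Proof.
apply/seteqP; split=> [a aS A SA|a Sa b bS xi]; last by rewrite bS.
rewrite -vn_bicommutant => b bA; apply: aS => c /(_ _ SA); exact: bA.
Qed.

(* The smallest von Neumann algebra containing S. *)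
Definition vn_gen : vnAlg H := VNAlg gen_star gen_bicommutant.

End Generated.

Section Tensor.
Context (H K : hilbert R) (HK : hilbert_tensor H K).
Context (M : vnAlg H) (N : vnAlg K).

Definition is_tensor (a : blin H H) (b : blin K K) (t : blin HK HK) : Prop :=
  forall h k, t (hit_tens HK h k) = hit_tens HK (a h) (b k).

Definition vn_tensor : vnAlg HK :=
  vn_gen [set t | exists (a : vn_elt M) (b : vn_elt N), is_tensor a b t].

Definition is_slice (f : predual M) (E : vn_elt vn_tensor -> vn_elt N) : Prop :=
  [/\ linear E, normal_map E &
      forall (a : vn_elt M) (b : vn_elt N) (t : vn_elt vn_tensor),
        is_tensor a b t -> E t = (f a : R[i]) *: b].

(* Definite description: such a map exists and is unique. *)
Definition slice (f : predual M) : vn_elt vn_tensor -> vn_elt N :=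
  xget (fun=> 0) (is_slice f).

Definition Tmap (x : vn_elt vn_tensor) :
    predual_matNormed M -> vn_matNormed N :=
  fun f => slice f x.

End Tensor.
End VonNeumann.

(* Main.v *)
(* Factor T_x = S_x R_x and T_y = S_y R_y through X and Y. The bilinear map
   (u, v) |-> S_x u * S_y v satisfies the Haagerup estimate, so it extends to a
   completely bounded S on X (x)^h Y. For the other factor, let theta be a bounded
   functional on X (x)^h Y and let omega_{h,k} be the functional a |-> <a h, k>.
   The form
     (h, k) |-> theta (R_x omega_{h,eta} (x) R_y omega_{xi,k})
   is bounded on all pairs of Bessel families, so it has a trace along orthonormal
   bases, and these traces are the coefficients <a_theta xi, eta> of an element
   a_theta of M. For f in M_*, theta |-> f a_theta is a bounded functional on the
   dual of X (x)^h Y, so by reflexivity it is evaluation at a point R f; a minimax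
   argument based on the Hahn-Banach theorem shows that R is completely bounded.
   Inserting a basis between x and y expands <xy (xi (x) k), eta (x) l> as the trace
   belonging to theta = <S _ k, l>, whence T_{xy} = S R. *)
Require Import Defs.
From HB Require Import structures.
From mathcomp Require Import all_boot all_order all_algebra.
From mathcomp Require Import complex mxtens.
From mathcomp Require Import all_classical all_reals all_analysis.
From mathcomp Require Import ring lra.
Set Implicit Arguments.
Unset Strict Implicit.
Unset Printing Implicit Defensive.

Import Order.TTheory GRing.Theory Num.Theory.
Import numFieldNormedType.Exports.

Local Open Scope classical_set_scope.
Local Open Scope ring_scope.

Local Notation Re := complex.Re.
Local Notation Im := complex.Im.

(** * Complex numbers and bounded linear maps *)

(** For a vector functional, R omega_{xi,eta} is formally the series over an orthonormal basis (e_i)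
    of R_x omega_{e_i,eta} (x) R_y omega_{xi,e_i}. Convergence is shown only for the values under
    each bounded functional theta, so the construction produces an element of the bidual, and
    reflexivity is what brings it back. The Haagerup norm fits because the omega_{e_i,eta} form a
    row and the omega_{xi,e_i} a column over the predual, of norms at most ||eta|| and ||xi||, and
    row times column is a Haagerup product. Bessel families are used instead of orthonormal ones
    because projections and images of basis vectors enter the proofs of convergence and of
    commutation. For complete boundedness the obstacle is that the operators a_theta are controlled
    only against finite systems of vector functionals, whereas the predual matrix norm is a supremum
    over contractive matrices in M. The minimax step converts the first kind of control into a
    factorization alpha^* B beta with B contractive and alpha, beta of Hilbert-Schmidt norm near 1,
    which the predual norm absorbs. *)

Lemma le_of_eq (disp : Order.disp_t) (T : porderType disp) (x y : T) : x = y -> (x <= y)%O.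
Proof. by move->. Qed.

Lemma linear_zero (R : pzRingType) (V W : lmodType R) (f : V -> W) : linear f -> f 0 = 0.
Proof. by move=> lf; have := lf (-1) 0 0; rewrite scaler0 addr0 scaleN1r addNr. Qed.

Lemma sum2_delta (V : nmodType) (I J : finType) (F : I -> J -> V) i j :
  (forall k l, (k != i) || (l != j) -> F k l = 0) -> \sum_k \sum_l F k l = F i j.
Proof.
move=> F0; rewrite (bigD1 i) //= (bigD1 j) //= big1 => [|l lj]; last by rewrite F0 ?lj ?orbT.
by rewrite addr0 big1 ?addr0 // => k ki; rewrite big1 // => l _; rewrite F0 ?ki.
Qed.

Section ComplexModulus.
Context (R : realType).
Local Notation C := R[i].
Implicit Types z w : C.

Definition cabs z : R := Re `|z|.

Lemma ReD z w : Re (z + w) = Re z + Re w. Proof. by case: z w => [a b] []. Qed.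
Lemma ImD z w : Im (z + w) = Im z + Im w. Proof. by case: z w => [a b] []. Qed.
Lemma ReN z : Re (- z) = - Re z. Proof. by case: z. Qed.
Lemma ImN z : Im (- z) = - Im z. Proof. by case: z. Qed.
Lemma ReB z w : Re (z - w) = Re z - Re w. Proof. by rewrite ReD ReN. Qed.
Lemma ImB z w : Im (z - w) = Im z - Im w. Proof. by rewrite ImD ImN. Qed.
Lemma Re_sum (I : Type) (r : seq I) (P : pred I) (F : I -> C) :
  Re (\sum_(i <- r | P i) F i) = \sum_(i <- r | P i) Re (F i).
Proof. exact: (big_morph _ ReD). Qed.
Lemma Re_mul z w : Re (z * w) = Re z * Re w - Im z * Im w.
Proof. by case: z w => [a b] []. Qed.
Lemma Re_realM (a : R) z : Re (a%:C%C * z) = a * Re z.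
Proof. by rewrite Re_mul /= mul0r subr0. Qed.
Lemma complexP z w : Re z = Re w -> Im z = Im w -> z = w.
Proof. by case: z w => [a b] [c e] /= -> ->. Qed.

Lemma cabsC z : `|z| = (cabs z)%:C%C.
Proof. by rewrite /cabs RRe_real // ger0_real. Qed.
Lemma cabs_ge0 z : 0 <= cabs z.
Proof. by rewrite -ler0c -cabsC. Qed.
Lemma cabsM z w : cabs (z * w) = cabs z * cabs w.
Proof. by apply: complexI; rewrite -cabsC normrM !cabsC rmorphM. Qed.
Lemma cabsD z w : cabs (z + w) <= cabs z + cabs w.
Proof. by rewrite -lecR rmorphD/= -!cabsC ler_normD. Qed.
Lemma cabsN z : cabs (- z) = cabs z. Proof. by rewrite /cabs normrN. Qed.
Lemma cabsB z w : cabs (z - w) <= cabs z + cabs w.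
Proof. by rewrite -(cabsN w) cabsD. Qed.
Lemma cabs_distC z w : cabs (z - w) = cabs (w - z).
Proof. by rewrite -cabsN opprB. Qed.
Lemma cabs0 : cabs 0 = 0. Proof. by rewrite /cabs normr0. Qed.
Lemma cabs1 : cabs 1 = 1. Proof. by rewrite /cabs normr1. Qed.
Lemma cabs_eq0 z : cabs z = 0 -> z = 0.
Proof. by move=> z0; apply/normr0_eq0; rewrite cabsC z0. Qed.
Lemma cabsR (a : R) : cabs a%:C%C = `|a|.
Proof. by rewrite /cabs normc_def /= expr0n /= addr0 sqrtr_sqr. Qed.
Lemma cabs_sum (I : Type) (r : seq I) (P : pred I) (F : I -> C) :
  cabs (\sum_(i <- r | P i) F i) <= \sum_(i <- r | P i) cabs (F i).
Proof.
elim/big_ind2 : _ => [|x1 x2 y1 y2 h1 h2|//]; first by rewrite cabs0.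
by rewrite (le_trans (cabsD _ _)) // lerD.
Qed.
Lemma mulJ z : z * z^* = (cabs z ^+ 2)%:C%C.
Proof. by rewrite -normCK cabsC rmorphXn. Qed.
Lemma mulJl z : z^* * z = (cabs z ^+ 2)%:C%C.
Proof. by rewrite mulrC mulJ. Qed.
Lemma cabsJ z : cabs z^* = cabs z. Proof. by rewrite /cabs norm_conjC. Qed.
Lemma cabs_sqr z : cabs z ^+ 2 = Re z ^+ 2 + Im z ^+ 2.
Proof. by rewrite /cabs normc_def /= sqr_sqrtr // addr_ge0 ?sqr_ge0. Qed.
Lemma Im_le z : `|Im z| <= cabs z.
Proof.
rewrite -(ler_pXn2r (n := 2)) // ?nnegrE ?cabs_ge0 //.
by rewrite cabs_sqr real_normK ?num_real // lerDr sqr_ge0.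
Qed.
Lemma Re_abs_le z : `|Re z| <= cabs z.
Proof.
rewrite -(ler_pXn2r (n := 2)) // ?nnegrE ?cabs_ge0 //.
by rewrite cabs_sqr real_normK ?num_real // lerDl sqr_ge0.
Qed.
Lemma Re_le z : Re z <= cabs z.
Proof. exact: le_trans (ler_norm _) (Re_abs_le z). Qed.
Lemma cabs_le_ReIm z : cabs z <= `|Re z| + `|Im z|.
Proof.
rewrite -(ler_pXn2r (n := 2)) ?nnegrE ?cabs_ge0 ?addr_ge0 //.
rewrite cabs_sqr sqrrD !real_normK ?num_real //.
have : 0 <= `|Re z| * `|Im z| by rewrite mulr_ge0.
by lra.
Qed.
Lemma ReJ z : Re z^* = Re z. Proof. by case: z. Qed.
Lemma ImJ z : Im z^* = - Im z. Proof. by case: z. Qed.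
Lemma conjR (a : R) : (a%:C%C)^* = a%:C%C.
Proof. by apply: complexP; rewrite ?ReJ ?ImJ //= oppr0. Qed.
(** Turns a modulus into the real part of a rotated value, so that estimates of real parts also
    bound moduli. *)
Lemma phase z : exists u : C, cabs u = 1 /\ u * z = (cabs z)%:C%C.
Proof.
have [->|z0] := eqVneq z 0.
  by exists 1; rewrite cabs1 mulr0 cabs0.
have c0 : cabs z != 0 by apply: contraNneq z0 => /cabs_eq0 ->.
exists (z^* * ((cabs z)^-1)%:C%C); split.
  by rewrite cabsM cabsJ cabsR ger0_norm ?invr_ge0 ?cabs_ge0 // divff.
by rewrite mulrAC mulJl -rmorphM /= expr2 mulfK.
Qed.
Lemma ltcRe (e : C) : 0 < e -> 0 < Re e /\ e = (Re e)%:C%C.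
Proof.
rewrite ltcE => /andP[/eqP ime ree]; split => //.
by apply: complexP => //=.
Qed.

End ComplexModulus.

Section NormedR.
Context (R : realType) (V : normedModType R[i]).
Implicit Types v w : V.

Lemma rnormC v : `|v| = (rnorm v)%:C%C.
Proof. by rewrite /rnorm RRe_real // ger0_real. Qed.
Lemma rnorm_ge0 v : 0 <= rnorm v.
Proof. by rewrite -ler0c -rnormC. Qed.
Lemma rnormD v w : rnorm (v + w) <= rnorm v + rnorm w.
Proof. by rewrite -lecR rmorphD/= -!rnormC ler_normD. Qed.
Lemma rnormN v : rnorm (- v) = rnorm v. Proof. by rewrite /rnorm normrN. Qed.
Lemma rnormB v w : rnorm (v - w) <= rnorm v + rnorm w.
Proof. by rewrite -(rnormN w) rnormD. Qed.
Lemma rnorm_distC v w : rnorm (v - w) = rnorm (w - v).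
Proof. by rewrite -rnormN opprB. Qed.
Lemma rnorm0 : rnorm (0 : V) = 0. Proof. by rewrite /rnorm normr0. Qed.
Lemma rnorm_eq0 v : rnorm v = 0 -> v = 0.
Proof. by move=> z0; apply/normr0_eq0; rewrite rnormC z0. Qed.
Lemma rnormZ (a : R[i]) v : rnorm (a *: v) = cabs a * rnorm v.
Proof. by apply: complexI; rewrite -rnormC normrZ rnormC cabsC rmorphM. Qed.
Lemma rnorm_sum (I : Type) (r : seq I) (P : pred I) (F : I -> V) :
  rnorm (\sum_(i <- r | P i) F i) <= \sum_(i <- r | P i) rnorm (F i).
Proof.
elim/big_ind2 : _ => [|x1 x2 y1 y2 h1 h2|//]; first by rewrite rnorm0.
by rewrite (le_trans (rnormD _ _)) // lerD.
Qed.

Lemma cvg_rnormP (T : Type) (F : set_system T) (FF : Filter F) (f : T -> V) l :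
  f @ F --> l <-> forall e : R, 0 < e -> \forall x \near F, rnorm (f x - l) < e.
Proof.
split=> [/cvgrPdist_lt fl e e0|h].
  have e0' : 0 < e%:C%C by rewrite ltcR.
  apply: filterS (fl _ e0') => x.
  by rewrite rnormC ltcR rnorm_distC.
apply/cvgrPdist_lt => e /ltcRe[e0 ->].
apply: filterS (h _ e0) => x.
by rewrite rnormC ltcR rnorm_distC.
Qed.

Lemma small_eq0 v : (forall e : R, 0 < e -> rnorm v <= e) -> v = 0.
Proof.
move=> h; apply: rnorm_eq0; apply/eqP; rewrite eq_le rnorm_ge0 andbT.
by apply/ler_addgt0Pl => e e0; rewrite addr0 h.
Qed.
End NormedR.

Lemma rnormCo (R : realType) (z : R[i]) : rnorm (z : R[i]^o) = cabs z.
Proof. by []. Qed.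

Section Blin.
Context (R : realType) (V W : normedModType R[i]).

Lemma blin_linear (f : blin V W) : linear f.
Proof. by have /asboolP[] := blinP f. Qed.

Lemma blinD (f : blin V W) u v : f (u + v) = f u + f v.
Proof. by have := blin_linear f 1 u v; rewrite !scale1r. Qed.
Lemma blin0 (f : blin V W) : f 0 = 0.
Proof. exact: linear_zero (blin_linear f). Qed.
Lemma blinZ (f : blin V W) a u : f (a *: u) = a *: f u.
Proof. by have := blin_linear f a u 0; rewrite blin0 !addr0. Qed.
Lemma blinN (f : blin V W) u : f (- u) = - f u.
Proof. by rewrite -scaleN1r blinZ scaleN1r. Qed.
Lemma blinB (f : blin V W) u v : f (u - v) = f u - f v.
Proof. by rewrite blinD blinN. Qed.
Lemma blin_sum (f : blin V W) (I : Type) (r : seq I) (P : pred I) (F : I -> V) :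
  f (\sum_(i <- r | P i) F i) = \sum_(i <- r | P i) f (F i).
Proof. by apply: (big_morph f); [exact: blinD|exact: blin0]. Qed.

Lemma blin_bounded (f : blin V W) :
  exists2 c : R, 0 <= c & forall v, rnorm (f v) <= c * rnorm v.
Proof.
have /asboolP[lf cf] := blinP f.
have /(_ 0) /cvg_rnormP /(_ _ ltr01) := cf; rewrite blin0.
case/nbhs_ballP => e /= /ltcRe[e0 eE] fe.
(* The vector [v] is rescaled to norm e / 2, strictly inside the ball on which [f] stays below 1. *)
exists (2 / Re e); first by rewrite divr_ge0 // ltW.
move=> v; have [v0|v0] := eqVneq (rnorm v) 0.
  by rewrite (rnorm_eq0 v0) blin0 !rnorm0 mulr0.
have vp : 0 < rnorm v by rewrite lt_neqAle eq_sym v0 rnorm_ge0.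
have cp : 0 < Re e / (2 * rnorm v) by rewrite divr_gt0 // mulr_gt0.
have : rnorm (f ((Re e / (2 * rnorm v))%:C%C *: v)) < 1.
  rewrite -[X in rnorm X]subr0; apply: fe.
  rewrite -ball_normE /ball_ /= sub0r normrN rnormC eE ltcR rnormZ cabsR.
  rewrite ger0_norm ?ltW // invfM mulrA mulfVK //.
  by rewrite ltr_pdivrMr // ltr_pMr // ltr1n.
rewrite blinZ rnormZ cabsR (ger0_norm (ltW cp)) => /ltW.
by rewrite -ler_pdivlMl // mulr1 invf_div mulrAC.
Qed.

Lemma blin_build (f : V -> W) (c : R) : linear f ->
  (forall v, rnorm (f v) <= c * rnorm v) -> {g : blin V W | forall v, g v = f v}.
Proof.
move=> lf bf.
suff H : f \in blin_pred V W by exists (Blin H).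
apply/asboolP; split => // x; apply/cvg_rnormP => e e0.
have c0 : 0 < `|c| + 1 by rewrite ltr_wpDl.
have : \forall y \near x, rnorm (y - x) < e / (`|c| + 1).
  by have /cvg_rnormP/(_ _ (divr_gt0 e0 c0)) := @cvg_id _ (nbhs x).
apply: filterS => y xy.
have -> : f y - f x = f (y - x).
  by have := lf (-1) x y; rewrite !scaleN1r [- x + y]addrC => ->; rewrite addrC.
apply: le_lt_trans (bf _) _.
rewrite ltr_pdivlMr // mulrC in xy.
apply: le_lt_trans xy; rewrite ler_wpM2r ?rnorm_ge0 //.
by rewrite (le_trans (ler_norm _)) // lerDl.
Qed.

End Blin.

(** * Inner products, the Riesz theorem and summable series *)

Section InnerProduct.
Context (R : realType) (V : lmodType R[i]).
Local Notation C := R[i].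

(** A positive semi-definite inner product on a bare module. The same facts then serve [H], the
    sequence space [l2], finite families and scalars. *)
Record ipspace := IPSpace {
  ip :> V -> V -> C;
  ip_lin : forall a u v w, ip (a *: u + v) w = a * ip u w + ip v w;
  ip_conj : forall u v, ip v u = (ip u v)^*;
  ip_ge0 : forall u, 0 <= ip u u }.

Variable d : ipspace.
Definition nrm (u : V) : R := Num.sqrt (Re (d u u)).

Lemma ipDl u v w : d (u + v) w = d u w + d v w.
Proof. by rewrite -[u]scale1r ip_lin mul1r scale1r. Qed.
Lemma ip0l w : d 0 w = 0.
Proof. by apply: (addrI (d 0 w)); rewrite -ipDl !addr0. Qed.
Lemma ipZl a u w : d (a *: u) w = a * d u w.
Proof. by rewrite -[a *: u]addr0 ip_lin ip0l addr0. Qed.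
Lemma ipNl u w : d (- u) w = - d u w.
Proof. by rewrite -scaleN1r ipZl mulN1r. Qed.
Lemma ipBl u v w : d (u - v) w = d u w - d v w.
Proof. by rewrite ipDl ipNl. Qed.
Lemma ip_suml (I : Type) (r : seq I) (P : pred I) (F : I -> V) w :
  d (\sum_(i <- r | P i) F i) w = \sum_(i <- r | P i) d (F i) w.
Proof. by apply: (big_morph (d^~ w)) => [u v|]; [exact: ipDl|exact: ip0l]. Qed.
Lemma ipDr u v w : d w (u + v) = d w u + d w v.
Proof. by rewrite ip_conj ipDl rmorphD /= -!ip_conj. Qed.
Lemma ip0r w : d w 0 = 0.
Proof. by rewrite ip_conj ip0l rmorph0. Qed.
Lemma ipZr a u w : d w (a *: u) = a^* * d w u.
Proof. by rewrite ip_conj ipZl rmorphM /= -!ip_conj. Qed.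
Lemma ipNr u w : d w (- u) = - d w u.
Proof. by rewrite ip_conj ipNl rmorphN /= -!ip_conj. Qed.
Lemma ipBr u v w : d w (u - v) = d w u - d w v.
Proof. by rewrite ipDr ipNr. Qed.
Lemma ip_sumr (I : Type) (r : seq I) (P : pred I) (F : I -> V) w :
  d w (\sum_(i <- r | P i) F i) = \sum_(i <- r | P i) d w (F i).
Proof. by apply: (big_morph (d w)) => [u v|]; [exact: ipDr|exact: ip0r]. Qed.

Lemma nrm_ge0 u : 0 <= nrm u. Proof. exact: sqrtr_ge0. Qed.
Lemma ip_nrm u : d u u = (nrm u ^+ 2)%:C%C.
Proof.
have := ip_ge0 d u; rewrite lecE => /andP[/eqP im re].
by apply: complexP => /=; rewrite ?sqr_sqrtr.
Qed.
Lemma nrm2 u : nrm u ^+ 2 = Re (d u u).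
Proof. by rewrite ip_nrm. Qed.
Lemma nrm0 : nrm 0 = 0. Proof. by rewrite /nrm ip0l sqrtr0. Qed.

Lemma nrm2D u v : nrm (u + v) ^+ 2 = nrm u ^+ 2 + nrm v ^+ 2 + 2 * Re (d u v).
Proof.
rewrite !nrm2 ipDl !ipDr !ReD (ip_conj d u v) ReJ; ring.
Qed.
Lemma nrm2Z a u : nrm (a *: u) ^+ 2 = cabs a ^+ 2 * nrm u ^+ 2.
Proof. by rewrite nrm2 ipZl ipZr mulrA mulJ ip_nrm -rmorphM. Qed.
Lemma nrmZ a u : nrm (a *: u) = cabs a * nrm u.
Proof.
apply/eqP; rewrite -(eqrXn2 (n := 2)) ?mulr_ge0 ?nrm_ge0 ?cabs_ge0 //.
by rewrite nrm2Z exprMn.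
Qed.
Lemma nrmN u : nrm (- u) = nrm u.
Proof. by rewrite -scaleN1r nrmZ cabsN cabs1 mul1r. Qed.
Lemma nrm2B u v : nrm (u - v) ^+ 2 = nrm u ^+ 2 + nrm v ^+ 2 - 2 * Re (d u v).
Proof. by rewrite nrm2D nrmN ipNr ReN mulrN. Qed.

Lemma cauchy_schwarz u v : cabs (d u v) <= nrm u * nrm v.
Proof.
rewrite -(ler_pXn2r (n := 2)) ?nnegrE ?mulr_ge0 ?nrm_ge0 ?cabs_ge0 //.
rewrite exprMn; set a := cabs _ ^+ 2; set P := nrm v ^+ 2; set Q := nrm u ^+ 2.
have a0 : 0 <= a by exact: sqr_ge0.
have P0 : 0 <= P by exact: sqr_ge0.
(* The squared norm of u - t <u,v> v as a quadratic in [t]. Its minimum at t = 1 / P gives the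
   inequality. The form may be degenerate: if P = 0 the expression is affine in [t] and, unless a =
   0, takes the impossible value -1 at t = (Q + 1) / (2 a). *)
have H t : 0 <= Q - 2 * t * a + t ^+ 2 * a * P.
  have := sqr_ge0 (nrm (u - (t%:C%C * d u v) *: v)).
  rewrite nrm2B nrm2Z ipZr rmorphM /= conjR -mulrA mulJl -rmorphM /=.
  rewrite cabsM cabsR exprMn real_normK ?num_real // -/a -/P -/Q.
  by lra.
have [P1|P1] := eqVneq P 0; last first.
  have Pp : 0 < P by rewrite lt_neqAle eq_sym P1.
  have := H P^-1; have -> : Q - 2 * P^-1 * a + P^-1 ^+ 2 * a * P = Q - a / P.
    by field.
  by rewrite subr_ge0 ler_pdivrMr.
have [->|a1] := eqVneq a 0; first by rewrite P1 mulr0.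
have := H ((Q + 1) / (2 * a)).
have -> : Q - 2 * ((Q + 1) / (2 * a)) * a + ((Q + 1) / (2 * a)) ^+ 2 * a * P = -1.
  by rewrite P1; field.
by rewrite ler0N1.
Qed.

Lemma nrmD u v : nrm (u + v) <= nrm u + nrm v.
Proof.
rewrite -(ler_pXn2r (n := 2)) ?nnegrE ?addr_ge0 ?nrm_ge0 //.
rewrite nrm2D; have := cauchy_schwarz u v; have := Re_le (d u v).
set a := nrm u; set b := nrm v; move=> h1 h2.
have -> : (a + b) ^+ 2 = a ^+ 2 + b ^+ 2 + 2 * (a * b) by ring.
lra.
Qed.
Lemma nrm_distC u v : nrm (u - v) = nrm (v - u).
Proof. by rewrite -nrmN opprB. Qed.
Lemma nrm_tri w u v : nrm (u - v) <= nrm (u - w) + nrm (w - v).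
Proof. by rewrite -{1}(subrK w u) -addrA nrmD. Qed.

Definition ip_complete := forall u : nat -> V,
  (forall e : R, 0 < e -> exists N, forall m n, (N <= m)%N -> (N <= n)%N ->
     nrm (u m - u n) < e) ->
  exists l, forall e : R, 0 < e -> exists N, forall n, (N <= n)%N -> nrm (u n - l) < e.

Definition near_set (P : set V) (y : V) := forall e : R, 0 < e ->
  exists2 p, P p & nrm (y - p) < e.

Hypothesis cV : ip_complete.

(** [P] is not assumed closed, so the foot of the perpendicular is found in its closure, as the
    limit of a minimizing sequence of points of [P]. *)
Lemma proj_exists (P : set V) (x : V) :
  P 0 -> (forall a u v, P u -> P v -> P (a *: u + v)) ->
  exists2 y, near_set P y & forall p, P p -> d (x - y) p = 0.
Proof.
move=> P0 Plin.
pose D := [set nrm (x - p) ^+ 2 | p in P].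
have hiD : has_inf D.
  split; first by exists (nrm (x - 0) ^+ 2), 0.
  by exists 0 => _ [p _ <-]; exact: sqr_ge0.
pose m := inf D.
have mlb p : P p -> m <= nrm (x - p) ^+ 2.
  by move=> Pp; apply: ge_inf; [case: hiD|exists p].
have m0 : 0 <= m.
  by apply: lb_le_inf; [case: hiD|move=> _ [q _ <-]; exact: sqr_ge0].
have app n : exists p, P p /\ nrm (x - p) ^+ 2 < m + n.+1%:R^-1.
  have [_ [p Pp <-] hp] := @inf_adherent _ D n.+1%:R^-1 (ltac:(by rewrite invr_gt0)) hiD.
  by exists p.
have [p hp] := choice app.
(* Parallelogram law: the midpoint of [u] and [v] is again in [P], hence at squared distance at
   least [m] from [x]. Minimizing sequences are therefore Cauchy. *)
have par (u v : V) : P u -> P v ->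
    nrm (u - v) ^+ 2 <= 2 * (nrm (x - u) ^+ 2 - m) + 2 * (nrm (x - v) ^+ 2 - m).
  move=> Pu Pv.
  have Pw : P ((2^-1%:C%C : C) *: u + (2^-1%:C%C : C) *: v).
    by apply: (Plin) => //; rewrite -[_ *: v]addr0; apply: (Plin).
  have := mlb _ Pw; set w := ((2^-1%:C%C : C) *: u + _) => mw.
  have e1 : x - w = (2^-1%:C%C : C) *: ((x - u) + (x - v)).
    rewrite /w addrACA scalerDr -opprD scalerN scalerDr.
    congr (_ - _); last by rewrite scalerDr.
    rewrite -[X in X + X]scale1r -scalerDl scalerA.
    have -> : (1 + 1) * (2^-1%:C%C : C) = 1; last by rewrite scale1r.
    by apply: complexP => /=; lra.
  have e2 : u - v = (x - v) - (x - u).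
    by rewrite opprB [RHS]addrC addrA subrK.
  move: mw; rewrite e1 e2 nrm2Z (nrm2D (x - u)) (nrm2B (x - v)) cabsR ger0_norm ?invr_ge0 //.
  rewrite (ip_conj d (x - u)) ReJ.
  set a := nrm (x - u) ^+ 2; set b := nrm (x - v) ^+ 2; set c := Re _; lra.
have [|y hy] := cV (u := p).
  move=> e e0.
  have e2 : 0 < e ^+ 2 / 4 by rewrite divr_gt0 // exprn_gt0.
  have [N _ hN] := near_infty_natSinv_lt (PosNum e2).
  exists N => i j Ni Nj.
  rewrite -(ltr_pXn2r (n := 2)) ?nnegrE ?nrm_ge0 ?ltW //.
  apply: le_lt_trans (par _ _ (hp i).1 (hp j).1) _.
  have := (hp i).2; have := (hp j).2.
  have hi : i.+1%:R^-1 < e ^+ 2 / 4 := hN _ Ni.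
  have hj : j.+1%:R^-1 < e ^+ 2 / 4 := hN _ Nj.
  move: hi hj; set s := i.+1%:R^-1; set t := j.+1%:R^-1.
  set a := nrm (x - p i) ^+ 2; set b := nrm (x - p j) ^+ 2; lra.
exists y.
  move=> e e0; have [N hN] := hy _ e0.
  by exists (p N); [case: (hp N)|rewrite nrm_distC hN].
have ym : nrm (x - y) ^+ 2 <= m.
  have : nrm (x - y) <= Num.sqrt m.
    apply/ler_addgt0Pr => e e0.
    have e2 : 0 < e / 2 by rewrite divr_gt0.
    have [N hN] := hy _ e2.
    have sm : 0 < (Num.sqrt m + e / 2) ^+ 2 - m.
      rewrite sqrrD sqr_sqrtr; last first.
        by apply: lb_le_inf; [case: hiD|move=> _ [q _ <-]; exact: sqr_ge0].
      have : 0 <= Num.sqrt m * (e / 2) by rewrite mulr_ge0 ?sqrtr_ge0 // ltW.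
      have : 0 < (e / 2) ^+ 2 by rewrite exprn_gt0.
      by lra.
    have [N' _ hN'] := near_infty_natSinv_lt (PosNum sm).
    set k := maxn N N'.
    have h1 := hN k (leq_maxl _ _).
    have h2 : nrm (x - p k) <= Num.sqrt m + e / 2.
      rewrite -(ler_pXn2r (n := 2)) ?nnegrE ?nrm_ge0 ?addr_ge0 ?sqrtr_ge0 ?ltW //.
      have := (hp k).2.
      have : k.+1%:R^-1 < (Num.sqrt m + e / 2) ^+ 2 - m := hN' k (leq_maxr _ _).
      set s := k.+1%:R^-1; lra.
    have := nrm_tri (p k) x y; lra.
  rewrite -(ler_pXn2r (n := 2)) ?nnegrE ?nrm_ge0 ?sqrtr_ge0 //.
  by rewrite (sqr_sqrtr m0).
have mw w : near_set P w -> m <= nrm (x - w) ^+ 2.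
  move=> nw.
  have : Num.sqrt m <= nrm (x - w).
    apply/ler_addgt0Pr => e e0; have [q Pq wq] := nw _ e0.
    have : Num.sqrt m <= nrm (x - q).
      by rewrite -[nrm _]ger0_norm ?nrm_ge0 // -sqrtr_sqr ler_wsqrtr // mlb.
    have := nrm_tri w x q; lra.
  by rewrite -(ler_pXn2r (n := 2)) ?nnegrE ?nrm_ge0 ?sqrtr_ge0 // (sqr_sqrtr m0).
move=> q Pq.
have H (t : R) : m <= nrm (x - (y + (t%:C%C * d (x - y) q) *: q)) ^+ 2.
  apply: mw => e e0; have [N hN] := hy _ e0.
  exists (p N + (t%:C%C * d (x - y) q) *: q).
    by rewrite addrC; apply: (Plin) => //; case: (hp N).
  by rewrite opprD addrACA subrr addr0 nrm_distC hN.
set r := x - y in ym H *.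
set a := cabs (d r q) ^+ 2; set b := nrm q ^+ 2.
have a0 : 0 <= a by exact: sqr_ge0.
have b0 : 0 <= b by exact: sqr_ge0.
(* The minimum is varied in the direction of <x - y, q> q. At t = 1 / (b + 1) one has t b <= 1, and
   2 t a <= (t a) (t b) then forces a = 0. *)
have K (t : R) : 2 * t * a <= t ^+ 2 * a * b.
  have := H t; rewrite opprD addrA -/r nrm2B ipZr rmorphM /= conjR -mulrA mulJl.
  rewrite -rmorphM /= nrm2Z cabsM cabsR exprMn real_normK ?num_real // -/a -/b.
  by lra.
apply: cabs_eq0; apply/eqP; rewrite -sqrf_eq0 -/a eq_le a0 andbT.
have b1 : 0 < b + 1 by rewrite ltr_wpDl.
have := K (b + 1)^-1; set s := (b + 1)^-1.
have s0 : 0 < s by rewrite invr_gt0.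
have sb : s * b <= 1 by rewrite mulrC ler_pdivrMr // mul1r lerDl.
have : s * a * (s * b) <= s * a by rewrite ler_piMr // mulr_ge0 // ltW.
have -> : s ^+ 2 * a * b = s * a * (s * b) by ring.
move=> h1 h2; rewrite -(pmulr_rle0 a s0); lra.
Qed.
End InnerProduct.

Section Riesz.
Context (R : realType) (V : lmodType R[i]) (d : ipspace V).
Hypothesis cV : ip_complete d.

Lemma riesz (phi : V -> R[i]) (c : R) :
  (forall a u v, phi (a *: u + v) = a * phi u + phi v) ->
  (forall u, cabs (phi u) <= c * nrm d u) ->
  exists y, forall x, phi x = d x y.
Proof.
move=> lphi bphi.
have phi0 : phi 0 = 0.
  apply: cabs_eq0; apply/eqP; rewrite eq_le cabs_ge0 andbT.
  by rewrite (le_trans (bphi _)) // nrm0 mulr0.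
have phiZ a u : phi (a *: u) = a * phi u.
  by rewrite -[a *: u]addr0 lphi phi0 addr0.
have phiB u v : phi (u - v) = phi u - phi v.
  by rewrite -scaleN1r addrC lphi mulN1r addrC.
have [all0|] := pselect (forall x, phi x = 0).
  by exists 0 => x; rewrite ip0r.
move/existsNP => [z /eqP z0].
have [|a u v /=|y0 ny0 hy0] := @proj_exists R V d cV [set x | phi x = 0] z.
- exact: phi0.
- by rewrite lphi => -> ->; rewrite mulr0 addr0.
have py0 : phi y0 = 0.
  apply: cabs_eq0; apply/eqP; rewrite eq_le cabs_ge0 andbT.
  apply/ler_addgt0Pl => e e0; rewrite addr0.
  have c1 : 0 < `|c| + 1 by rewrite ltr_wpDl.
  have [p pp hp] := ny0 _ (divr_gt0 e0 c1).
  rewrite -[phi y0]subr0 -pp -phiB (le_trans (bphi _)) //.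
  apply: le_trans (_ : (`|c| + 1) * nrm d (y0 - p) <= _).
    by rewrite ler_wpM2r ?nrm_ge0 // (le_trans (ler_norm _)) // lerDl.
  by rewrite -ler_pdivlMl // mulrC ltW.
set w := z - y0 in hy0.
have pw : phi w = phi z by rewrite /w phiB py0 subr0.
have w0 : d w w != 0.
  rewrite ip_nrm; apply: contraNneq z0 => w0; apply/eqP/cabs_eq0/eqP.
  rewrite eq_le cabs_ge0 andbT -pw (le_trans (bphi _)) //.
  by move/complexI/eqP : w0; rewrite sqrf_eq0 => /eqP ->; rewrite mulr0.
exists ((phi w / d w w)^* *: w) => x.
have pwx0 : phi w != 0 by rewrite pw.
have := hy0 (x - (phi x / phi w) *: w).
rewrite /= phiB phiZ divfK // subrr => /(_ erefl).
rewrite ipBr ipZr => /eqP; rewrite subr_eq0 => /eqP dwx.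
rewrite ipZr conjCK (ip_conj d w x) dwx rmorphM /= conjCK -(ip_conj d w w).
by field; rewrite w0 pwx0.
Qed.
End Riesz.

Section Hilbert.
Context (R : realType) (H : hilbert R).
Implicit Types x y z : H.

Lemma hdot_lin a x y z : hdot H (a *: x + y) z = a * hdot H x z + hdot H y z.
Proof. by rewrite linearPl. Qed.
Lemma hdot_conj x y : hdot H y x = (hdot H x y)^*.
Proof. by rewrite hermC /= expr0 mul1r. Qed.
Lemma hdot_ge0 x : 0 <= hdot H x x.
Proof. by rewrite hdotE exprn_ge0. Qed.

Definition hip : ipspace H := IPSpace hdot_lin hdot_conj hdot_ge0.

Lemma nrmE x : nrm hip x = rnorm x.
Proof.
rewrite /nrm /= hdotE rnormC -rmorphXn /= sqrtr_sqr ger0_norm //.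
exact: rnorm_ge0.
Qed.

Lemma hdotDl x y z : hdot H (x + y) z = hdot H x z + hdot H y z.
Proof. exact: (ipDl hip). Qed.
Lemma hdotDr x y z : hdot H z (x + y) = hdot H z x + hdot H z y.
Proof. exact: (ipDr hip). Qed.
Lemma hdotBl x y z : hdot H (x - y) z = hdot H x z - hdot H y z.
Proof. exact: (ipBl hip). Qed.
Lemma hdotBr x y z : hdot H z (x - y) = hdot H z x - hdot H z y.
Proof. exact: (ipBr hip). Qed.
Lemma hdotZl a x z : hdot H (a *: x) z = a * hdot H x z.
Proof. exact: (ipZl hip). Qed.
Lemma hdotZr a x z : hdot H z (a *: x) = a^* * hdot H z x.
Proof. exact: (ipZr hip). Qed.
Lemma hdot0l z : hdot H 0 z = 0. Proof. exact: (ip0l hip). Qed.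
Lemma hdot0r z : hdot H z 0 = 0. Proof. exact: (ip0r hip). Qed.
Lemma hdot_suml (I : Type) (r : seq I) (P : pred I) (F : I -> H) z :
  hdot H (\sum_(i <- r | P i) F i) z = \sum_(i <- r | P i) hdot H (F i) z.
Proof. exact: (ip_suml hip). Qed.
Lemma hdot_sumr (I : Type) (r : seq I) (P : pred I) (F : I -> H) z :
  hdot H z (\sum_(i <- r | P i) F i) = \sum_(i <- r | P i) hdot H z (F i).
Proof. exact: (ip_sumr hip). Qed.
Lemma hdot_nrm x : hdot H x x = (rnorm x ^+ 2)%:C%C.
Proof. by rewrite -nrmE; exact: (ip_nrm hip). Qed.
Lemma rnorm2E x : rnorm x ^+ 2 = Re (hdot H x x).
Proof. by rewrite hdot_nrm. Qed.
Lemma hdot_CS x y : cabs (hdot H x y) <= rnorm x * rnorm y.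
Proof. by rewrite -!nrmE; exact: (cauchy_schwarz hip). Qed.
Lemma rnorm2D x y : rnorm (x + y) ^+ 2 = rnorm x ^+ 2 + rnorm y ^+ 2 + 2 * Re (hdot H x y).
Proof. by rewrite -!nrmE; exact: (nrm2D hip). Qed.

Lemma hdot_eq x y : (forall z, hdot H x z = hdot H y z) -> x = y.
Proof.
move=> h; apply/eqP; rewrite -subr_eq0; apply/eqP/rnorm_eq0/eqP.
by rewrite -sqrf_eq0 rnorm2E hdotBl h subrr.
Qed.

Lemma complete_seq (V : completeNormedModType R[i]) (u : nat -> V) :
  (forall e : R, 0 < e -> exists N, forall m n, (N <= m)%N -> (N <= n)%N ->
     rnorm (u m - u n) < e) ->
  exists l, forall e : R, 0 < e -> exists N, forall n, (N <= n)%N -> rnorm (u n - l) < e.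
Proof.
move=> cu.
have : cvg (u @ \oo).
  apply/cauchy_cvgP/cauchy_exP => e /ltcRe[e0 ->].
  have [N hN] := cu _ e0; exists (u N).
  exists N => // n /= Nn.
  by rewrite -ball_normE /ball_ /= rnormC ltcR hN.
move=> /cvg_ex[l /cvg_rnormP ul]; exists l => e /ul[N _ hN].
by exists N => n Nn; apply: hN.
Qed.

Lemma hip_complete : ip_complete hip.
Proof.
move=> u cu; have [|l hl] := @complete_seq H u.
  by move=> e /cu[N hN]; exists N => m n Nm Nn; rewrite -nrmE hN.
by exists l => e /hl[N hN]; exists N => n Nn; rewrite nrmE hN.
Qed.

Lemma hriesz (phi : H -> R[i]) (c : R) :
  (forall a u v, phi (a *: u + v) = a * phi u + phi v) ->
  (forall u, cabs (phi u) <= c * rnorm u) ->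
  exists y, forall x, phi x = hdot H x y.
Proof.
move=> lphi bphi; apply: (riesz hip_complete lphi (c := c)) => u.
by rewrite nrmE.
Qed.
End Hilbert.

Section Operators.
Context (R : realType).

Lemma blin_ext (V W : normedModType R[i]) (f g : blin V W) :
  (forall v, f v = g v) -> f = g.
Proof. by move=> h; apply: val_inj; apply/funext. Qed.

Lemma rnorm_le_hdot (K : hilbert R) (x : K) (c : R) : 0 <= c ->
  (forall y, cabs (hdot K x y) <= c * rnorm y) -> rnorm x <= c.
Proof.
move=> c0 /(_ x); rewrite hdot_nrm cabsR ger0_norm ?sqr_ge0 // expr2.
have [->//|x0] := eqVneq (rnorm x) 0.
by rewrite ler_pM2r // lt_neqAle eq_sym x0 rnorm_ge0.
Qed.

Lemma form_op (H K : hilbert R) (b : H -> K -> R[i]) (c : R) : 0 <= c ->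
  (forall a u v k, b (a *: u + v) k = a * b u k + b v k) ->
  (forall a u v h, b h (a *: u + v) = a^* * b h u + b h v) ->
  (forall h k, cabs (b h k) <= c * rnorm h * rnorm k) ->
  exists2 T : blin H K, (forall h, rnorm (T h) <= c * rnorm h) &
     forall h k, hdot K (T h) k = b h k.
Proof.
move=> c0 b1 b2 bb.
have ex h : exists y, forall k, (b h k)^* = hdot K k y.
  apply: (hriesz (c := c * rnorm h)) => [a u v|u].
    by rewrite b2 rmorphD rmorphM /= conjCK.
  by rewrite cabsJ bb.
have [T hT] := choice ex.
have TE h k : hdot K (T h) k = b h k by rewrite hdot_conj -hT conjCK.
have Tb h : rnorm (T h) <= c * rnorm h.
  apply: rnorm_le_hdot => [|k]; first by rewrite mulr_ge0 ?rnorm_ge0.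
  by rewrite TE.
have lT : linear T.
  by move=> a u v; apply: hdot_eq => k; rewrite hdot_lin !TE b1.
have [g hg] := blin_build lT Tb.
by exists g => [h|h k]; rewrite hg.
Qed.

Lemma adjoint_exists (H : hilbert R) (a : blin H H) : exists b, is_adjoint a b.
Proof.
have [c c0 ac] := blin_bounded a.
have [||h k|T _ hT] := @form_op H H (fun h k => hdot H h (a k)) c c0.
- by move=> *; rewrite hdot_lin.
- by move=> s u v h; rewrite blin_linear hdotDr hdotZr.
- rewrite (le_trans (hdot_CS _ _)) // mulrAC mulrC.
  by rewrite ler_wpM2r ?rnorm_ge0.
by exists T => xi eta; rewrite (hdot_conj (T eta)) hT -hdot_conj.
Qed.

Lemma adjointC (H : hilbert R) (a b : blin H H) : is_adjoint a b -> is_adjoint b a.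
Proof. by move=> ab x y; rewrite hdot_conj -ab -hdot_conj. Qed.

End Operators.

Section ComplexLimits.
Context (R : realType).
Local Notation C := R[i].

(** Completeness of the real line, one coordinate at a time. The filter is arbitrary because limits
    are taken along sequences and along the directed system of orthonormal families. *)
Lemma complex_cauchy (T : Type) (F : set_system T) (FF : ProperFilter F) (f : T -> C) :
  (forall e : R, 0 < e -> exists z, \forall x \near F, cabs (f x - z) < e) ->
  exists l : C, forall e : R, 0 < e -> \forall x \near F, cabs (f x - l) < e.
Proof.
move=> cf.
have H (g : C -> R) : (forall z w, `|g z - g w| <= cabs (z - w)) ->
    exists l : R, forall e, 0 < e -> \forall x \near F, `|g (f x) - l| < e.
  move=> hg.
  have : cvg ((g \o f) @ F).
    apply/cauchy_cvgP/cauchy_exP => e e0.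
    have [z hz] := cf _ e0; exists (g z).
    apply: filterS hz => x xz; rewrite /= -ball_normE /ball_ /= distrC.
    exact: le_lt_trans xz.
  move=> /cvg_ex[l /cvgrPdist_lt fl]; exists l => e /fl.
  by apply: filterS => x; rewrite distrC.
have [a ha] := H (@complex.Re R) (ltac:(by move=> z w; rewrite -ReB Re_abs_le)).
have [b hb] := H (@complex.Im R) (ltac:(by move=> z w; rewrite -ImB Im_le)).
exists (a +i* b)%C => e e0; have e2 : 0 < e / 2 by rewrite divr_gt0.
apply: filterS2 (ha _ e2) (hb _ e2) => x xa xb.
apply: le_lt_trans (cabs_le_ReIm _) _; rewrite ReB ImB /=; lra.
Qed.

Lemma clim_unique (T : Type) (F : set_system T) (FF : ProperFilter F) (f : T -> C) l l' :
  (forall e : R, 0 < e -> \forall x \near F, cabs (f x - l) < e) ->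
  (forall e : R, 0 < e -> \forall x \near F, cabs (f x - l') < e) -> l = l'.
Proof.
move=> h h'; apply/eqP; rewrite -subr_eq0; apply/eqP/(@small_eq0 R (R[i]^o)).
move=> e e0; rewrite rnormCo; have e2 : 0 < e / 2 by rewrite divr_gt0.
have [x [x1 x2]] := filter_ex (filterI (h _ e2) (h' _ e2)).
have -> : l - l' = (f x - l') - (f x - l) by rewrite opprB [RHS]addrC addrA subrK.
by rewrite (le_trans (cabsB _ _)) //; lra.
Qed.
Lemma clim_lin (T : Type) (F : set_system T) (FF : Filter F) (g h : T -> C) (l m c : C) :
  (forall e : R, 0 < e -> \forall x \near F, cabs (g x - l) < e) ->
  (forall e : R, 0 < e -> \forall x \near F, cabs (h x - m) < e) ->
  forall e : R, 0 < e -> \forall x \near F, cabs (c * g x + h x - (c * l + m)) < e.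
Proof.
move=> gl hm e e0; have s0 : 0 < cabs c + 1 by rewrite ltr_wpDl ?cabs_ge0.
have q0 : 0 < e / (cabs c + 1) by rewrite divr_gt0.
apply: filterS2 (gl _ q0) (hm _ q0) => x h1 h2.
rewrite opprD addrACA -mulrBr; apply: le_lt_trans (cabsD _ _) _; rewrite cabsM.
have E : cabs c * (e / (cabs c + 1)) + e / (cabs c + 1) = e by field; rewrite gt_eqF.
by rewrite -[ltRHS]E; apply: ler_ltD => //; rewrite ler_wpM2l ?cabs_ge0 // ltW.
Qed.
End ComplexLimits.

Section ComplexSeries.
Context (R : realType).
Local Notation C := R[i].
Implicit Types (u v : nat -> C) (l : C).

Definition csum u l := forall e : R, 0 < e ->
  exists N, forall n, (N <= n)%N -> cabs (\sum_(i < n) u i - l) < e.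

Lemma csumP u l : csum u l <-> series (u : nat -> R[i]^o) @ \oo --> (l : R[i]^o).
Proof.
split=> [ul|/cvg_rnormP ul].
  apply/cvg_rnormP => e /ul[N hN]; exists N => // n /= Nn.
  by rewrite rnormCo /series /= big_mkord hN.
move=> e /ul[N _ hN]; exists N => n /= Nn.
by have := hN _ Nn; rewrite /= rnormCo /series /= big_mkord.
Qed.

Lemma csum_near u l : csum u l <->
  forall e : R, 0 < e -> \forall n \near \oo, cabs (\sum_(i < n) u i - l) < e.
Proof.
split=> h e /h[N]; first by exists N.
by move=> _ hN; exists N.
Qed.

Lemma csum_unique u l l' : csum u l -> csum u l' -> l = l'.
Proof. by move=> /csum_near h /csum_near; apply: clim_unique h. Qed.

Lemma csumD u v l m : csum u l -> csum v m -> csum (fun n => u n + v n) (l + m).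
Proof.
move=> ul vm e e0; have e2 : 0 < e / 2 by rewrite divr_gt0.
have [N hN] := ul _ e2; have [M hM] := vm _ e2.
exists (maxn N M) => n; rewrite geq_max => /andP[Nn Mn].
rewrite big_split /= opprD addrACA (le_lt_trans (cabsD _ _)) //.
have := hN _ Nn; have := hM _ Mn; lra.
Qed.

Lemma csumZ a u l : csum u l -> csum (fun n => a * u n) (a * l).
Proof.
move=> ul e e0; have a1 : 0 < cabs a + 1 by rewrite ltr_wpDl // cabs_ge0.
have [N hN] := ul _ (divr_gt0 e0 a1); exists N => n /hN.
rewrite ltr_pdivlMr // => h; apply: le_lt_trans h.
by rewrite -mulr_sumr -mulrBr cabsM mulrC ler_wpM2l ?cabs_ge0 // lerDl.
Qed.

Lemma csumJ u l : csum u l -> csum (fun n => (u n)^*) l^*.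
Proof.
move=> ul e /ul[N hN]; exists N => n /hN.
by rewrite -cabsJ rmorphB /= rmorph_sum.
Qed.

Lemma csum0 : csum (fun=> 0) 0.
Proof. by move=> e e0; exists 0%N => n _; rewrite big1 // subr0 cabs0. Qed.

Lemma csum_fin u K : (forall n, (K <= n)%N -> u n = 0) -> csum u (\sum_(i < K) u i).
Proof.
move=> u0 e e0; exists K => n Kn.
rewrite -(subnKC Kn) big_split_ord /= [X in _ + X - _]big1 ?addr0 ?subrr ?cabs0 //.
by move=> i _; rewrite u0 // leq_addr.
Qed.

Lemma csum_le u l (B : R) : csum u l -> (forall n, \sum_(i < n) cabs (u i) <= B) ->
  cabs l <= B.
Proof.
move=> ul uB; apply/ler_addgt0Pr => e /ul[N /(_ _ (leqnn N))] h.
have -> : l = \sum_(i < N) u i - (\sum_(i < N) u i - l) by rewrite opprB addrC subrK.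
apply: le_trans (cabsB _ _) _; apply: lerD; last exact: ltW.
exact: le_trans (cabs_sum _ _ _) (uB _).
Qed.

Lemma bounded_sup (s : nat -> R) (B : R) : {homo s : m n / (m <= n)%N >-> m <= n} ->
  (forall n, s n <= B) ->
  exists S, (forall n, s n <= S) /\ S <= B /\
   forall e, 0 < e -> exists N, forall n, (N <= n)%N -> S - e < s n.
Proof.
move=> ms sB; pose D := [set s n | n in setT].
have hD : has_sup D.
  by split; [exists (s 0%N), 0%N|exists B => _ [n _ <-]].
exists (sup D); split; first by move=> n; apply: ub_le_sup; [case: hD|exists n].
split; first by apply: ge_sup => [|_ [n _ <-]//]; case: hD.
move=> e e0; have [_ [N _ <-] hN] := sup_adherent e0 hD.
by exists N => n Nn; apply: lt_le_trans hN _; apply: ms.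
Qed.

Lemma psum_homo (a : nat -> R) : (forall n, 0 <= a n) ->
  {homo (fun n => \sum_(i < n) a i) : m n / (m <= n)%N >-> m <= n}.
Proof.
move=> a0 m n mn; rewrite -(subnKC mn) big_split_ord /= lerDl.
by rewrite sumr_ge0.
Qed.

Lemma csum_abs u (B : R) : (forall n, \sum_(i < n) cabs (u i) <= B) ->
  exists2 l, csum u l & cabs l <= B.
Proof.
move=> uB.
have [S [sS [_ hS]]] := bounded_sup (psum_homo (fun n => cabs_ge0 (u n))) uB.
have [e /hS[N hN]|l /csum_near ul] :=
    @complex_cauchy R nat \oo _ (fun n => \sum_(i < n) u i).
  exists (\sum_(i < N) u i); exists N => // n /= Nn.
  have := hN _ (leqnn N); have := sS n.
  rewrite -(subnKC Nn) !big_split_ord /= [X in cabs (X - _)]addrC addrK => h1 h2.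
  apply: le_lt_trans (cabs_sum _ _ _) _.
  by move: h1 h2; set x := \sum_(i < N) _; set y := \sum_(_ < _) _; lra.
by exists l => //; exact: csum_le ul uB.
Qed.

(** Lists a double array as one sequence along the encoding of pairs by integers, so that a
    square-summable double array of vectors becomes a square-summable sequence. Positions that
    encode no pair get the default [z]. *)
Definition flat (T : Type) (z : T) (a : nat -> nat -> T) (p : nat) : T :=
  if pickle_inv p is Some nm then a nm.1 nm.2 else z.

Lemma pickle_inv_bound P : exists K, forall p nm, (p < P)%N ->
  pickle_inv p = Some nm :> option (nat * nat) -> (nm.1 < K)%N /\ (nm.2 < K)%N.
Proof.
elim: P => [|P [K hK]]; first by exists 0%N.
case E : (pickle_inv P : option (nat * nat)) => [[n m]|].
  exists (maxn K (maxn n.+1 m.+1)) => p nm; rewrite ltnS leq_eqVlt => /orP[/eqP ->|pP].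
    by rewrite E => -[<-] /=; rewrite !leq_max !leqnn !orbT.
  by move=> /(hK _ _ pP)[h1 h2]; rewrite !leq_max h1 h2.
exists K => p nm; rewrite ltnS leq_eqVlt => /orP[/eqP ->|pP]; first by rewrite E.
exact: hK.
Qed.

Lemma sum_flat (V : zmodType) (a : nat -> nat -> V) P N M :
  (forall p nm, (p < P)%N -> pickle_inv p = Some nm :> option (nat * nat) ->
     (nm.1 < N)%N /\ (nm.2 < M)%N) ->
  \sum_(p < P) flat 0 a p =
  \sum_(n < N) \sum_(m < M) (if (pickle (n : nat, m : nat) < P)%N then a n m else 0).
Proof.
move=> hK.
have step (p : 'I_P) : flat 0 a p = \sum_(n < N) \sum_(m < M)
    (if pickle (n : nat, m : nat) == p then a n m else 0).
  rewrite /flat; case E : (pickle_inv p : option (nat * nat)) => [[n0 m0]|].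
    have [n0N m0M] := hK _ _ (ltn_ord p) E; rewrite /= in n0N m0M.
    have Ep : pickle (n0, m0) = p.
      by have := @pickle_invK (nat * nat)%type p; rewrite E.
    rewrite (sum2_delta (i := Ordinal n0N) (j := Ordinal m0M)) ?Ep ?eqxx // => n m nm.
    rewrite -Ep (inj_eq (pcan_inj pickleK)) xpair_eqE -[n0]/(val (Ordinal n0N)).
    by rewrite -[m0]/(val (Ordinal m0M)) !val_eqE; case/orP: nm => /negbTE ->; rewrite ?andbF.
  rewrite big1 // => n _; rewrite big1 // => m _; case: eqP => // h.
  by move: E; rewrite -h pickleK_inv.
under eq_bigr do rewrite step.
rewrite exchange_big; apply: eq_bigr => n _.
rewrite exchange_big; apply: eq_bigr => m _ /=.
case: ifPn => [lt|nlt].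
  rewrite (bigD1 (Ordinal lt)) //= eqxx big1 ?addr0 // => p pp.
  by case: eqP => // h; case/eqP: pp; apply: val_inj; rewrite /= h.
rewrite big1 // => p _; case: eqP => // h.
by move: nlt; rewrite h ltn_ord.
Qed.

Lemma flat_bound (a : nat -> nat -> R) (B : R) : (forall n m, 0 <= a n m) ->
  (forall N M, \sum_(n < N) \sum_(m < M) a n m <= B) ->
  forall P, \sum_(p < P) flat 0 a p <= B.
Proof.
move=> a0 aB P; have [K hK] := pickle_inv_bound P.
rewrite (sum_flat a hK) (le_trans _ (aB K K)) //.
by apply: ler_sum => n _; apply: ler_sum => m _; case: ifP.
Qed.

Lemma csum_sum (I : Type) (s : seq I) (u : I -> nat -> C) (l : I -> C) :
  (forall i, csum (u i) (l i)) ->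
  csum (fun n => \sum_(i <- s) u i n) (\sum_(i <- s) l i).
Proof.
move=> ul; elim: s => [|i s IH].
  rewrite big_nil (_ : (fun n => _) = fun=> 0); first exact: csum0.
  by apply/funext => n; rewrite big_nil.
rewrite big_cons.
rewrite (_ : (fun n => _) = fun n => u i n + \sum_(j <- s) u j n).
  exact: csumD (ul i) IH.
by apply/funext => n; rewrite big_cons.
Qed.

(** Fubini for absolutely summable double arrays. A rectangle containing all pairs encoded below [P]
    differs from the flat partial sum at [P] by at most the absolute mass not yet collected at [P],
    which is below e / 3. *)
Lemma csum_flat (a : nat -> nat -> C) (r : nat -> C) l (B : R) :
  (forall N M, \sum_(n < N) \sum_(m < M) cabs (a n m) <= B) ->
  (forall n, csum (a n) (r n)) -> csum (flat 0 a) l -> csum r l.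
Proof.
move=> aB ar al e e0.
have e3 : 0 < e / 3 by rewrite divr_gt0.
pose b n m := cabs (a n m).
have b0 n m : 0 <= b n m by exact: cabs_ge0.
have fb0 p : 0 <= flat 0 b p by rewrite /flat; case: pickle_inv.
have [S [sS [_ hS]]] := bounded_sup (psum_homo fb0) (flat_bound b0 aB).
have [N1 hN1] := al _ e3; have [N2 hN2] := hS _ e3.
pose P := maxn N1 N2; have [K hK] := pickle_inv_bound P.
exists K => N KN.
have rN : csum (fun m => \sum_(n < N) a n m) (\sum_(n < N) r n).
  have -> : \sum_(n < N) r n = \sum_(n <- iota 0 N) r n.
    by rewrite -(big_mkord xpredT r) /index_iota subn0.
  rewrite [X in csum X](_ : _ = fun m => \sum_(n <- iota 0 N) a n m).
    exact: csum_sum.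
  apply/funext => m.
  by rewrite -(big_mkord xpredT (fun n => a n m)) /index_iota subn0.
have [M' hM] := rN _ e3; pose M := maxn M' K.
have h3 := hM M (leq_maxl _ _).
have h1 := hN1 P (leq_maxl _ _).
have h2 := hN2 P (leq_maxr _ _).
have hNM p nm : (p < P)%N -> pickle_inv p = Some nm :> option (nat * nat) ->
     (nm.1 < N)%N /\ (nm.2 < M)%N.
  move=> pP E; have [x y] := hK _ _ pP E; split; first exact: leq_trans KN.
  exact: leq_trans y (leq_maxr _ _).
(* The whole rectangle is encoded below some [P'], so its absolute mass is bounded by the total mass
   [S]. *)
have rect : \sum_(n < N) \sum_(m < M) b n m <= S.
  have [P' hP'] : exists P', forall n m, (n < N)%N -> (m < M)%N -> (pickle (n, m) < P')%N.
    exists (\max_(n < N) \max_(m < M) (pickle (n : nat, m : nat)).+1)%N.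
    move=> n m nN mM.
    apply: leq_trans (leq_bigmax (Ordinal nN)).
    exact: (leq_trans _ (leq_bigmax (Ordinal mM))).
  have [K' hK'] := pickle_inv_bound P'.
  have := sS P'; rewrite (sum_flat b (N := maxn N K') (M := maxn M K')).
    move=> h; apply: le_trans h.
    have aux (k k' : nat) (F : nat -> R) : (forall i, 0 <= F i) -> (k <= k')%N ->
        \sum_(i < k) F i <= \sum_(i < k') F i.
      by move=> F0 kk; apply: psum_homo.
    have hin n m : 0 <= (if (pickle (n, m) < P')%N then b n m else 0) by case: ifP.
    apply: le_trans (aux N (maxn N K') (fun n => \sum_(m < maxn M K')
       (if (pickle (n, m : nat) < P')%N then b n m else 0)) _ _); last 2 first.
    - by move=> n; apply: sumr_ge0.
    - exact: leq_maxl.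
    apply: ler_sum => n _.
    apply: le_trans (aux M (maxn M K') (fun m =>
       (if (pickle (n : nat, m : nat) < P')%N then b n m else 0)) _ _); last 2 first.
    - by move=> m.
    - exact: leq_maxl.
    by apply: ler_sum => m _; rewrite hP'.
  move=> p nm pP E; have [x y] := hK' _ _ pP E.
  by rewrite !leq_max x y !orbT.
have key : cabs (\sum_(n < N) \sum_(m < M) a n m - \sum_(p < P) flat 0 a p) <= e / 3.
  rewrite (sum_flat a hNM); move: h2; rewrite (sum_flat b hNM) => h2.
  have : cabs (\sum_(n < N) \sum_(m < M) a n m - \sum_(n < N) \sum_(m < M)
       (if (pickle (n : nat, m : nat) < P)%N then a n m else 0))
     <= \sum_(n < N) \sum_(m < M) b n m - \sum_(n < N) \sum_(m < M)
       (if (pickle (n : nat, m : nat) < P)%N then b n m else 0).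
    rewrite -!sumrB; apply: le_trans (cabs_sum _ _ _) _; apply: ler_sum => n _.
    rewrite -!sumrB; apply: le_trans (cabs_sum _ _ _) _; apply: ler_sum => m _.
    by case: ifP; rewrite ?subrr ?cabs0 // !subr0.
  move: h2 rect; set x := \sum_(_ < _) _; set y := \sum_(n < _) \sum_(_ < _) b _ _.
  by move=> ? ? ?; lra.
have {}h3 : cabs (\sum_(n < N) \sum_(m < M) a n m - \sum_(n < N) r n) < e / 3.
  by rewrite exchange_big.
set x := \sum_(n < N) \sum_(m < M) a n m in h3 key.
set y := \sum_(_ < P) _ in key h1.
have -> : \sum_(n < N) r n - l = (x - y) + (y - l) - (x - \sum_(n < N) r n).
  by rewrite addrA subrK opprB [RHS]addrC addrA subrK.
have := cabsB (x - y + (y - l)) (x - \sum_(n < N) r n).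
have := cabsD (x - y) (y - l).
lra.
Qed.
End ComplexSeries.

(** * Square-summable sequences and amplifications *)

Section SquareSummable.
Context (R : realType) (H : hilbert R).
Local Notation C := R[i].

(** Bounded partial sums rather than convergence: such bounds are easily added and survive
    coordinatewise limits. [sq_summableP] identifies the two conditions. *)
Definition l2_pred : {pred nat -> H} :=
  fun f => `[< exists B : R, forall n, \sum_(i < n) rnorm (f i) ^+ 2 <= B >].

Lemma l2P (f : nat -> H) : reflect (exists B : R, forall n, \sum_(i < n) rnorm (f i) ^+ 2 <= B)
  (f \in l2_pred).
Proof. exact: asboolP. Qed.

Lemma l2_submod : submod_closed l2_pred.
Proof.
split=> [|c f g /l2P[A hA] /l2P[B hB]]; apply/l2P.
  by exists 0 => n; rewrite big1 // => i _; rewrite rnorm0 expr0n.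
exists (2 * (cabs c ^+ 2 * A) + 2 * B) => n.
apply: le_trans (_ : 2 * (cabs c ^+ 2 * \sum_(i < n) rnorm (f i) ^+ 2)
   + 2 * \sum_(i < n) rnorm (g i) ^+ 2 <= _); last first.
  by apply: lerD; rewrite ler_pM2l // ler_wpM2l // sqr_ge0.
rewrite !mulr_sumr -big_split; apply: ler_sum => i _ /=.
apply: le_trans (_ : (cabs c * rnorm (f i) + rnorm (g i)) ^+ 2 <= _).
  rewrite ler_pXn2r ?nnegrE ?addr_ge0 ?mulr_ge0 ?cabs_ge0 ?rnorm_ge0 //.
  by rewrite (le_trans (rnormD _ _)) // rnormZ.
rewrite -exprMn; set a := cabs c * _; set b := rnorm _.
have := sqr_ge0 (a - b); rewrite sqrrB sqrrD; lra.
Qed.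

Record l2 := L2 { l2_fun :> nat -> H; l2_prop : l2_fun \in l2_pred }.
HB.instance Definition _ :=
  GRing.isSubmodClosed.Build R[i] (nat -> H) l2_pred l2_submod.
HB.instance Definition _ := [isSub for l2_fun].
HB.instance Definition _ := [Choice of l2 by <:].
HB.instance Definition _ := [SubChoice_isSubLmodule of l2 by <:].

Lemma l2_linE c (f g : l2) n : (c *: f + g) n = c *: f n + g n.
Proof. by []. Qed.
Lemma l2_BE (f g : l2) n : (f - g) n = f n - g n.
Proof. by []. Qed.
Lemma l2_ext (f g : l2) : (forall n, f n = g n) -> f = g.
Proof. by move=> h; apply: val_inj; apply/funext. Qed.

Lemma l2_dot_abs (f g : nat -> H) (A B : R) :
  (forall n, \sum_(i < n) rnorm (f i) ^+ 2 <= A) ->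
  (forall n, \sum_(i < n) rnorm (g i) ^+ 2 <= B) ->
  forall n, \sum_(i < n) cabs (hdot H (f i) (g i)) <= 2^-1 * (A + B).
Proof.
move=> hA hB n; apply: le_trans (_ : \sum_(i < n) 2^-1 * (rnorm (f i) ^+ 2 + rnorm (g i) ^+ 2) <= _).
  apply: ler_sum => i _; rewrite (le_trans (hdot_CS _ _)) //.
  have := sqr_ge0 (rnorm (f i) - rnorm (g i)); rewrite sqrrB; lra.
by rewrite -mulr_sumr ler_pM2l ?invr_gt0 // big_split lerD.
Qed.

Lemma l2_dot_ex (f g : l2) : exists l, csum (fun n => hdot H (f n) (g n)) l.
Proof.
have /l2P[A hA] := l2_prop f; have /l2P[B hB] := l2_prop g.
by have [l hl _] := @csum_abs R (fun n => hdot H (f n) (g n)) _ (l2_dot_abs hA hB); exists l.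
Qed.

Definition l2_dot (f g : l2) : C := sval (cid (l2_dot_ex f g)).
Lemma l2_dotP (f g : l2) : csum (fun n => hdot H (f n) (g n)) (l2_dot f g).
Proof. by rewrite /l2_dot; case: cid. Qed.

Lemma l2_dot_lin a (u v w : l2) : l2_dot (a *: u + v) w = a * l2_dot u w + l2_dot v w.
Proof.
apply: csum_unique (l2_dotP _ _) _.
rewrite (_ : (fun n => _) = fun n => a * hdot H (u n) (w n) + hdot H (v n) (w n)).
  by apply: csumD; [apply: csumZ|]; exact: l2_dotP.
by apply/funext => n; rewrite l2_linE hdot_lin.
Qed.
Lemma l2_dot_conj (u v : l2) : l2_dot v u = (l2_dot u v)^*.
Proof.
apply: csum_unique (l2_dotP _ _) _.
rewrite (_ : (fun n => _) = fun n => (hdot H (u n) (v n))^*).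
  by apply: csumJ; exact: l2_dotP.
by apply/funext => n; rewrite -hdot_conj.
Qed.

Lemma l2_dot_self (u : l2) : Im (l2_dot u u) = 0 /\
  forall n, \sum_(i < n) rnorm (u i) ^+ 2 <= Re (l2_dot u u).
Proof.
have E n : \sum_(i < n) hdot H (u i) (u i) = (\sum_(i < n) rnorm (u i) ^+ 2)%:C%C.
  by rewrite rmorph_sum; apply: eq_bigr => i _; rewrite hdot_nrm.
have du := l2_dotP u u.
split.
  apply/eqP; rewrite -normr_eq0 eq_le normr_ge0 andbT.
  apply/ler_addgt0Pl => e /du[N /(_ _ (leqnn N))]; rewrite E addr0 cabs_distC => h.
  by apply: le_trans (ltW h); apply: le_trans (Im_le _); rewrite ImB /= subr0.
move=> n; apply/ler_addgt0Pr => e /du[N /(_ (maxn N n) (leq_maxl _ _))].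
rewrite E => h; apply: le_trans (_ : \sum_(i < maxn N n) rnorm (u i) ^+ 2 <= _).
  by apply: (psum_homo (fun i => sqr_ge0 (rnorm (u i)))); exact: leq_maxr.
have := Re_le ((\sum_(i < maxn N n) rnorm (u i) ^+ 2)%:C%C - l2_dot u u).
rewrite ReB /=; lra.
Qed.
Lemma l2_dot_ge0 (u : l2) : 0 <= l2_dot u u.
Proof.
have [im re] := l2_dot_self u; rewrite lecE im eqxx /=.
by have := re 0%N; rewrite big_ord0.
Qed.

Definition l2ip : ipspace l2 := IPSpace l2_dot_lin l2_dot_conj l2_dot_ge0.

Lemma l2_psum_le (u : l2) n : \sum_(i < n) rnorm (u i) ^+ 2 <= nrm l2ip u ^+ 2.
Proof. by rewrite nrm2; have [_] := l2_dot_self u. Qed.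

Lemma l2_nrm_le (u : l2) (B : R) :
  (forall n, \sum_(i < n) rnorm (u i) ^+ 2 <= B) -> nrm l2ip u ^+ 2 <= B.
Proof.
move=> uB; rewrite nrm2 (le_trans (Re_le _)) //; apply: csum_le (l2_dotP u u) _ => n.
rewrite (le_trans _ (uB n)) //; apply: ler_sum => i _.
by rewrite hdot_nrm cabsR ger0_norm ?sqr_ge0.
Qed.

Lemma l2_coord_le (u : l2) i : rnorm (u i) <= nrm l2ip u.
Proof.
rewrite -(ler_pXn2r (n := 2)) ?nnegrE ?rnorm_ge0 ?nrm_ge0 //.
rewrite (le_trans _ (l2_psum_le u i.+1)) // big_ord_recr /= lerDr.
by apply: sumr_ge0 => j _; exact: sqr_ge0.
Qed.

Lemma l2_eq0 (u : l2) : nrm l2ip u = 0 -> u = 0.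
Proof.
move=> u0; apply: l2_ext => n; apply: rnorm_eq0; apply/eqP.
by rewrite eq_le rnorm_ge0 andbT -u0 l2_coord_le.
Qed.

Lemma l2_complete : ip_complete l2ip.
Proof.
move=> u cu.
have cux i : exists x, forall e : R, 0 < e -> exists N, forall n, (N <= n)%N ->
    rnorm (u n i - x) < e.
  apply: complete_seq => e /cu[N hN]; exists N => m n Nm Nn.
  by rewrite -l2_BE (le_lt_trans (l2_coord_le _ _)) // hN.
have [x hx] := choice cux.
have ux (e : R) : 0 < e -> exists N, forall k, (N <= k)%N -> forall n,
    \sum_(i < n) rnorm (u k i - x i) ^+ 2 <= e ^+ 2.
  move=> e0; have e2 : 0 < e / 2 by rewrite divr_gt0.
  have [N hN] := cu _ e2; exists N => k Nk n.
  have n1 : 0 < (n.+1)%:R :> R by rewrite ltr0n.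
  (* Each of the first [n] coordinates may err by e / (2 (n + 1)), so that together they contribute
     at most (e / 2)^2. With the factor 2 from (a + b)^2 <= 2 (a^2 + b^2) the total is e^2. *)
  have sq : 0 < e / 2 / n.+1%:R by rewrite divr_gt0.
  have [M hM] : exists M, forall i : 'I_n, forall m, (M <= m)%N ->
      rnorm (u m i - x i) < e / 2 / n.+1%:R.
    have [f hf] := choice (fun i => hx i _ sq).
    exists (\max_(i < n) f i)%N => i m Mm; apply: hf.
    exact: leq_trans (leq_bigmax i) Mm.
  pose m := maxn N M.
  have h1 := hN k m Nk (leq_maxl _ _).
  pose v := u k - u m.
  have h2 := l2_psum_le v n.
  have v0 : 0 <= nrm l2ip v by exact: nrm_ge0.
  apply: le_trans (_ : \sum_(i < n) 2 * (rnorm (v i) ^+ 2 + (e / 2 / n.+1%:R) ^+ 2) <= _).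
    apply: ler_sum => i _.
    have -> : u k i - x i = v i + (u m i - x i) by rewrite l2_BE addrA subrK.
    apply: le_trans (_ : (rnorm (v i) + rnorm (u m i - x i)) ^+ 2 <= _).
      by rewrite ler_pXn2r ?nnegrE ?addr_ge0 ?rnorm_ge0 // rnormD.
    have := hM i m (leq_maxr _ _); set b := rnorm (u m i - x i) => hb.
    have hb2 : b ^+ 2 <= (e / 2 / n.+1%:R) ^+ 2.
      by rewrite ler_pXn2r ?nnegrE ?rnorm_ge0 ?(ltW sq) // ltW.
    move: hb2; set q := (e / 2 / _) ^+ 2; set a := rnorm (v i).
    by have := sqr_ge0 (a - b); rewrite sqrrB sqrrD => ? ?; lra.
  rewrite -mulr_sumr big_split /= sumr_const card_ord.
  have : nrm l2ip v ^+ 2 <= (e / 2) ^+ 2.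
    by rewrite ler_pXn2r ?nnegrE ?(ltW e2) // ltW.
  have : (e / 2 / n.+1%:R) ^+ 2 *+ n <= (e / 2) ^+ 2.
    rewrite exprMn -mulrnAr ler_piMr ?sqr_ge0 // -mulr_natr expr2 -mulrA.
    apply: mulr_ile1; rewrite ?invr_ge0 ?mulr_ge0 ?invr_ge0 ?ler0n //.
      by rewrite invf_le1 // ler1n.
    by rewrite mulrC ler_pdivrMr // mul1r ler_nat.
  have -> : (e / 2) ^+ 2 = e ^+ 2 / 4 by field.
  move: h2; set X := \sum_(_ < _) _; set Y := _ *+ n; lra.
have xl2 : x \in l2_pred.
  have [N /(_ _ (leqnn N)) hN] := ux 1 ltr01.
  have xl : (fun i => u N i - x i) \in l2_pred by apply/l2P; exists (1 ^+ 2).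
  rewrite (_ : x = (u N : nat -> H) - (fun i => u N i - x i)).
    by rewrite rpredB // l2_prop.
  by apply/funext => i; rewrite !fctE opprB addrC subrK.
exists (L2 xl2) => e e0; have e2 : 0 < e / 2 by rewrite divr_gt0.
have [N hN] := ux _ e2; exists N => n Nn.
have : nrm l2ip (u n - L2 xl2) <= e / 2; last by lra.
rewrite -(ler_pXn2r (n := 2)) ?nnegrE ?nrm_ge0 ?(ltW e2) //.
by apply: l2_nrm_le => k; exact: hN.
Qed.

Lemma sq_summableP (f : nat -> H) : sq_summable f <-> f \in l2_pred.
Proof.
have E n : \sum_(i < n) (`|f i| ^+ 2 : C) = (\sum_(i < n) rnorm (f i) ^+ 2)%:C%C.
  by rewrite rmorph_sum; apply: eq_bigr => i _; rewrite rnormC -rmorphXn.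
split.
  move=> /cvg_ex[l /csumP hl]; apply/l2P; have [N hN] := hl _ ltr01.
  exists (Re l + 1) => n; have := hN (maxn N n) (leq_maxl _ _); rewrite E => h.
  apply: le_trans (_ : \sum_(i < maxn N n) rnorm (f i) ^+ 2 <= _).
    by apply: (psum_homo (fun i => sqr_ge0 (rnorm (f i)))); exact: leq_maxr.
  have := Re_le ((\sum_(i < maxn N n) rnorm (f i) ^+ 2)%:C%C - l).
  rewrite ReB /=; lra.
move=> /l2P[B hB]; have [l hl _] := @csum_abs R (fun n => `|f n| ^+ 2) B
   (ltac:(move=> n; rewrite (le_trans _ (hB n)) //; apply: ler_sum => i _;
     by rewrite rnormC -rmorphXn cabsR ger0_norm // sqr_ge0)).
by apply/cvg_ex; exists l; apply/csumP.
Qed.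

End SquareSummable.

Section Amplification.
Context (R : realType) (H : hilbert R).
Local Notation C := R[i].
Local Notation l2 := (l2 H).
Local Notation l2ip := (l2ip H).

Lemma amp_proof (a : blin H H) (f : l2) : (fun n => a (f n)) \in @l2_pred R H.
Proof.
have [c c0 ac] := blin_bounded a; have /l2P[B hB] := l2_prop f.
apply/l2P; exists (c ^+ 2 * B) => n.
rewrite (le_trans _ (ler_wpM2l (sqr_ge0 _) (hB n))) // mulr_sumr.
apply: ler_sum => i _; rewrite -exprMn.
by rewrite ler_pXn2r ?nnegrE ?mulr_ge0 ?rnorm_ge0.
Qed.
(** The operator a (x) 1 on H (x) l^2. A functional sum_n <a xi_n, eta_n> is then a single
    coefficient <amp a xi, eta>. *)
Definition amp (a : blin H H) (f : l2) : l2 := L2 (amp_proof a f).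

Lemma amp_lin a c f g : amp a (c *: f + g) = c *: amp a f + amp a g.
Proof. by apply: l2_ext => n; exact: (blin_linear a c (f n) (g n)). Qed.
Lemma ampB a f g : amp a (f - g) = amp a f - amp a g.
Proof. by apply: l2_ext => n; exact: (blinB a (f n) (g n)). Qed.

Lemma amp_bounded a : exists2 c : R, 0 < c & forall f, nrm l2ip (amp a f) <= c * nrm l2ip f.
Proof.
have [c c0 ac] := blin_bounded a; exists (c + 1); first by rewrite ltr_wpDl.
move=> f; rewrite -(ler_pXn2r (n := 2)) ?nnegrE ?mulr_ge0 ?nrm_ge0 ?addr_ge0 //.
apply: l2_nrm_le => n; rewrite exprMn.
rewrite (le_trans _ (ler_wpM2l (sqr_ge0 _) (l2_psum_le f n))) // mulr_sumr.
apply: ler_sum => i _; rewrite -exprMn.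
rewrite ler_pXn2r ?nnegrE ?mulr_ge0 ?rnorm_ge0 ?addr_ge0 //.
by rewrite (le_trans (ac _)) // ler_wpM2r ?rnorm_ge0 // lerDl.
Qed.

Lemma amp_adj a b f g : is_adjoint a b -> l2ip (amp a f) g = l2ip f (amp b g).
Proof.
move=> ab; apply: csum_unique (l2_dotP _ _) _ => /=.
rewrite (_ : (fun n => _) = fun n => hdot H (f n) (amp b g n)); first exact: l2_dotP.
by apply/funext => n; rewrite /= ab.
Qed.

Lemma single_proof (j : nat) (h : H) : (fun n => if n == j then h else 0) \in @l2_pred R H.
Proof.
apply/l2P; exists (rnorm h ^+ 2) => n.
have [jn|nj] := ltnP j n.
  rewrite (bigD1 (Ordinal jn)) //= eqxx big1 ?addr0 // => i ij.
  by case: eqP => [ji|]; [case/eqP: ij; apply: val_inj|rewrite rnorm0 expr0n].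
rewrite big1 ?sqr_ge0 // => i _; case: eqP => [ij|]; last by rewrite rnorm0 expr0n.
by move: (ltn_ord i); rewrite ij ltnNge nj.
Qed.
Definition single j h : l2 := L2 (single_proof j h).

Lemma single_lin j c h k : single j (c *: h + k) = c *: single j h + single j k.
Proof.
by apply: l2_ext => n; rewrite l2_linE /=; case: eqP => // _; rewrite scaler0 addr0.
Qed.
Lemma single_nrm j h : nrm l2ip (single j h) <= rnorm h.
Proof.
rewrite -(ler_pXn2r (n := 2)) ?nnegrE ?rnorm_ge0 ?nrm_ge0 //.
apply: l2_nrm_le => n.
have [jn|nj] := ltnP j n.
  rewrite (bigD1 (Ordinal jn)) //= eqxx big1 ?addr0 // => i ij.
  by case: eqP => [ji|]; [case/eqP: ij; apply: val_inj|rewrite rnorm0 expr0n].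
rewrite big1 ?sqr_ge0 // => i _ /=; case: eqP => [ij|]; last by rewrite rnorm0 expr0n.
by move: (ltn_ord i); rewrite ij ltnNge nj.
Qed.
Lemma amp_single a j h : amp a (single j h) = single j (a h).
Proof. by apply: l2_ext => n /=; case: eqP => // _; rewrite blin0. Qed.

Lemma l2_trunc (f : l2) (e : R) : 0 < e ->
  exists N, forall n, (N <= n)%N -> nrm l2ip (f - \sum_(j < n) single j (f j)) <= e.
Proof.
move=> e0.
have sv (m : nat) (i : nat) : (\sum_(j < m) single j (f j)) i = if (i < m)%N then f i else 0.
  have -> : (\sum_(j < m) single j (f j)) i = \sum_(j < m) (single j (f j) i).
    exact: (big_morph (fun g : l2 => g i)).
  case: ifPn => [im|im].
    rewrite (bigD1 (Ordinal im)) //= eqxx big1 ?addr0 // => j ji.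
    by case: eqP => // ij; case/eqP: ji; apply: val_inj.
  rewrite big1 // => j _ /=; case: eqP => // ij.
  by move: im; rewrite ij ltn_ord.
have [S [sS [_ hS]]] := bounded_sup (psum_homo (fun n => sqr_ge0 (rnorm (f n)))) (l2_psum_le f).
have e2 : 0 < e ^+ 2 by rewrite exprn_gt0.
have [N hN] := hS _ e2; exists N => n Nn.
rewrite -(ler_pXn2r (n := 2)) ?nnegrE ?nrm_ge0 ?(ltW e0) //.
apply: l2_nrm_le => m.
have -> : \sum_(i < m) rnorm ((f - \sum_(j < n) single j (f j)) i) ^+ 2 =
   \sum_(i < m) (if (i < n)%N then 0 else rnorm (f i) ^+ 2).
  apply: eq_bigr => i _; rewrite l2_BE sv; case: ifP => _.
    by rewrite subrr rnorm0 expr0n.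
  by rewrite subr0.
have := hN _ Nn; have := sS (maxn m n).
have -> : \sum_(i < maxn m n) rnorm (f i) ^+ 2 = \sum_(i < n) rnorm (f i) ^+ 2 +
  \sum_(i < maxn m n) (if (i < n)%N then 0 else rnorm (f i) ^+ 2).
  have nm : (n <= maxn m n)%N by exact: leq_maxr.
  rewrite -(subnKC nm) !big_split_ord /=; congr (_ + _).
  rewrite [X in _ = X + _]big1 ?add0r; last by move=> i _; rewrite ltn_ord.
  by apply: eq_bigr => i _; rewrite ltnNge leq_addr.
have : \sum_(i < m) (if (i < n)%N then 0 else rnorm (f i) ^+ 2) <=
  \sum_(i < maxn m n) (if (i < n)%N then 0 else rnorm (f i) ^+ 2).
  apply: (psum_homo (a := fun i => if (i < n)%N then 0 else rnorm (f i) ^+ 2)).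
    by move=> i; case: ifP => // _; exact: sqr_ge0.
  exact: leq_maxl.
set X := \sum_(i < m) _; set Y := \sum_(i < maxn m n) _; set Z := \sum_(_ < _) _; lra.
Qed.
End Amplification.

(** * Normal functionals and slice maps *)

Section ClosedSpan.
Context (R : realType) (V : lmodType R[i]) (d : ipspace V) (P : set V).
Hypothesis P0 : P 0.
Hypothesis Plin : forall a u v, P u -> P v -> P (a *: u + v).
Local Notation near_set := (near_set d).

Lemma near_lin a u v : near_set P u -> near_set P v -> near_set P (a *: u + v).
Proof.
move=> hu hv e e0; have c0 : 0 < cabs a + 1 by rewrite ltr_wpDl // cabs_ge0.
have e2 : 0 < e / 2 by rewrite divr_gt0.
have [p Pp up] := hu _ (divr_gt0 e2 c0); have [q Pq vq] := hv _ e2.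
exists (a *: p + q); first exact: Plin.
rewrite opprD addrACA -scalerBr (le_lt_trans (nrmD _ _ _)) // nrmZ.
rewrite ltr_pdivlMr // in up.
have : cabs a * nrm d (u - p) <= nrm d (u - p) * (cabs a + 1).
  by rewrite mulrC ler_wpM2l ?nrm_ge0 // lerDl.
by lra.
Qed.

Lemma near_sub u : P u -> near_set P u.
Proof. by move=> Pu e e0; exists u => //; rewrite subrr nrm0. Qed.

Lemma perp_near w y : (forall q, P q -> d w q = 0) -> near_set P y -> d w y = 0.
Proof.
move=> wP ny; apply: (@small_eq0 R (R[i]^o)) => e e0; rewrite rnormCo.
have c0 : 0 < nrm d w + 1 by rewrite ltr_wpDl // nrm_ge0.
have [q Pq yq] := ny _ (divr_gt0 e0 c0).
have -> : d w y = d w (y - q) by rewrite ipBr (wP _ Pq) subr0.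
rewrite (le_trans (cauchy_schwarz _ _ _)) //.
rewrite ltr_pdivlMr // in yq.
rewrite (le_trans _ (ltW yq)) // mulrC ler_wpM2l ?nrm_ge0 // lerDl //.
Qed.

Lemma perp_near_eq0 w : (forall q, P q -> d w q = 0) -> near_set P w -> nrm d w = 0.
Proof. by move=> h /(perp_near h); rewrite /nrm => ->; rewrite sqrtr0. Qed.

Lemma near_nrm_le x y : near_set P y -> (forall q, P q -> d (x - y) q = 0) ->
  nrm d y <= nrm d x.
Proof.
move=> ny h; have h0 := perp_near h ny.
rewrite -(ler_pXn2r (n := 2)) ?nnegrE ?nrm_ge0 //.
by rewrite -[x in leRHS](subrK y) nrm2D h0 mulr0 addr0 lerDr sqr_ge0.
Qed.
End ClosedSpan.

Section Density.
Context (R : realType) (H : hilbert R).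
Local Notation C := R[i].
Local Notation l2 := (l2 H).
Local Notation l2ip := (l2ip H).

Lemma commutant_sub (S T : set (blin H H)) : S `<=` T -> commutant T `<=` commutant S.
Proof. by move=> ST b hb a /ST; exact: hb. Qed.
Lemma sub_bicommutant (S : set (blin H H)) : S `<=` commutant (commutant S).
Proof. by move=> a Sa b hb xi; rewrite hb. Qed.
Lemma tricommutant (S : set (blin H H)) :
  commutant (commutant (commutant S)) = commutant S.
Proof.
apply/seteqP; split; first exact/commutant_sub/sub_bicommutant.
exact: sub_bicommutant.
Qed.

Lemma commutant_star (S : set (blin H H)) :
  (forall a b, S a -> is_adjoint a b -> S b) ->
  forall a b, commutant S a -> is_adjoint a b -> commutant S b.
Proof.
move=> hS a b Sa ab s Ss xi; have [s' ss'] := adjoint_exists s.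
apply: hdot_eq => y.
have ba := adjointC ab.
rewrite ss' ba -(Sa _ (hS _ _ Ss ss')).
by rewrite ba -ss'.
Qed.

Lemma gen_sub_bicommutant (S : set (blin H H)) :
  (forall a b, S a -> is_adjoint a b -> S b) ->
  gen_set S `<=` commutant (commutant S).
Proof.
move=> hS z; pose A := VNAlg (commutant_star (commutant_star hS)) (tricommutant _).
by move=> /(_ A); apply; exact: sub_bicommutant.
Qed.

(** The linear span as an intersection of subspaces: a linear property of its members is proved by
    taking for [Q] the subspace of operators that satisfy it. *)
Definition opspan (S : set (blin H H)) : set (blin H H) :=
  [set t | forall Q : set (blin H H), S `<=` Q -> Q 0 ->
     (forall (c : C) u v, Q u -> Q v -> Q (c *: u + v)) -> Q t].

(* The projection p onto the closure of {a xi : a in S} commutes with the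
   amplification of S, so its matrix entries lie in the commutant of S; hence p
   commutes with the amplification of z and fixes z xi. *)
Lemma density (S : set (blin H H)) :
  (forall a b, S a -> S b -> S (blin_comp a b)) ->
  (forall a b, S a -> is_adjoint a b -> S b) ->
  (exists2 i, S i & forall h, i h = h) ->
  forall xi eta : l2, (forall a, S a -> l2ip (amp a xi) eta = 0) ->
  forall z, gen_set S z -> l2ip (amp z xi) eta = 0.
Proof.
move=> Scomp Sstar [one S1 oneE] xi eta S0 z /(gen_sub_bicommutant Sstar) zS.
pose A := opspan S.
have A0 : A 0 by move=> Q.
have Alin (c : C) u v : A u -> A v -> A (c *: u + v).
  by move=> Au Av Q SQ Q0 Ql; apply: (Ql); [exact: Au|exact: Av].
have SA s t : S s -> A t -> A (blin_comp s t).
  move=> Ss At; apply: (At [set t | A (blin_comp s t)]).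
  - by move=> a Sa /= Q SQ Q0 Ql; apply/SQ/Scomp.
  - rewrite /= (_ : blin_comp s 0 = 0) //.
    by apply: blin_ext => h /=; rewrite blin0.
  - move=> c u v /= hu hv.
    rewrite (_ : blin_comp s (c *: u + v) = c *: blin_comp s u + blin_comp s v).
      exact: Alin.
    by apply: blin_ext => h; exact: (blin_linear s c (u h) (v h)).
have ampl (c : C) (u v : blin H H) (f : l2) : amp (c *: u + v) f = c *: amp u f + amp v f.
  exact: l2_ext.
have amp0 (f : l2) : amp 0 f = 0 by exact: l2_ext.
pose P := [set amp t xi | t in A].
have P0 : P 0 by exists 0.
have Plin (c : C) u v : P u -> P v -> P (c *: u + v).
  by move=> [s As <-] [t At <-]; exists (c *: s + t); [exact: Alin|exact: ampl].
have PS s u : S s -> P u -> P (amp s u).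
  by move=> Ss [t At <-]; exists (blin_comp s t); [exact: SA|exact: l2_ext].
have Pperp q : P q -> l2ip q eta = 0.
  move=> [t At <-]; apply: (At [set t | l2ip (amp t xi) eta = 0]) => //.
    by change (l2ip (amp 0 xi) eta = 0); rewrite amp0 ip0l.
  move=> c u v Qu Qv; change (l2ip (amp (c *: u + v) xi) eta = 0).
  by rewrite ampl ip_lin Qu Qv mulr0 addr0.
have nlin := @near_lin R l2 l2ip P Plin.
have [p hp] := choice (fun x =>
  let: ex_intro2 y a b := proj_exists (@l2_complete R H) x P0 Plin in
  ex_intro (fun y => near_set l2ip P y /\ forall q, P q -> l2ip (x - y) q = 0)
    y (conj a b)).
have puniq x y : near_set l2ip P y -> (forall q, P q -> l2ip (x - y) q = 0) -> y = p x.
  move=> ny hy; have [np hpx] := hp x.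
  have w0 : nrm l2ip (y - p x) = 0.
    apply: (perp_near_eq0 (P := P)).
      move=> q Pq; have := hy _ Pq; have := hpx _ Pq.
      rewrite !ipBl => /eqP; rewrite subr_eq0 => /eqP <- /eqP.
      by rewrite subr_eq0 => /eqP <-; rewrite subrr.
    by rewrite -scaleN1r addrC; exact: (nlin _ _ _ np ny).
  by apply/eqP; rewrite -subr_eq0; apply/eqP/l2_eq0.
have plin (c : C) x y : p (c *: x + y) = c *: p x + p y.
  have [nx hx] := hp x; have [ny hy] := hp y.
  symmetry; apply: puniq; first exact: (nlin _ _ _ nx ny).
  by move=> q Pq; rewrite opprD addrACA -scalerBr ipDl ipZl hx // hy // mulr0 addr0.
have pnrm x : nrm l2ip (p x) <= nrm l2ip x.
  by have [nx hx] := hp x; exact: near_nrm_le hx.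
have pcomm s x : S s -> amp s (p x) = p (amp s x).
  move=> Ss; have [nx hx] := hp x; have [s' ss'] := adjoint_exists s.
  apply: puniq.
    move=> e e0; have [c c0 hc] := amp_bounded s.
    have [q Pq xq] := nx _ (divr_gt0 e0 c0).
    exists (amp s q); first exact: PS.
    by rewrite -ampB (le_lt_trans (hc _)) // mulrC -ltr_pdivlMr.
  move=> q Pq; rewrite -ampB (amp_adj _ _ ss'); apply: hx.
  by apply: PS => //; exact: Sstar ss'.
have Tex ij : exists T : blin H H, forall h, T h = p (single ij.2 h) ij.1.
  have [|h|T hT] := @blin_build R H H (fun h => p (single ij.2 h) ij.1) 1.
  - by move=> c u v; rewrite single_lin plin.
  - rewrite mul1r (le_trans (l2_coord_le _ _)) // (le_trans (pnrm _)) //.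
    exact: single_nrm.
  by exists T.
have [T hT] := choice Tex.
have zT ij h : z (T ij h) = T ij (z h).
  symmetry; apply: zS => s Ss k.
  by rewrite !hT -amp_single -pcomm.
have pxi : p xi = xi.
  symmetry; apply: puniq; last by move=> q Pq; rewrite subrr ip0l.
  apply: near_sub; exists one; last by apply: l2_ext => n /=.
  by move=> Q SQ _ _; apply: SQ.
have pB x y : p (x - y) = p x - p y.
  by rewrite -scaleN1r addrC plin scaleN1r addrC.
have p0 : p 0 = 0.
  by apply: l2_eq0; apply/eqP; rewrite eq_le nrm_ge0 andbT (le_trans (pnrm _)) ?nrm0.
have psum (n : nat) (F : nat -> l2) : p (\sum_(j < n) F j) = \sum_(j < n) p (F j).
  apply: (big_morph p) => // x y.
  by have := plin 1 x y; rewrite !scale1r.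
have sumE (n : nat) (F : nat -> l2) i : (\sum_(j < n) F j) i = \sum_(j < n) F j i.
  exact: (big_morph (fun g : l2 => g i)).
(* Row [i] of the matrix of [p] acts as a norm-convergent series, so the commutation of [z] with the
   entries passes from finite sums to [p] itself. *)
have coord_app (f : l2) i (e : R) : 0 < e -> exists N, forall n, (N <= n)%N ->
    rnorm (p f i - \sum_(j < n) T (i, j : nat) (f j)) <= e.
  move=> e0; have [N hN] := l2_trunc f e0; exists N => n /hN hn.
  have -> : \sum_(j < n) T (i, j : nat) (f j) = p (\sum_(j < n) single j (f j)) i.
    rewrite (psum n (fun j => single j (f j))) (sumE n (fun j => p (single j (f j)))).
    by apply: eq_bigr => j _; rewrite hT.
  rewrite -l2_BE -pB (le_trans (l2_coord_le _ _)) // (le_trans (pnrm _)) //.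
have pz : p (amp z xi) = amp z xi.
  apply: l2_ext => i; apply/eqP; rewrite -subr_eq0; apply/eqP/small_eq0 => e e0.
  have [c c0 zc] := blin_bounded z.
  have c1 : 0 < c + 1 by rewrite ltr_wpDl.
  have e2 : 0 < e / 2 by rewrite divr_gt0.
  have [N hN] := coord_app (amp z xi) i _ e2.
  have [N' hN'] := coord_app xi i _ (divr_gt0 e2 c1).
  pose n := maxn N N'.
  have h1 := hN n (leq_maxl _ _); have h2 := hN' n (leq_maxr _ _).
  rewrite pxi ler_pdivlMr // in h2.
  have h3 : rnorm (z (xi i - \sum_(j < n) T (i, j : nat) (xi j))) <= e / 2.
    rewrite (le_trans (zc _)) // (le_trans _ h2) // mulrC.
    by rewrite ler_wpM2l ?rnorm_ge0 // lerDl.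
  rewrite blinB blin_sum in h3.
  rewrite (eq_bigr (fun j : 'I_n => T (i, j : nat) (z (xi j)))) in h3; last first.
    by move=> j _; rewrite zT.
  rewrite rnorm_distC in h3.
  have := rnormD (p (amp z xi) i - \sum_(j < n) T (i, j : nat) (amp z xi j))
     (\sum_(j < n) T (i, j : nat) (z (xi j)) - z (xi i)).
  rewrite /= addrA subrK; move: h1 h3 => /=; lra.
have [nz _] := hp (amp z xi); rewrite pz in nz.
rewrite ip_conj (perp_near (P := P)) ?rmorph0 // => q Pq.
by rewrite ip_conj Pperp // rmorph0.
Qed.
End Density.

Section Flat.
Context (R : realType) (H : hilbert R).
Local Notation C := R[i].
Local Notation l2 := (l2 H).
Local Notation l2ip := (l2ip H).

Lemma flat_map (S T : Type) (s : S) (t : T) (F : S -> T) (a : nat -> nat -> S) p :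
  F s = t -> F (flat s a p) = flat t (fun n m => F (a n m)) p.
Proof. by rewrite /flat; case: pickle_inv. Qed.

Lemma flat_l2 (X : nat -> nat -> H) (B : R) :
  (forall N M, \sum_(n < N) \sum_(m < M) rnorm (X n m) ^+ 2 <= B) ->
  flat 0 X \in @l2_pred R H.
Proof.
move=> hX; apply/l2P; exists B => P.
have -> : \sum_(i < P) rnorm (flat 0 X i) ^+ 2 =
   \sum_(i < P) flat 0 (fun n m => rnorm (X n m) ^+ 2) i.
  apply: eq_bigr => i _; rewrite -(flat_map (s := 0) (F := fun x => rnorm x ^+ 2)) //.
  by rewrite rnorm0 expr0n.
by apply: flat_bound => // n m; exact: sqr_ge0.
Qed.

Lemma flat_dot (X Y : nat -> nat -> H) (A B : R)
  (hX : forall N M, \sum_(n < N) \sum_(m < M) rnorm (X n m) ^+ 2 <= A)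
  (hY : forall N M, \sum_(n < N) \sum_(m < M) rnorm (Y n m) ^+ 2 <= B)
  (a : blin H H) (r : nat -> C) :
  (forall n, csum (fun m => hdot H (a (X n m)) (Y n m)) (r n)) ->
  csum r (l2ip (amp a (L2 (flat_l2 hX))) (L2 (flat_l2 hY))).
Proof.
move=> hr; have [c c0 ac] := blin_bounded a.
apply: (csum_flat (B := 2^-1 * (c ^+ 2 * A + B))) hr _.
  move=> N M; apply: le_trans (_ : 2^-1 * (c ^+ 2 * \sum_(n < N) \sum_(m < M) rnorm (X n m) ^+ 2
     + \sum_(n < N) \sum_(m < M) rnorm (Y n m) ^+ 2) <= _).
    rewrite mulr_sumr -big_split mulr_sumr; apply: ler_sum => n _ /=.
    rewrite mulr_sumr -big_split mulr_sumr; apply: ler_sum => m _ /=.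
    apply: le_trans (hdot_CS _ _) _; apply: le_trans (ler_wpM2r (rnorm_ge0 _) (ac _)) _.
    rewrite -exprMn; set x := c * _; set y := rnorm _.
    by have := sqr_ge0 (x - y); rewrite sqrrB => ?; lra.
  by rewrite ler_pM2l ?invr_gt0 // lerD // ler_wpM2l // sqr_ge0.
have := l2_dotP (amp a (L2 (flat_l2 hX))) (L2 (flat_l2 hY)).
rewrite (_ : (fun n => _) = flat 0 (fun n m => hdot H (a (X n m)) (Y n m))) //.
apply/funext => p /=; rewrite /flat; case: pickle_inv => //.
by rewrite hdot0r.
Qed.

Lemma flat_bound2 (u v : l2) (X : nat -> nat -> H) :
  (forall n m, X n m = if n == 0%N then u m else if n == 1%N then v m else 0) ->
  forall N M, \sum_(n < N) \sum_(m < M) rnorm (X n m) ^+ 2 <=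
    nrm l2ip u ^+ 2 + nrm l2ip v ^+ 2.
Proof.
move=> hX N M; pose g n := \sum_(m < M) rnorm (X n m) ^+ 2.
have g0 n : 0 <= g n by apply: sumr_ge0 => m _; exact: sqr_ge0.
apply: le_trans (_ : \sum_(n < 2 + N) g n <= _).
  by apply: (psum_homo g0); rewrite leq_addl.
rewrite big_split_ord /= [X in _ + X]big1 ?addr0; last first.
  by move=> i _; rewrite /g big1 // => m _; rewrite hX /= rnorm0 expr0n.
rewrite !big_ord_recl big_ord0 addr0 /g /=.
under eq_bigr do rewrite hX /=; under [X in _ + X <= _]eq_bigr do rewrite hX /=.
by rewrite lerD // l2_psum_le.
Qed.

(** The two pairs of sequences occupy rows 0 and 1 of a double array, which is then flattened.
    Linear combinations of vector functionals are thus given by a single pair again. *)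
Lemma vec_combine (xi eta xi' eta' : l2) (c : C) : exists xi2 eta2 : l2,
  forall a : blin H H, l2ip (amp a xi2) eta2 =
    l2ip (amp a xi) eta + c * l2ip (amp a xi') eta'.
Proof.
pose X n m := if n == 0%N then xi m else if n == 1%N then (c *: xi') m else 0 : H.
pose Y n m := if n == 0%N then eta m else if n == 1%N then eta' m else 0 : H.
have hX := flat_bound2 (X := X) (fun _ _ => erefl).
have hY := flat_bound2 (X := Y) (fun _ _ => erefl).
exists (L2 (flat_l2 hX)), (L2 (flat_l2 hY)) => a.
pose r n := if n == 0%N then l2ip (amp a xi) eta else if n == 1%N then
  c * l2ip (amp a xi') eta' else 0.
have -> : l2ip (amp a xi) eta + c * l2ip (amp a xi') eta' = \sum_(i < 2) r i.
  by rewrite !big_ord_recl big_ord0 addr0.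
apply: (csum_unique (u := r)); last by apply: csum_fin => -[|[|]].
apply: flat_dot => -[|[|n]]; rewrite /X /Y /r /=.
- exact: (l2_dotP (amp a xi) eta).
- rewrite (_ : (fun m => _) = fun m => c * hdot H (a (xi' m)) (eta' m)).
    by apply: csumZ; exact: (l2_dotP (amp a xi') eta').
  by apply/funext => m; rewrite -hdotZl -blinZ.
- rewrite (_ : (fun m => _) = fun=> 0); first exact: csum0.
  by apply/funext => m; rewrite hdot0r.
Qed.
End Flat.

Section Predual.
Context (R : realType) (H : hilbert R) (M : vnAlg H).
Local Notation C := R[i].
Local Notation l2 := (l2 H).
Local Notation l2ip := (l2ip H).

Lemma vecE (xi eta : l2) (a : vn_elt M) :
  vec_functional xi eta a = l2ip (amp a xi) eta.
Proof.
apply/cvg_lim; first exact: norm_hausdorff.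
by have /csumP := l2_dotP (amp a xi) eta.
Qed.

Lemma vn_lin (c : C) (a b : vn_elt M) : vn_val (c *: a + b) = c *: vn_val a + vn_val b.
Proof. by []. Qed.
Lemma vn_linE (c : C) (a b : vn_elt M) h : (c *: a + b) h = c *: a h + b h.
Proof. by []. Qed.
Lemma vn_ext (a b : vn_elt M) : (forall h, a h = b h) -> a = b.
Proof. by move=> h; apply/val_inj/blin_ext. Qed.

Lemma amp_oplin (c : C) (u v : blin H H) (f : l2) :
  amp (c *: u + v) f = c *: amp u f + amp v f.
Proof. exact: l2_ext. Qed.
Lemma amp_op0 (f : l2) : amp 0 f = 0.
Proof. exact: l2_ext. Qed.
Lemma ampZ (a : blin H H) (c : C) (f : l2) : amp a (c *: f) = c *: amp a f.
Proof. by apply: l2_ext => n; exact: (blinZ a c (f n)). Qed.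

Definition vfun (p : l2 * l2) (a : vn_elt M) : C := l2ip (amp a p.1) p.2.
Lemma vfun_lin p c a b : vfun p (c *: a + b) = c * vfun p a + vfun p b.
Proof. by rewrite /vfun vn_lin amp_oplin ip_lin. Qed.

(** A functional that vanishes on the common kernel of finitely many vector functionals is a
    combination of them, hence by [vec_combine] one vector functional. In the induction a multiple
    of [vfun p] is subtracted so that the rest vanishes on the common kernel of [L]. *)
Lemma lin_span (L : seq (l2 * l2)) (f : vn_elt M -> C) :
  (forall c a b, f (c *: a + b) = c * f a + f b) ->
  (forall a, (forall p, p \in L -> vfun p a = 0) -> f a = 0) ->
  exists xi eta : l2, forall a : vn_elt M, f a = l2ip (amp a xi) eta.
Proof.
elim: L f => [|p L IH] f flin fker.
  by exists 0, 0 => a; rewrite ip0r fker.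
have [h|] := pselect (forall a, (forall q, q \in L -> vfun q a = 0) -> vfun p a = 0).
  apply: IH => // a aL; apply: fker => q; rewrite inE => /orP[/eqP ->|]; last exact: aL.
  exact: h.
move=> /existsNP[a0 /not_implyP[a0L /eqP va0]].
pose k := f a0 / vfun p a0.
have [|a aL|xi [eta hxi]] := IH (fun a => f a - k * vfun p a).
- by move=> c a b; rewrite flin vfun_lin; ring.
- have := fker (- (vfun p a / vfun p a0) *: a0 + a).
  rewrite flin => /(_ _) h; rewrite /k.
  suff /h : forall q, q \in p :: L -> vfun q (- (vfun p a / vfun p a0) *: a0 + a) = 0.
    by move=> e; rewrite -{}e; field.
  move=> q; rewrite inE vfun_lin => /orP[/eqP ->|qL].
    by rewrite mulNr divfK // addNr.
  by rewrite (a0L _ qL) (aL _ qL) mulr0 addr0.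
have [xi2 [eta2 h2]] := vec_combine xi eta p.1 p.2 k.
by exists xi2, eta2 => a; rewrite h2 -hxi /vfun subrK.
Qed.

(** Continuity along the filter of sigma-weak neighbourhoods of 0 bounds [f] by 1 on some [U L]. On
    the common kernel of [L] every multiple of an element stays in [U L], so [f] vanishes there and
    [lin_span] applies. *)
Lemma normal_vec (f : vn_elt M -> R[i]^o) : linear f -> normal_functional f ->
  exists xi eta : l2, forall a, f a = l2ip (amp a xi) eta.
Proof.
move=> flin fnorm.
(* Radius 1 is enough for a base of neighbourhoods of 0: other radii are absorbed by scaling the
   vectors. *)
pose U (L : seq (l2 * l2)) := [set a : vn_elt M | forall p, p \in L -> cabs (vfun p a) < 1].
pose F : set_system (vn_elt M) := [set A | exists L, U L `<=` A].
have v0 p : vfun p 0 = 0 by rewrite /vfun amp_op0 ip0l.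
have FF : ProperFilter F.
  apply: Build_ProperFilter.
    by move=> [L LA]; apply: (LA 0) => p _; rewrite v0 cabs0 ltr01.
  split.
  - by exists [::].
  - move=> A B [L LA] [L' LB]; exists (L ++ L') => a ha; split.
      by apply: LA => p pL; apply: ha; rewrite mem_cat pL.
    by apply: LB => p pL; apply: ha; rewrite mem_cat pL orbT.
  - by move=> A B AB [L LA]; exists L => a /LA /AB.
have F0 : sigma_weak_cvg F (0 : vn_elt M).
  move=> xi eta /sq_summableP hxi /sq_summableP heta.
  apply/cvg_rnormP => e e0; exists [:: ((e^-1)%:C%C *: L2 hxi, L2 heta)] => a.
  move=> /(_ _ (mem_head _ _)); rewrite /vfun /= ampZ.
  rewrite -[l2_dot _ _]/(l2ip _ _) ipZl cabsM cabsR ger0_norm ?invr_ge0 ?ltW //.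
  rewrite ltr_pdivrMl // mulr1 => h.
  by rewrite (vecE (L2 hxi) (L2 heta)) (vecE (L2 hxi) (L2 heta)) amp_op0 ip0l subr0.
have f0 := linear_zero flin.
have /cvg_rnormP /(_ _ ltr01) [L hL] := fnorm F 0 FF F0.
apply: (lin_span (L := L)) => [c a b|a aL]; first exact: flin.
apply: cabs_eq0; apply/eqP/negP => /negP fa0.
have fp : 0 < cabs (f a) by rewrite lt_neqAle eq_sym fa0 cabs_ge0.
have := hL ((cabs (f a))^-1%:C%C *: a) => /= h.
have : rnorm (f ((cabs (f a))^-1%:C%C *: a) - f 0) < 1.
  apply: h => p pL.
  by rewrite -[_ *: a]addr0 vfun_lin aL // v0 mulr0 addr0 cabs0 ltr01.
rewrite f0 subr0 -[_ *: a]addr0 flin f0 addr0 rnormZ cabsR.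
by rewrite ger0_norm ?invr_ge0 ?cabs_ge0 // rnormCo mulVf // ltxx.
Qed.

Lemma predual_vec (f : predual M) : exists xi eta : l2, forall a, f a = l2ip (amp a xi) eta.
Proof. by have /asboolP[lf nf] := predualP f; exact: normal_vec. Qed.

Lemma vec_predual (xi eta : l2) : exists f : predual M, forall a, f a = l2ip (amp a xi) eta.
Proof.
suff H0 : (fun a : vn_elt M => l2ip (amp a xi) eta : R[i]^o) \in predual_pred (M := M).
  by exists (Predual H0).
apply/asboolP; split=> [c a b|F a FF Fa].
  by rewrite vn_lin amp_oplin ip_lin.
have := Fa xi eta; rewrite (_ : vec_functional xi eta = fun a => l2ip (amp a xi) eta).
  by apply; apply/sq_summableP; exact: l2_prop.
by apply/funext => b; exact: vecE.
Qed.
End Predual.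

Section Dense.
Context (R : realType) (V : normedModType R[i]).
Lemma dense_near (S : set V) (x : V) (e : R) : dense S -> 0 < e ->
  exists2 s, S s & rnorm (x - s) < e.
Proof.
move=> dS e0; have e0' : 0 < e%:C%C by rewrite ltcR.
have [||s [xs Ss]] := dS (ball x e%:C%C).
- by exists x; exact: ballxx.
- exact: ball_open.
exists s => //; move: xs; rewrite -ball_normE /ball_ /= rnormC ltcR //.
Qed.
End Dense.

Section Slices.
Context (R : realType) (H K : hilbert R) (HK : hilbert_tensor H K).
Local Notation C := R[i].
Local Notation t := (hit_tens HK).

Lemma tens_linl c u v k : t (c *: u + v) k = c *: t u k + t v k.
Proof. by rewrite linearPl. Qed.
Lemma tens_linr c u v h : t h (c *: u + v) = c *: t h u + t h v.
Proof. by rewrite linearPr. Qed.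
Lemma tens0l k : t 0 k = 0.
Proof. by rewrite linear0l. Qed.

Lemma tens_norm h k : rnorm (t h k) = rnorm h * rnorm k.
Proof.
apply/eqP; rewrite -(eqrXn2 (n := 2)) ?mulr_ge0 ?rnorm_ge0 //.
by rewrite rnorm2E hit_dot !hdot_nrm -rmorphM /= exprMn.
Qed.

Lemma tens_eq (x y : HK) :
  (forall h k, hdot HK x (t h k) = hdot HK y (t h k)) -> x = y.
Proof.
move=> hxy; apply/eqP; rewrite -subr_eq0; apply/eqP; set w := x - y.
have w0 h k : hdot HK w (t h k) = 0 by rewrite hdotBl hxy subrr.
apply: small_eq0 => e e0.
have [_ [n [h [k ->]]] hs] := dense_near w (@hit_dense _ _ _ HK) e0.
set s := \sum_(i < n) _ in hs.
have ws : hdot HK w s = 0 by rewrite hdot_sumr big1.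
apply: le_trans (ltW hs); rewrite -(ler_pXn2r (n := 2)) ?nnegrE ?rnorm_ge0 //.
rewrite (rnorm2D w) rnormN -scaleN1r hdotZr ws mulr0 mulr0 addr0 lerDl.
exact: sqr_ge0.
Qed.

Lemma tensl2_bound (f : l2 H) k n :
  \sum_(i < n) rnorm (t (f i) k) ^+ 2 <= (nrm (l2ip H) f * rnorm k) ^+ 2.
Proof.
rewrite exprMn.
rewrite (le_trans _ (ler_wpM2r (sqr_ge0 _) (l2_psum_le f n))) // mulr_suml.
by apply: ler_sum => i _; rewrite tens_norm exprMn.
Qed.
Lemma tensl2_proof (f : l2 H) k : (fun n => t (f n) k) \in @l2_pred R HK.
Proof. by apply/l2P; exists ((nrm (l2ip H) f * rnorm k) ^+ 2); exact: tensl2_bound. Qed.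
Definition tensl2 (f : l2 H) k : l2 HK := L2 (tensl2_proof f k).
Lemma tensl2_nrm f k : nrm (l2ip HK) (tensl2 f k) <= nrm (l2ip H) f * rnorm k.
Proof.
rewrite -(ler_pXn2r (n := 2)) ?nnegrE ?mulr_ge0 ?rnorm_ge0 ?nrm_ge0 //.
by apply: l2_nrm_le => n; exact: tensl2_bound.
Qed.
Lemma tensl2_lin f c u v : tensl2 f (c *: u + v) = c *: tensl2 f u + tensl2 f v.
Proof. by apply: l2_ext => n; exact: tens_linr. Qed.

Context (M : vnAlg H) (N : vnAlg K).
Local Notation MN := (vn_tensor HK M N).
Local Notation S := [set z | exists (a : vn_elt M) (b : vn_elt N), is_tensor a b z].

Lemma blin_idP : exists i : blin HK HK, forall x, i x = x.
Proof.
have [||i hi] := @blin_build R HK HK id 1 => //; first by move=> v; rewrite mul1r.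
by exists i.
Qed.

Lemma vn_id (L : hilbert R) (A : vnAlg L) : exists a : vn_elt A, forall x, a x = x.
Proof.
have [||i hi] := @blin_build R L L id 1 => //; first by move=> v; rewrite mul1r.
suff iA : i \in vn_pred A by exists (VNElt iA).
by apply/asboolP; rewrite -vn_bicommutant => b _ x; rewrite !hi.
Qed.

Lemma vn_adj (L : hilbert R) (A : vnAlg L) (a : vn_elt A) :
  exists b : vn_elt A, is_adjoint a b.
Proof.
have [b ab] := adjoint_exists a.
suff bA : b \in vn_pred A by exists (VNElt bA).
by apply/asboolP; apply: vn_star ab; have /asboolP := vn_eltP a.
Qed.

Lemma tensor_density (xi eta : l2 HK) :
  (forall (a : vn_elt M) (b : vn_elt N) z, is_tensor a b z ->
     l2ip HK (amp z xi) eta = 0) ->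
  forall z : vn_elt MN, l2ip HK (amp z xi) eta = 0.
Proof.
move=> h0 z.
have /asboolP zS := vn_eltP z.
apply: (density (S := S)) zS.
- move=> x y [a [b xab]] [a' [b' yab]].
  by exists (vn_mul a a'), (vn_mul b b') => h k; rewrite /= yab xab.
- move=> x y [a [b xab]] xy.
  have [a' aa] := vn_adj a; have [b' bb] := vn_adj b.
  exists a', b' => h k; apply: tens_eq => h' k'.
  by rewrite (adjointC xy) xab !hit_dot (adjointC aa) (adjointC bb).
- have [i hi] := blin_idP; have [a ha] := vn_id M; have [b hb] := vn_id N.
  by exists i => //; exists a, b => h k; rewrite hi ha hb.
- by move=> x [a [b xab]]; exact: h0 xab.
Qed.

Lemma tensor_density2 (xi eta xi' eta' : l2 HK) :
  (forall (a : vn_elt M) (b : vn_elt N) z, is_tensor a b z ->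
     l2ip HK (amp z xi) eta = l2ip HK (amp z xi') eta') ->
  forall z : vn_elt MN, l2ip HK (amp z xi) eta = l2ip HK (amp z xi') eta'.
Proof.
move=> h0 z; have [x [y hxy]] := vec_combine xi eta xi' eta' (-1).
apply/eqP; rewrite -subr_eq0; apply/eqP; rewrite -mulN1r -hxy.
by apply: tensor_density => a b z' zab; rewrite hxy (h0 _ _ _ zab) mulN1r subrr.
Qed.

Lemma tensor_amp (a : blin H H) (b : blin K K) (z : blin HK HK) (xi eta : l2 H) k l :
  is_tensor a b z ->
  l2ip HK (amp z (tensl2 xi k)) (tensl2 eta l) = l2ip H (amp a xi) eta * hdot K (b k) l.
Proof.
move=> zab; apply: csum_unique (l2_dotP (amp z (tensl2 xi k)) (tensl2 eta l)) _.
rewrite (_ : (fun n => _) = fun n => hdot K (b k) l * hdot H (a (xi n)) (eta n)).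
  by rewrite mulrC; apply: csumZ; exact: (l2_dotP (amp a xi) eta).
by apply/funext => n /=; rewrite zab hit_dot mulrC.
Qed.

Lemma slice_op (xi eta : l2 H) (z : vn_elt MN) : exists e : vn_elt N,
  forall k l, hdot K (e k) l = l2ip HK (amp z (tensl2 xi k)) (tensl2 eta l).
Proof.
have [c c0 hc] := amp_bounded z.
have [||||E0 _ hE] := @form_op R K K
  (fun k l => l2ip HK (amp z (tensl2 xi k)) (tensl2 eta l))
  (c * nrm (l2ip H) xi * nrm (l2ip H) eta).
- by rewrite !mulr_ge0 ?nrm_ge0 // ltW.
- by move=> a u v k; rewrite tensl2_lin amp_lin ip_lin.
- by move=> a u v k; rewrite tensl2_lin ipDr ipZr.
- move=> k l; apply: le_trans (cauchy_schwarz _ _ _) _.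
  apply: le_trans (_ : (c * (nrm (l2ip H) xi * rnorm k)) * (nrm (l2ip H) eta * rnorm l) <= _).
    apply: ler_pM; rewrite ?nrm_ge0 //; last exact: tensl2_nrm.
    by apply: le_trans (hc _) _; rewrite ler_pM2l // tensl2_nrm.
  apply: le_of_eq; ring.
suff EN : E0 \in vn_pred N by exists (VNElt EN).
(* For [u] in the commutant of [N], both coefficients are vector functionals of [z]. They agree on
   elementary tensors, whose component on [K] commutes with [u], hence everywhere by density. *)
apply/asboolP; rewrite -vn_bicommutant => u uN k; apply: hdot_eq => l.
have [u' uu] := adjoint_exists u.
rewrite uu !hE.
apply: (tensor_density2 (xi := tensl2 xi k) (eta := tensl2 eta (u' l))) => a b z' zab.
rewrite !(tensor_amp _ _ _ _ zab) -uu uN //.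
by have /asboolP := vn_eltP b.
Qed.

Section SliceMap.
Context (xi eta : l2 H).
Definition slice0 (z : vn_elt MN) : vn_elt N := sval (cid (slice_op xi eta z)).
Lemma slice0P z k l :
  hdot K (slice0 z k) l = l2ip HK (amp z (tensl2 xi k)) (tensl2 eta l).
Proof. by rewrite /slice0; case: cid => /= e ->. Qed.

Lemma slice0_lin : linear slice0.
Proof.
move=> c x y; apply: vn_ext => k; apply: hdot_eq => l.
by rewrite vn_linE hdot_lin !slice0P vn_lin amp_oplin ip_lin.
Qed.

Lemma flat_tens_bound (f : l2 H) (g : l2 K) n m :
  \sum_(i < n) \sum_(j < m) rnorm (t (f j) (g i)) ^+ 2 <=
  nrm (l2ip H) f ^+ 2 * nrm (l2ip K) g ^+ 2.
Proof.
apply: le_trans (_ : nrm (l2ip H) f ^+ 2 * \sum_(i < n) rnorm (g i) ^+ 2 <= _).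
  rewrite mulr_sumr; apply: ler_sum => i _.
  by apply: le_trans (tensl2_bound _ _ _) _; rewrite exprMn.
by rewrite ler_wpM2l ?sqr_ge0 // l2_psum_le.
Qed.

(** Composed with [slice0], the vector functional of the sequences k and l is the vector functional
    of the flattened double sequences xi_m (x) k_n and eta_m (x) l_n, so convergence at these two
    suffices. *)
Lemma slice0_normal : normal_map slice0.
Proof.
move=> F z FF Fz k l /sq_summableP hk /sq_summableP hl.
pose X n m := t (xi m) (k n); pose Y n m := t (eta m) (l n).
have bk := flat_tens_bound xi (L2 hk) : forall n m,
  \sum_(i < n) \sum_(j < m) rnorm (X i j) ^+ 2 <= _.
have bl := flat_tens_bound eta (L2 hl) : forall n m,
  \sum_(i < n) \sum_(j < m) rnorm (Y i j) ^+ 2 <= _.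
have E : @vec_functional R HK MN (L2 (flat_l2 (X := X) bk)) (L2 (flat_l2 (X := Y) bl)) =
    (fun x => vec_functional k l (slice0 x)).
  apply/funext => x; apply: etrans (vecE _ _ x) _.
  apply: etrans _ (esym (vecE (L2 hk) (L2 hl) (slice0 x))); symmetry.
  apply: csum_unique (l2_dotP (amp (slice0 x) (L2 hk)) (L2 hl)) _.
  apply: flat_dot => n /=; rewrite slice0P.
  exact: (l2_dotP (amp x (tensl2 xi (k n))) (tensl2 eta (l n))).
have := Fz (L2 (flat_l2 (X := X) bk)) (L2 (flat_l2 (X := Y) bl)); rewrite E.
by apply; apply/sq_summableP; exact: l2_prop.
Qed.
End SliceMap.

Lemma slice_exists (f : predual M) : exists E, is_slice (HK := HK) (N := N) f E.
Proof.
have [xi [eta hf]] := predual_vec f.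
exists (slice0 xi eta); split; [exact: slice0_lin|exact: slice0_normal|].
move=> a b z zab; apply: vn_ext => k; apply: hdot_eq => l.
rewrite slice0P (tensor_amp _ _ _ _ zab) -hf.
by rewrite -hdotZl.
Qed.

(* Normality makes a |-> <E a k, l> a vector functional, and two vector
   functionals that agree on elementary tensors are equal by density. *)
Lemma slice_eq (f : predual M) E (xi eta : l2 H) :
  (forall a, f a = l2ip H (amp a xi) eta) ->
  is_slice (HK := HK) (N := N) f E ->
  forall z k l, hdot K (E z k) l = l2ip HK (amp z (tensl2 xi k)) (tensl2 eta l).
Proof.
move=> hf [linE normE tensE] z k l.
pose g (x : vn_elt MN) : R[i]^o := hdot K (E x k) l.
have sE (x : vn_elt N) : l2ip K (amp x (single 0 k)) (single 0 l) = hdot K (x k) l.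
  apply: csum_unique (l2_dotP _ _) _.
  rewrite -[X in csum _ X](_ : \sum_(i < 1) hdot K (amp x (single 0 k) i) (single 0 l i) = _).
    by apply: csum_fin => -[|n] //= _; rewrite hdot0r.
  by rewrite big_ord_recl big_ord0 addr0.
have [c a b|F a FF Fa|xi' [eta' hg]] := @normal_vec R HK MN g.
- by rewrite /g linE vn_linE hdot_lin.
- have sqs (v : l2 K) : sq_summable v by apply/sq_summableP; exact: l2_prop.
  have := normE F a FF Fa _ _ (sqs (single 0 k)) (sqs (single 0 l)).
  rewrite vecE sE -/(g a).
  rewrite (_ : vec_functional _ _ = fun x : vn_elt N => (hdot K (x k) l : R[i]^o)) //.
  by apply/funext => x; rewrite vecE sE.
rewrite -[LHS]/(g z) hg.
apply: tensor_density2 => a b y yab; rewrite (tensor_amp _ _ _ _ yab).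
have yMN : y \in vn_pred MN.
  by apply/asboolP => A hA; apply: hA; exists a, b.
pose y' : vn_elt MN := VNElt yMN.
have Ey : E y' = (f a : R[i]) *: b by apply: tensE.
have gE : g y' = f a * hdot K (b k) l by rewrite -hdotZl -[(_ *: _ : K)]/((f a *: b) k) -Ey.
by rewrite -hf -gE; exact: esym (hg y').
Qed.

(** [slice] is whichever slice map [xget] selects, and [slice_eq] computes every slice map. All
    later use of [Tmap] goes through this formula. *)
Lemma TmapP (f : predual M) (xi eta : l2 H) :
  (forall a, f a = l2ip H (amp a xi) eta) ->
  forall (z : vn_elt MN) k l,
    hdot K ((Tmap z f : vn_elt N) k) l = l2ip HK (amp z (tensl2 xi k)) (tensl2 eta l).
Proof.
move=> hf z k l; apply: slice_eq hf _ z k l.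
rewrite /slice; have [E hE] := slice_exists f.
exact: (xgetPex (fun=> 0) (ex_intro _ E hE)).
Qed.
End Slices.

(** * Matrix norms *)

Section FiniteSums.
Context (R : realType).
Local Notation C := R[i].

Section FinIp.
Context (V : lmodType C) (d : ipspace V) (I : finType).
Lemma fsip_lin a (u v w : I -> V) :
  \sum_i d ((a *: u + v) i) (w i) = a * (\sum_i d (u i) (w i)) + \sum_i d (v i) (w i).
Proof.
by rewrite mulr_sumr -big_split; apply: eq_bigr => i _; exact: ip_lin.
Qed.
Lemma fsip_conj (u v : I -> V) :
  \sum_i d (v i) (u i) = (\sum_i d (u i) (v i))^*.
Proof. by rewrite rmorph_sum; apply: eq_bigr => i _; exact: ip_conj. Qed.
Lemma fsip_ge0 (u : I -> V) : 0 <= \sum_i d (u i) (u i).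
Proof. by apply: sumr_ge0 => i _; exact: ip_ge0. Qed.
Definition fsip : ipspace (I -> V) := IPSpace fsip_lin fsip_conj fsip_ge0.

Lemma fsip_nrm2 (u : I -> V) : nrm fsip u ^+ 2 = \sum_i nrm d (u i) ^+ 2.
Proof. by rewrite nrm2 Re_sum; apply: eq_bigr => i _; rewrite nrm2. Qed.
Lemma fsip_CS (u v : I -> V) :
  cabs (\sum_i d (u i) (v i)) <=
  Num.sqrt (\sum_i nrm d (u i) ^+ 2) * Num.sqrt (\sum_i nrm d (v i) ^+ 2).
Proof.
have := cauchy_schwarz fsip u v.
by rewrite -[nrm fsip u]ger0_norm ?nrm_ge0 // -sqrtr_sqr fsip_nrm2
  -[nrm fsip v]ger0_norm ?nrm_ge0 // -sqrtr_sqr fsip_nrm2.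
Qed.
End FinIp.

Lemma cip_lin (a u v w : C^o) : (a *: u + v) * w^* = a * (u * w^*) + v * w^*.
Proof. by rewrite mulrDl -mulrA. Qed.
Lemma cip_conj (u v : C^o) : v * u^* = (u * v^*)^*.
Proof. by rewrite rmorphM /= conjCK mulrC. Qed.
Lemma cip_ge0 (u : C^o) : 0 <= u * u^*.
Proof. by rewrite mulJ ler0c sqr_ge0. Qed.
Definition cip : ipspace C^o := IPSpace cip_lin cip_conj cip_ge0.
Lemma cip_nrm (u : C^o) : nrm cip u = cabs u.
Proof. by rewrite /nrm /= mulJ /= sqrtr_sqr ger0_norm // cabs_ge0. Qed.

Lemma sumCS (I : finType) (u v : I -> C) :
  cabs (\sum_i u i * (v i)^*) <=
  Num.sqrt (\sum_i cabs (u i) ^+ 2) * Num.sqrt (\sum_i cabs (v i) ^+ 2).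
Proof.
have E (w : I -> C^o) : \sum_i nrm cip (w i) ^+ 2 = \sum_i cabs (w i) ^+ 2.
  by apply: eq_bigr => i _; rewrite cip_nrm.
by have := fsip_CS cip u v; rewrite !E.
Qed.

Lemma sumCS_real (I : finType) (u v : I -> R) :
  \sum_i u i * v i <= Num.sqrt (\sum_i u i ^+ 2) * Num.sqrt (\sum_i v i ^+ 2).
Proof.
have := sumCS (fun i => (u i)%:C%C) (fun i => (v i)%:C%C).
under eq_bigr do rewrite conjR -rmorphM.
rewrite -rmorph_sum cabsR => h; apply: le_trans (ler_norm _) _.
apply: le_trans h _; apply: le_of_eq.
by congr (Num.sqrt _ * Num.sqrt _); apply: eq_bigr => i _;
  rewrite cabsR real_normK ?num_real.
Qed.
End FiniteSums.

Section L2norm.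
Context (R : realType) (V : normedModType R[i]).
Local Notation C := R[i].
Implicit Types (n : nat).

Lemma l2norm_ge0 n (v : 'I_n -> V) : 0 <= l2norm v. Proof. exact: sqrtr_ge0. Qed.
Lemma l2norm2 n (v : 'I_n -> V) : l2norm v ^+ 2 = \sum_i rnorm (v i) ^+ 2.
Proof. by rewrite sqr_sqrtr // sumr_ge0 // => i _; exact: sqr_ge0. Qed.
Lemma l2normZ n (c : C) (v : 'I_n -> V) : l2norm (fun i => c *: v i) = cabs c * l2norm v.
Proof.
rewrite /l2norm; under eq_bigr do rewrite rnormZ exprMn.
by rewrite -mulr_sumr sqrtrM ?sqr_ge0 // sqrtr_sqr ger0_norm // cabs_ge0.
Qed.
Lemma l2norm_eq0 n (v : 'I_n -> V) : l2norm v = 0 -> forall i, v i = 0.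
Proof.
move=> v0 i; apply: rnorm_eq0; apply/eqP; rewrite -sqrf_eq0; apply/eqP.
have : \sum_i rnorm (v i) ^+ 2 = 0 by rewrite -l2norm2 v0 expr0n.
by move=> /psumr_eq0P; apply=> // j _; exact: sqr_ge0.
Qed.
Lemma l2norm0 n : l2norm (fun _ : 'I_n => 0 : V) = 0.
Proof. by rewrite /l2norm big1 ?sqrtr0 // => i _; rewrite rnorm0 expr0n. Qed.
Lemma l2norm_coord n (v : 'I_n -> V) i : rnorm (v i) <= l2norm v.
Proof.
rewrite -(ler_pXn2r (n := 2)) ?nnegrE ?rnorm_ge0 ?l2norm_ge0 // l2norm2.
by rewrite (bigD1 i) //= lerDl sumr_ge0 // => j _; exact: sqr_ge0.
Qed.
End L2norm.

Lemma hdot_sumCS (R : realType) (H : hilbert R) (I : finType) (u v : I -> H) :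
  cabs (\sum_i hdot H (u i) (v i)) <=
  Num.sqrt (\sum_i rnorm (u i) ^+ 2) * Num.sqrt (\sum_i rnorm (v i) ^+ 2).
Proof.
have E (w : I -> H) : \sum_i nrm (hip H) (w i) ^+ 2 = \sum_i rnorm (w i) ^+ 2.
  by apply: eq_bigr => i _; rewrite nrmE.
by have := fsip_CS (hip H) u v; rewrite !E.
Qed.

Section OpSup.
Context (R : realType) (V W : normedModType R[i]) (m n : nat).
Context (T : ('I_n -> V) -> ('I_m -> W)).
Local Notation C := R[i].
(** Both [scalar_opnorm] and [vn_norm] are suprema of sets of this form. *)
Definition opset := [set l2norm (T x) | x in [set x : 'I_n -> V | l2norm x <= 1]].

Lemma opsup_le (b : R) : 0 <= b ->
  (forall x, l2norm (T x) <= b * l2norm x) -> sup opset <= b.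
Proof.
move=> b0 hb; apply: ge_sup.
  by exists (l2norm (T (fun=> 0))), (fun=> 0) => //=; rewrite l2norm0.
move=> _ [x /= x1 <-]; apply: le_trans (hb _) _.
by rewrite ler_piMr.
Qed.

Lemma opsup_ub (b : R) : 0 <= b ->
  (forall (c : C) x, T (fun i => c *: x i) = fun i => c *: T x i) ->
  (forall x, l2norm (T x) <= b * l2norm x) ->
  forall x, l2norm (T x) <= sup opset * l2norm x.
Proof.
move=> b0 TZ hb x.
have ub : has_ubound opset.
  exists b => _ [y /= y1 <-]; apply: le_trans (hb _) _; by rewrite ler_piMr.
have [x0|x0] := eqVneq (l2norm x) 0.
  by rewrite x0 mulr0; have := hb x; rewrite x0 mulr0.
have xp : 0 < l2norm x by rewrite lt_neqAle eq_sym x0 l2norm_ge0.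
rewrite -ler_pdivrMr //.
have -> : l2norm (T x) / l2norm x = l2norm (T (fun i => ((l2norm x)^-1)%:C%C *: x i)).
  by rewrite TZ l2normZ cabsR ger0_norm ?invr_ge0 ?l2norm_ge0 // mulrC.
apply: ub_le_sup => //; eexists; last reflexivity.
by rewrite /= l2normZ cabsR ger0_norm ?invr_ge0 ?l2norm_ge0 // mulVf.
Qed.
Lemma opsup_ge0 (b : R) : 0 <= b ->
  (forall x, l2norm (T x) <= b * l2norm x) -> 0 <= sup opset.
Proof.
move=> b0 hb; apply: le_trans (_ : l2norm (T (fun=> 0)) <= _); first exact: l2norm_ge0.
apply: ub_le_sup; last by exists (fun=> 0) => //=; rewrite l2norm0.
by exists b => _ [y /= y1 <-]; apply: le_trans (hb _) _; rewrite ler_piMr.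
Qed.
End OpSup.

Section ScalarNorm.
Context (R : realType).
Local Notation C := R[i].

Definition mxapp m n (a : 'M[C]_(m, n)) (x : 'I_n -> R[i]^o) : 'I_m -> R[i]^o :=
  fun i => \sum_j a i j * x j.

Lemma opnorm_le m n (a : 'M[C]_(m, n)) (b : R) : 0 <= b ->
  (forall (x : 'I_n -> C) (y : 'I_m -> C), cabs (\sum_i (\sum_j a i j * x j) * (y i)^*) <=
     b * Num.sqrt (\sum_j cabs (x j) ^+ 2) * Num.sqrt (\sum_i cabs (y i) ^+ 2)) ->
  scalar_opnorm a <= b.
Proof.
move=> b0 hb; apply: (@opsup_le R (R[i]^o) (R[i]^o) m n (mxapp a) b b0) => x.
have := hb x (mxapp a x); set z := mxapp a x.
have -> : \sum_i (\sum_j a i j * x j) * (z i)^* = (l2norm z ^+ 2)%:C%C.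
  rewrite l2norm2 rmorph_sum; apply: eq_bigr => i _.
  exact: mulJ.
rewrite cabsR ger0_norm ?sqr_ge0 // -[Num.sqrt (\sum_i cabs (z i) ^+ 2)]/(l2norm z) expr2.
have [->|z0] := eqVneq (l2norm z) 0; first by rewrite mulr_ge0 // sqrtr_ge0.
by rewrite ler_pM2r // lt_neqAle eq_sym z0 l2norm_ge0.
Qed.

Lemma opnorm_bounded m n (a : 'M[C]_(m, n)) : exists2 b : R, 0 <= b &
  forall x : 'I_n -> R[i]^o, l2norm (fun i => \sum_j a i j * x j : R[i]^o) <= b * l2norm x.
Proof.
pose b := \sum_i \sum_j cabs (a i j).
have b0 : 0 <= b by do 2 apply: sumr_ge0 => ? _; exact: cabs_ge0.
exists b => // x.
rewrite -(ler_pXn2r (n := 2)) ?nnegrE ?mulr_ge0 ?l2norm_ge0 // l2norm2.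
apply: le_trans (_ : (\sum_i rnorm (\sum_j a i j * x j : R[i]^o)) ^+ 2 <= _).
  rewrite [leRHS]expr2 mulr_suml; apply: ler_sum => i _; rewrite expr2.
  rewrite ler_wpM2l ?rnorm_ge0 // (bigD1 i) //= lerDl.
  by apply: sumr_ge0 => ? _; exact: rnorm_ge0.
rewrite ler_pXn2r ?nnegrE ?mulr_ge0 ?l2norm_ge0 //; last first.
  by apply: sumr_ge0 => ? _; exact: rnorm_ge0.
rewrite mulr_suml; apply: ler_sum => i _; rewrite mulr_suml rnormCo.
apply: le_trans (cabs_sum _ _ _) _; apply: ler_sum => j _.
by rewrite cabsM ler_wpM2l ?cabs_ge0 // -rnormCo l2norm_coord.
Qed.

Lemma opnorm_ub m n (a : 'M[C]_(m, n)) (x : 'I_n -> R[i]^o) :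
  l2norm (fun i => \sum_j a i j * x j : R[i]^o) <= scalar_opnorm a * l2norm x.
Proof.
have [b b0 hb] := opnorm_bounded a.
apply: (@opsup_ub R (R[i]^o) (R[i]^o) m n (mxapp a) b b0 _ hb x) => c y.
by apply/funext => i; rewrite scaler_sumr; apply: eq_bigr => j _; rewrite mulrCA.
Qed.

Lemma opnorm_ge0 m n (a : 'M[C]_(m, n)) : 0 <= scalar_opnorm a.
Proof.
have [b b0 hb] := opnorm_bounded a.
exact: (@opsup_ge0 R (R[i]^o) (R[i]^o) m n (mxapp a) b b0 hb).
Qed.

Lemma opnorm_form m n (a : 'M[C]_(m, n)) (x : 'I_n -> C) (y : 'I_m -> C) :
  cabs (\sum_i (\sum_j a i j * x j) * (y i)^*) <=
  scalar_opnorm a * Num.sqrt (\sum_j cabs (x j) ^+ 2) * Num.sqrt (\sum_i cabs (y i) ^+ 2).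
Proof.
apply: le_trans (sumCS _ _) _.
by rewrite ler_wpM2r ?sqrtr_ge0 //; exact: (opnorm_ub a x).
Qed.
End ScalarNorm.

Section VnNorm.
Context (R : realType) (H : hilbert R) (M : vnAlg H).
Local Notation C := R[i].

Lemma vn_norm_le m n (a : 'M[vn_elt M]_(m, n)) (b : R) : 0 <= b ->
  (forall x : 'I_n -> H, l2norm (fun i => \sum_j a i j (x j)) <= b * l2norm x) ->
  vn_norm a <= b.
Proof. exact: (opsup_le (T := fun x i => \sum_j a i j (x j))). Qed.

Lemma vn_bounded m n (a : 'M[vn_elt M]_(m, n)) : exists2 b : R, 0 <= b &
  forall x : 'I_n -> H, l2norm (fun i => \sum_j a i j (x j)) <= b * l2norm x.
Proof.
have bex ij : exists c : R, 0 <= c /\ forall h, rnorm (a ij.1 ij.2 h) <= c * rnorm h.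
  by have [c c0 hc] := blin_bounded (a ij.1 ij.2); exists c.
have [k hk] := choice bex.
pose b := \sum_i \sum_j k (i, j).
have k0 ij : 0 <= k ij by case: (hk ij).
have b0 : 0 <= b by do 2 apply: sumr_ge0 => ? _.
exists b => // x.
rewrite -(ler_pXn2r (n := 2)) ?nnegrE ?mulr_ge0 ?l2norm_ge0 // l2norm2.
apply: le_trans (_ : (\sum_i rnorm (\sum_j a i j (x j))) ^+ 2 <= _).
  rewrite [leRHS]expr2 mulr_suml; apply: ler_sum => i _; rewrite expr2.
  rewrite ler_wpM2l ?rnorm_ge0 // (bigD1 i) //= lerDl.
  by apply: sumr_ge0 => ? _; exact: rnorm_ge0.
rewrite ler_pXn2r ?nnegrE ?mulr_ge0 ?l2norm_ge0 //; last first.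
  by apply: sumr_ge0 => ? _; exact: rnorm_ge0.
rewrite mulr_suml; apply: ler_sum => i _; rewrite mulr_suml.
apply: le_trans (rnorm_sum _ _ _) _; apply: ler_sum => j _.
apply: le_trans ((hk (i, j)).2 _) _.
by rewrite ler_wpM2l ?l2norm_coord.
Qed.

Lemma vn_norm_ub m n (a : 'M[vn_elt M]_(m, n)) (x : 'I_n -> H) :
  l2norm (fun i => \sum_j a i j (x j)) <= vn_norm a * l2norm x.
Proof.
have [b b0 hb] := vn_bounded a.
apply: (opsup_ub (T := fun x i => \sum_j a i j (x j))) b0 _ hb x => c y.
by apply/funext => i; rewrite scaler_sumr; apply: eq_bigr => j _; rewrite blinZ.
Qed.

Lemma vn_norm_ge0 m n (a : 'M[vn_elt M]_(m, n)) : 0 <= vn_norm a.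
Proof.
have [b b0 hb] := vn_bounded a.
exact: (opsup_ge0 (T := fun x i => \sum_j a i j (x j))) b0 hb.
Qed.

Lemma vn_form m n (a : 'M[vn_elt M]_(m, n)) (x : 'I_n -> H) (y : 'I_m -> H) :
  cabs (\sum_i hdot H (\sum_j a i j (x j)) (y i)) <= vn_norm a * l2norm x * l2norm y.
Proof.
apply: le_trans (hdot_sumCS _ _) _.
by rewrite ler_wpM2r ?sqrtr_ge0 //; exact: (vn_norm_ub a x).
Qed.

Lemma vn_norm_le_form m n (a : 'M[vn_elt M]_(m, n)) (b : R) : 0 <= b ->
  (forall (x : 'I_n -> H) (y : 'I_m -> H),
     cabs (\sum_i hdot H (\sum_j a i j (x j)) (y i)) <= b * l2norm x * l2norm y) ->
  vn_norm a <= b.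
Proof.
move=> b0 hb; apply: vn_norm_le => // x.
have := hb x (fun i => \sum_j a i j (x j)).
set z := fun i => \sum_j a i j (x j).
have -> : \sum_i hdot H (\sum_j a i j (x j)) (z i) = (l2norm z ^+ 2)%:C%C.
  rewrite l2norm2 rmorph_sum; apply: eq_bigr => i _.
  exact: hdot_nrm.
rewrite cabsR ger0_norm ?sqr_ge0 // expr2.
have [->|z0] := eqVneq (l2norm z) 0; first by rewrite mulr_ge0 // l2norm_ge0.
by rewrite ler_pM2r // lt_neqAle eq_sym z0 l2norm_ge0.
Qed.

(** Amplification does not increase the norm of an operator matrix: the form estimate is applied in
    each coordinate [k] of the sequences, and Cauchy-Schwarz sums over [k]. *)
Lemma vn_form_l2 m n (a : 'M[vn_elt M]_(m, n)) (X : 'I_n -> l2 H) (Y : 'I_m -> l2 H) :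
  cabs (\sum_i \sum_j l2ip H (amp (a i j) (X j)) (Y i)) <=
  vn_norm a * Num.sqrt (\sum_j nrm (l2ip H) (X j) ^+ 2)
            * Num.sqrt (\sum_i nrm (l2ip H) (Y i) ^+ 2).
Proof.
pose u k := \sum_(i < m) \sum_(j < n) hdot H (a i j (X j k)) (Y i k).
have cs : csum u (\sum_i \sum_j l2ip H (amp (a i j) (X j)) (Y i)).
  apply: csum_sum => i; apply: csum_sum => j.
  exact: (l2_dotP (amp (a i j) (X j)) (Y i)).
apply: csum_le cs _ => N.
apply: le_trans (_ : \sum_(k < N) (vn_norm a * (l2norm (fun j => X j k) * l2norm (fun i => Y i k))) <= _).
  apply: ler_sum => k _; rewrite mulrA /u.
  have := vn_form a (fun j => X j k) (fun i => Y i k).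
  by under eq_bigr do rewrite hdot_suml.
rewrite -mulr_sumr -mulrA ler_wpM2l ?vn_norm_ge0 //.
apply: le_trans (sumCS_real _ _) _.
apply: ler_pM; rewrite ?sqrtr_ge0 // ler_wsqrtr //.
  under eq_bigr do rewrite l2norm2.
  by rewrite exchange_big; apply: ler_sum => j _; exact: l2_psum_le.
under eq_bigr do rewrite l2norm2.
by rewrite exchange_big; apply: ler_sum => j _; exact: l2_psum_le.
Qed.
End VnNorm.

Section PredualNorm.
Context (R : realType) (H : hilbert R) (M : vnAlg H).
Local Notation C := R[i].

Lemma sum_tens (V : nmodType) (p n : nat) (F : 'I_p -> 'I_n -> V) :
  \sum_(u < p * n) F (mxtens_unindex u).1 (mxtens_unindex u).2 = \sum_i \sum_k F i k.
Proof.
rewrite pair_bigA (reindex (@mxtens_index p n)); last first.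
  by exists (@mxtens_unindex p n) => ? _; rewrite ?mxtens_indexK ?mxtens_unindexK.
by apply: eq_bigr => ik _; rewrite mxtens_indexK.
Qed.

Definition pset p q (f : 'M[predual M]_(p, q)) := [set s : R | exists n (a : 'M[vn_elt M]_n), vn_norm a <= 1 /\
    s = scalar_opnorm (\matrix_(u < p * n, v < q * n)
      (f (mxtens_unindex u).1 (mxtens_unindex v).1
         (a (mxtens_unindex u).2 (mxtens_unindex v).2) : R[i]))].

Lemma pset_le p q (f : 'M[predual M]_(p, q)) (b : R) : 0 <= b ->
  (forall n (a : 'M[vn_elt M]_n), vn_norm a <= 1 ->
    forall (x : 'I_q -> 'I_n -> C) (y : 'I_p -> 'I_n -> C),
     cabs (\sum_i \sum_j \sum_k \sum_l f i j (a k l) * (x j l * (y i k)^*)) <=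
     b * Num.sqrt (\sum_j \sum_l cabs (x j l) ^+ 2) *
      Num.sqrt (\sum_i \sum_k cabs (y i k) ^+ 2)) ->
  forall s, pset f s -> s <= b.
Proof.
move=> b0 hb _ [n [a [a1 ->]]].
apply: opnorm_le => // x y.
have := hb n a a1 (fun j l => x (mxtens_index (j, l))) (fun i k => y (mxtens_index (i, k))).
have E r (z : 'I_(r * n) -> C) : \sum_(i < r) \sum_(k < n) cabs (z (mxtens_index (i, k))) ^+ 2
   = \sum_i cabs (z i) ^+ 2.
  rewrite -(sum_tens (fun i k => cabs (z (mxtens_index (i, k))) ^+ 2)).
  by apply: eq_bigr => u _; rewrite -surjective_pairing mxtens_unindexK.
rewrite !E => h; apply: le_trans h; apply: le_of_eq.
congr cabs.
pose G i k := (\sum_(j < q) \sum_(l < n) f i j (a k l) * x (mxtens_index (j, l))) *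
   (y (mxtens_index (i, k)))^*.
transitivity (\sum_i \sum_k G i k).
  rewrite -sum_tens; apply: eq_bigr => u _; rewrite /G -surjective_pairing mxtens_unindexK.
  congr (_ * _); rewrite -(sum_tens (fun j l => f (mxtens_unindex u).1 j (a (mxtens_unindex u).2 l) * x (mxtens_index (j, l)))).
  by apply: eq_bigr => v _; rewrite mxE -surjective_pairing mxtens_unindexK.
apply: eq_bigr => i _.
rewrite exchange_big; apply: eq_bigr => k _ /=; rewrite /G mulr_suml.
by apply: eq_bigr => j _; rewrite mulr_suml; apply: eq_bigr => l _; rewrite mulrA.
Qed.

Lemma pset_neq0 p q (f : 'M[predual M]_(p, q)) : pset f !=set0.
Proof.
eexists; exists 0%N, 0; split; last reflexivity.
by apply: vn_norm_le => // x; rewrite mul1r /l2norm !big_ord0 sqrtr0.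
Qed.

(** Such an [f] is the matrix of a |-> eta^* (a (x) 1) xi, where xi and eta stand for the synthesis
    operators z |-> sum_j z_j xi_j and z |-> sum_i z_i eta_i. These have norms at most [b] and [c],
    which multiply. *)
Lemma predual_norm_le p q (f : 'M[predual M]_(p, q))
    (xi : 'I_q -> l2 H) (eta : 'I_p -> l2 H) (b c : R) : 0 <= b -> 0 <= c ->
  (forall i j a, f i j a = l2ip H (amp a (xi j)) (eta i)) ->
  (forall z : 'I_q -> C, nrm (l2ip H) (\sum_j z j *: xi j) ^+ 2 <= b ^+ 2 * \sum_j cabs (z j) ^+ 2) ->
  (forall z : 'I_p -> C, nrm (l2ip H) (\sum_j z j *: eta j) ^+ 2 <= c ^+ 2 * \sum_j cabs (z j) ^+ 2) ->
  predual_norm f <= b * c.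
Proof.
move=> b0 c0 hf hxi heta; apply: ge_sup; first exact: pset_neq0.
apply: pset_le => [|n a a1 x y]; first exact: mulr_ge0.
have -> : \sum_i \sum_j \sum_k \sum_l f i j (a k l) * (x j l * (y i k)^*) =
  \sum_k \sum_l l2ip H (amp (a k l) (\sum_j x j l *: xi j)) (\sum_i y i k *: eta i).
  transitivity (\sum_i \sum_k \sum_j \sum_l f i j (a k l) * (x j l * (y i k)^*)).
    by apply: eq_bigr => i _; rewrite exchange_big.
  rewrite exchange_big; apply: eq_bigr => k _ /=.
  transitivity (\sum_i \sum_l \sum_j f i j (a k l) * (x j l * (y i k)^*)).
    by apply: eq_bigr => i _; rewrite exchange_big.
  rewrite exchange_big; apply: eq_bigr => l _ /=.
  rewrite -[l2_dot _ _]/(l2ip H _ _) ip_sumr; apply: eq_bigr => i _.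
  have ampsum : amp (a k l) (\sum_j x j l *: xi j) = \sum_j x j l *: amp (a k l) (xi j).
    rewrite (big_morph (amp (a k l)) (id1 := 0) (op1 := +%R)).
    - by apply: eq_bigr => j _; rewrite ampZ.
    - by move=> u v; rewrite -[u]scale1r amp_lin !scale1r.
    - by apply: l2_ext => m; exact: blin0.
  rewrite ampsum ip_suml; apply: eq_bigr => j _.
  by rewrite ipZl ipZr hf mulrC -mulrA.
apply: le_trans (vn_form_l2 _ _ _) _.
have sx : Num.sqrt (\sum_l nrm (l2ip H) (\sum_j x j l *: xi j) ^+ 2) <=
   b * Num.sqrt (\sum_j \sum_l cabs (x j l) ^+ 2).
  rewrite -[b]ger0_norm // -sqrtr_sqr -sqrtrM ?sqr_ge0 // ler_wsqrtr //.
  rewrite exchange_big mulr_sumr; apply: ler_sum => l _ /=.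
  exact: hxi.
have sy : Num.sqrt (\sum_k nrm (l2ip H) (\sum_i y i k *: eta i) ^+ 2) <=
   c * Num.sqrt (\sum_i \sum_k cabs (y i k) ^+ 2).
  rewrite -[c]ger0_norm // -sqrtr_sqr -sqrtrM ?sqr_ge0 // ler_wsqrtr //.
  rewrite exchange_big mulr_sumr; apply: ler_sum => l _ /=.
  exact: heta.
apply: le_trans (_ : Num.sqrt (\sum_l nrm (l2ip H) (\sum_j x j l *: xi j) ^+ 2) *
   Num.sqrt (\sum_k nrm (l2ip H) (\sum_i y i k *: eta i) ^+ 2) <= _).
  by rewrite -mulrA ler_piMl // mulr_ge0 ?sqrtr_ge0.
apply: le_trans (ler_pM (sqrtr_ge0 _) (sqrtr_ge0 _) sx sy) _.
by rewrite mulrACA mulrA.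
Qed.

(** A crude bound that adds up representations of the entries. It only ensures that the supremum
    defining the predual norm is a genuine upper bound. *)
Lemma pset_bounded p q (f : 'M[predual M]_(p, q)) : has_ubound (pset f).
Proof.
have rep ij : exists xe : l2 H * l2 H, forall a, f ij.1 ij.2 a = l2ip H (amp a xe.1) xe.2.
  by have [xi [eta h]] := predual_vec (f ij.1 ij.2); exists (xi, eta).
have [r hr] := choice rep.
pose b := \sum_(i < p) \sum_(j < q) nrm (l2ip H) (r (i, j)).1 * nrm (l2ip H) (r (i, j)).2.
have b0 : 0 <= b by do 2 apply: sumr_ge0 => ? _; rewrite mulr_ge0 ?nrm_ge0.
exists b; apply: pset_le => // n a a1 x y.
rewrite /b -mulrA mulr_suml; apply: le_trans (cabs_sum _ _ _) _; apply: ler_sum => i _.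
rewrite mulr_suml; apply: le_trans (cabs_sum _ _ _) _; apply: ler_sum => j _.
set xe := r (i, j).
have -> : \sum_k \sum_l f i j (a k l) * (x j l * (y i k)^*) =
  \sum_k \sum_l l2ip H (amp (a k l) (x j l *: xe.1)) (y i k *: xe.2).
  apply: eq_bigr => k _; apply: eq_bigr => l _.
  by rewrite ampZ ipZl ipZr (hr (i, j)) mulrC -mulrA.
apply: le_trans (vn_form_l2 _ _ _) _.
have aux s (z : 'I_s -> 'I_n -> C) i0 (w : l2 H) :
    Num.sqrt (\sum_l nrm (l2ip H) (z i0 l *: w) ^+ 2) <=
    nrm (l2ip H) w * Num.sqrt (\sum_j \sum_l cabs (z j l) ^+ 2).
  rewrite -[nrm _ w]ger0_norm ?nrm_ge0 // -sqrtr_sqr -sqrtrM ?sqr_ge0 // ler_wsqrtr //.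
  under eq_bigr do rewrite nrmZ exprMn mulrC; rewrite -mulr_sumr.
  rewrite ler_wpM2l ?sqr_ge0 // (bigD1 i0) //= lerDl.
  by do 2 apply: sumr_ge0 => ? _; exact: sqr_ge0.
apply: le_trans (_ : Num.sqrt (\sum_l nrm (l2ip H) (x j l *: xe.1) ^+ 2) *
   Num.sqrt (\sum_k nrm (l2ip H) (y i k *: xe.2) ^+ 2) <= _).
  by rewrite -mulrA ler_piMl // mulr_ge0 ?sqrtr_ge0.
apply: le_trans (ler_pM (sqrtr_ge0 _) (sqrtr_ge0 _) (aux _ x j xe.1) (aux _ y i xe.2)) _.
by rewrite mulrACA.
Qed.

Lemma predual_norm_ge0 p q (f : 'M[predual M]_(p, q)) : 0 <= predual_norm f.
Proof.
have [s hs] := pset_neq0 f; apply: le_trans (_ : s <= _).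
  by case: hs => n [a [_ ->]]; exact: opnorm_ge0.
exact: (ub_le_sup (pset_bounded f)).
Qed.

Lemma predual_norm_form p q (f : 'M[predual M]_(p, q)) n (a : 'M[vn_elt M]_n)
    (x : 'I_q -> 'I_n -> C) (y : 'I_p -> 'I_n -> C) : vn_norm a <= 1 ->
  cabs (\sum_i \sum_j \sum_k \sum_l f i j (a k l) * (x j l * (y i k)^*)) <=
     predual_norm f * Num.sqrt (\sum_j \sum_l cabs (x j l) ^+ 2) *
      Num.sqrt (\sum_i \sum_k cabs (y i k) ^+ 2).
Proof.
move=> a1.
set A := (\matrix_(u < p * n, v < q * n)
      (f (mxtens_unindex u).1 (mxtens_unindex v).1
         (a (mxtens_unindex u).2 (mxtens_unindex v).2) : R[i])).
have hA : scalar_opnorm A <= predual_norm f.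
  by apply: (ub_le_sup (pset_bounded f)); exists n, a.
pose x' u := x (@mxtens_unindex q n u).1 (mxtens_unindex u).2.
pose y' u := y (@mxtens_unindex p n u).1 (mxtens_unindex u).2.
have := opnorm_form A x' y'.
rewrite /x' /y' (sum_tens (fun i k => cabs (x i k) ^+ 2)) (sum_tens (fun i k => cabs (y i k) ^+ 2)).
move=> h; apply: le_trans (_ : _ <= scalar_opnorm A * Num.sqrt (\sum_j \sum_l cabs (x j l) ^+ 2) *
      Num.sqrt (\sum_i \sum_k cabs (y i k) ^+ 2)) _; last first.
  by rewrite -!mulrA ler_wpM2r // mulr_ge0 ?sqrtr_ge0.
apply: le_trans h; apply: le_of_eq; congr cabs.
transitivity (\sum_i \sum_k (\sum_j \sum_l f i j (a k l) * x j l) * (y i k)^*).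
  apply: eq_bigr => i _; rewrite exchange_big; apply: eq_bigr => k _ /=; rewrite mulr_suml.
  by apply: eq_bigr => j _; rewrite mulr_suml; apply: eq_bigr => l _; rewrite mulrA.
rewrite -(sum_tens (fun i k => (\sum_j \sum_l f i j (a k l) * x j l) * (y i k)^*)).
apply: eq_bigr => u _; congr (_ * _).
rewrite -(sum_tens (fun j l => f (mxtens_unindex u).1 j (a (mxtens_unindex u).2 l) * x j l)).
by apply: eq_bigr => v _; rewrite mxE.
Qed.
End PredualNorm.

(** * Submatrices, zero padding and rectangular matrices *)

Section OpSpaceNorm.
Context (R : realType).
Local Notation C := R[i].

Lemma sel_form m p (f : 'I_p -> 'I_m) (x : 'I_p -> C) (y : 'I_m -> C) : injective f ->
  cabs (\sum_i x i * (y (f i))^*) <=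
     Num.sqrt (\sum_j cabs (x j) ^+ 2) * Num.sqrt (\sum_i cabs (y i) ^+ 2).
Proof.
move=> fi; apply: le_trans (sumCS x (fun i => y (f i))) _.
rewrite ler_wpM2l ?sqrtr_ge0 // ler_wsqrtr //.
rewrite -(big_imset (h := f) (A := predT) (fun j => cabs (y j) ^+ 2)) /=; last exact: in2W.
rewrite [leRHS](bigID (fun j => j \in f @: predT)) /= lerDl.
by apply: sumr_ge0 => j _; exact: sqr_ge0.
Qed.

Lemma sel_opnorm m p (f : 'I_p -> 'I_m) : injective f ->
  scalar_opnorm (\matrix_(u < m, i < p) ((u == f i)%:R : C)) <= 1.
Proof.
move=> fi; apply: opnorm_le => // x y; rewrite mul1r.
have -> : \sum_i (\sum_j (\matrix_(u < m, i < p) ((u == f i)%:R : C)) i j * x j) * (y i)^* =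
   \sum_j x j * (y (f j))^*.
  under eq_bigr do rewrite mulr_suml.
  rewrite exchange_big; apply: eq_bigr => j _ /=.
  rewrite (bigD1 (f j)) //= mxE eqxx mul1r big1 ?addr0 // => i ij.
  by rewrite mxE (negbTE ij) !mul0r.
exact: sel_form.
Qed.

Lemma sel_opnormT m p (f : 'I_p -> 'I_m) : injective f ->
  scalar_opnorm (\matrix_(i < p, u < m) ((u == f i)%:R : C)) <= 1.
Proof.
move=> fi; apply: opnorm_le => // x y; rewrite mul1r.
have -> : \sum_i (\sum_j (\matrix_(i < p, u < m) ((u == f i)%:R : C)) i j * x j) * (y i)^* =
   (\sum_i y i * (x (f i))^*)^*.
  rewrite rmorph_sum; apply: eq_bigr => i _; rewrite rmorphM /= conjCK mulrC; congr (_ * _).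
  rewrite (bigD1 (f i)) //= mxE eqxx mul1r big1 ?addr0 // => u ui.
  by rewrite mxE (negbTE ui) mul0r.
by rewrite cabsJ mulrC; exact: sel_form.
Qed.

Variable X : opSpace R.

Lemma os_norm0 m n : os_norm (0 : 'M[X]_(m, n)) = 0.
Proof.
have := os_normZ 0 (0 : 'M[X]_(m, n)); rewrite -[complex.Re _]/(cabs 0) cabs0 mul0r => <-.
by congr os_norm; apply/matrixP => i j; rewrite !mxE scaler0.
Qed.
Lemma os_normN m n (v : 'M[X]_(m, n)) : os_norm (- v) = os_norm v.
Proof.
have := os_normZ (-1) v; rewrite -[complex.Re _]/(cabs (-1)) cabsN cabs1 mul1r => <-.
by congr os_norm; apply/matrixP => i j; rewrite !mxE scaleN1r.
Qed.
Lemma os_norm_ge0 m n (v : 'M[X]_(m, n)) : 0 <= os_norm v.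
Proof.
have := os_normD v (- v); rewrite subrr os_norm0 os_normN; lra.
Qed.

(** A submatrix is a product with 0-1 selection matrices, whose norm is at most 1 because the
    selected indices are distinct. *)
Lemma os_sub m n p q (f : 'I_p -> 'I_m) (g : 'I_q -> 'I_n) (v : 'M[X]_(m, n)) :
  injective f -> injective g ->
  os_norm (\matrix_(i, j) v (f i) (g j) : 'M[X]_(p, q)) <= os_norm v.
Proof.
move=> fi gi.
have -> : \matrix_(i, j) v (f i) (g j) =
   smulmx (\matrix_(i < p, u < m) ((u == f i)%:R : C)) v
          (\matrix_(u < n, i < q) ((u == g i)%:R : C)).
  apply/matrixP => i j; rewrite !mxE (sum2_delta (i := f i) (j := g j)) => [|k l].
    by rewrite !mxE !eqxx mul1r scale1r.
  by rewrite !mxE => /orP[] /negbTE ->; rewrite ?mul0r ?mulr0 scale0r.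
apply: le_trans (os_norm_smul _ _ _) _.
apply: le_trans (_ : 1 * os_norm v * 1 <= _); last by rewrite mul1r mulr1.
apply: ler_pM; rewrite ?mulr_ge0 ?opnorm_ge0 ?os_norm_ge0 ?sel_opnorm //.
by rewrite ler_wpM2r ?os_norm_ge0 ?sel_opnormT.
Qed.

Lemma os_pad m n p q (f : 'I_m -> 'I_p) (g : 'I_n -> 'I_q) (v : 'M[X]_(m, n)) (w : 'M[X]_(p, q)) :
  injective f -> injective g ->
  (forall i j, w (f i) (g j) = v i j) ->
  (forall u s, u \notin codom f -> w u s = 0) ->
  (forall u s, s \notin codom g -> w u s = 0) ->
  os_norm w <= os_norm v.
Proof.
move=> fi gi wv wf wg.
have -> : w = smulmx (\matrix_(u < p, i < m) ((u == f i)%:R : C)) v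
          (\matrix_(i < n, u < q) ((u == g i)%:R : C)).
  apply/matrixP => u s; rewrite !mxE.
  have [/codomP[i ->]|uf] := boolP (u \in codom f); last first.
    rewrite wf // big1 // => i _; rewrite big1 // => j _; rewrite !mxE.
    by case: eqP uf => [->|_ _]; [rewrite codom_f|rewrite mul0r scale0r].
  have [/codomP[j ->]|sg] := boolP (s \in codom g); last first.
    rewrite wg // big1 // => i' _; rewrite big1 // => j _; rewrite !mxE.
    by case: (s =P g j) sg => [->|_ _]; [rewrite codom_f|rewrite mulr0 scale0r].
  rewrite wv (sum2_delta (i := i) (j := j)) => [|k l].
    by rewrite !mxE !eqxx mul1r scale1r.
  rewrite !mxE (inj_eq fi) (inj_eq gi) ![_ == k]eq_sym ![_ == l]eq_sym.
  by move=> /orP[] /negbTE ->; rewrite ?mul0r ?mulr0 scale0r.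
apply: le_trans (os_norm_smul _ _ _) _.
apply: le_trans (_ : 1 * os_norm v * 1 <= _); last by rewrite mul1r mulr1.
apply: ler_pM; rewrite ?mulr_ge0 ?opnorm_ge0 ?os_norm_ge0 ?sel_opnormT //.
by rewrite ler_wpM2r ?os_norm_ge0 ?sel_opnorm.
Qed.

Lemma os_norm_sum m n (I : Type) (s : seq I) (P : pred I) (F : I -> 'M[X]_(m, n)) :
  os_norm (\sum_(i <- s | P i) F i) <= \sum_(i <- s | P i) os_norm (F i).
Proof.
elim/big_ind2 : _ => [|x1 x2 y1 y2 h1 h2|//]; first by rewrite os_norm0.
by rewrite (le_trans (os_normD _ _)) // lerD.
Qed.

Lemma os_le_sum m n (v : 'M[X]_(m, n)) : os_norm v <= \sum_i \sum_j rnorm (v i j).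
Proof.
pose e i j := \matrix_(k < m, l < n) (if (k == i) && (l == j) then v i j else 0).
have eE k l : (\sum_i \sum_j e i j) k l = v k l.
  rewrite summxE; under eq_bigr do rewrite summxE.
  rewrite (sum2_delta (i := k) (j := l)) => [|i j]; rewrite mxE ?eqxx //.
  by rewrite ![k == _]eq_sym ![l == _]eq_sym => /orP[] /negbTE ->; rewrite ?andbF.
have -> : v = \sum_i \sum_j e i j by apply/matrixP => k l; rewrite eE.
apply: le_trans (os_norm_sum _ _ _) _; apply: ler_sum => i _.
apply: le_trans (os_norm_sum _ _ _) _; apply: ler_sum => j _.
rewrite eE -os_norm1.
have nc (A : finType) (f : 'I_1 -> A) u : u \notin codom f -> u != f ord0.
  by apply: contraNneq => ->; exact: codom_f.
apply: (os_pad (f := fun _ : 'I_1 => i) (g := fun _ : 'I_1 => j)).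
- by move=> a b _; rewrite !ord1.
- by move=> a b _; rewrite !ord1.
- by move=> a b; rewrite !mxE !eqxx.
- by move=> u s /nc us; rewrite mxE (negbTE us).
- by move=> u s /nc us; rewrite mxE (negbTE us) andbF.
Qed.

Lemma os_entry m n (v : 'M[X]_(m, n)) i j : rnorm (v i j) <= os_norm v.
Proof.
rewrite -os_norm1.
have := @os_sub m n 1 1 (fun=> i) (fun=> j) v.
rewrite (_ : \matrix_(_, _) _ = const_mx (v i j)); last by apply/matrixP => a b; rewrite !mxE.
by apply=> a b _; rewrite !ord1.
Qed.
End OpSpaceNorm.

Section RectangularCb.
Context (R : realType).
Local Notation C := R[i].

(* The complete bounds in factors_cb concern square matrices only; padding to the
   upper right corner transfers them to rectangular ones. *)
Definition ur_pad (V : nmodType) p q (f : 'M[V]_(p, q)) : 'M[V]_(p + q) :=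
  \matrix_(u < p + q, s < p + q) match fintype.split u, fintype.split s with inl i, inr j => f i j | _, _ => 0 end.

Lemma map_ur_pad (V W : nmodType) (T : V -> W) p q (f : 'M[V]_(p, q)) : T 0 = 0 ->
  map_mx T (ur_pad f) = ur_pad (map_mx T f).
Proof. by move=> T0; apply/matrixP => u s; rewrite !mxE; case: (fintype.split u) => i; case: (fintype.split s) => j //; rewrite !mxE. Qed.

Lemma ur_padE (V : nmodType) p q (f : 'M[V]_(p, q)) i j :
  ur_pad f (lshift q i) (rshift p j) = f i j.
Proof. by rewrite mxE -[lshift q i]/(unsplit (inl i)) unsplitK -[rshift p j]/(unsplit (inr j)) unsplitK. Qed.

Lemma os_ur_pad_ge (X : opSpace R) p q (v : 'M[X]_(p, q)) : os_norm v <= os_norm (ur_pad v).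
Proof.
have := os_sub (ur_pad v) (@lshift_inj p q) (@rshift_inj p q).
rewrite (_ : \matrix_(_, _) _ = v) //.
by apply/matrixP => i j; rewrite mxE ur_padE.
Qed.

Lemma os_ur_pad_le (X : opSpace R) p q (v : 'M[X]_(p, q)) : os_norm (ur_pad v) <= os_norm v.
Proof.
apply: (os_pad (f := @lshift p q) (g := @rshift p q)).
- exact: lshift_inj.
- exact: rshift_inj.
- exact: ur_padE.
- move=> u s us; rewrite mxE; case: splitP => i E //.
  by case/codomP: us; exists i; apply: val_inj.
- move=> u s us; rewrite mxE; case: splitP => i E //; case: splitP => j E' //.
  by case/codomP: us; exists j; apply: val_inj.
Qed.

Section Domain.
Context (H : hilbert R) (M : vnAlg H) (X : opSpace R).
Context (T : predual_matNormed M -> X) (c : R).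
Hypothesis lT : linear T.
Hypothesis hT : forall n (v : 'M[predual_matNormed M]_n), os_norm (map_mx T v) <= c * predual_norm v.

Lemma cb_predual_rect p q (f : 'M[predual_matNormed M]_(p, q))
    (xi : 'I_q -> l2 H) (eta : 'I_p -> l2 H) (b d : R) : 0 <= c -> 0 <= b -> 0 <= d ->
  (forall i j a, (f i j : predual M) a = l2ip H (amp a (xi j)) (eta i)) ->
  (forall z : 'I_q -> C, nrm (l2ip H) (\sum_j z j *: xi j) ^+ 2 <= b ^+ 2 * \sum_j cabs (z j) ^+ 2) ->
  (forall z : 'I_p -> C, nrm (l2ip H) (\sum_j z j *: eta j) ^+ 2 <= d ^+ 2 * \sum_j cabs (z j) ^+ 2) ->
  os_norm (map_mx T f) <= c * (b * d).
Proof.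
move=> c0 b0 d0 hf hxi heta.
apply: le_trans (os_ur_pad_ge _) _; rewrite -(map_ur_pad _ (linear_zero lT)).
apply: le_trans (hT _) _; rewrite ler_wpM2l //.
pose xi' (u : 'I_(p + q)) : l2 H := if fintype.split u is inr j then xi j else 0.
pose eta' (u : 'I_(p + q)) : l2 H := if fintype.split u is inl j then eta j else 0.
have spl (i : 'I_p) : fintype.split (lshift q i) = inl i := unsplitK (inl i).
have spr (i : 'I_q) : fintype.split (rshift p i) = inr i := unsplitK (inr i).
apply: (predual_norm_le (xi := xi') (eta := eta')) => //.
- move=> u s a; rewrite /xi' /eta' mxE; case: (fintype.split u) => i; case: (fintype.split s) => j.
  + rewrite (_ : amp a 0 = 0) ?ip0l //.
    by apply: l2_ext => n; exact: blin0.
  + exact: hf.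
  + by rewrite ip0r.
  + by rewrite ip0r.
- move=> z; rewrite !big_split_ord /= big1 ?add0r; last by move=> i _; rewrite /xi' spl scaler0.
  under eq_bigr do rewrite /xi' spr.
  apply: le_trans (hxi _) _; rewrite ler_wpM2l ?sqr_ge0 // lerDr.
  by apply: sumr_ge0 => i _; exact: sqr_ge0.
- move=> z; rewrite !big_split_ord /= [X in _ + X]big1 ?addr0; last by move=> i _; rewrite /eta' spr scaler0.
  under eq_bigr do rewrite /eta' spl.
  apply: le_trans (heta _) _; rewrite ler_wpM2l ?sqr_ge0 // lerDl.
  by apply: sumr_ge0 => i _; exact: sqr_ge0.
Qed.
End Domain.

Lemma cb_vn_rect (K : hilbert R) (N : vnAlg K) (X : opSpace R) (S : X -> vn_elt N) (c : R) :
  linear S -> (forall n (v : 'M[X]_n), vn_norm (map_mx S v) <= c * os_norm v) ->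
  0 <= c ->
  forall p q (v : 'M[X]_(p, q)), vn_norm (map_mx S v) <= c * os_norm v.
Proof.
move=> lS hS c0 p q v.
have spl (i : 'I_p) : fintype.split (lshift q i) = inl i := unsplitK (inl i).
have spr (i : 'I_q) : fintype.split (rshift p i) = inr i := unsplitK (inr i).
apply: le_trans (_ : c * os_norm (ur_pad v) <= _); last first.
  by rewrite ler_wpM2l // os_ur_pad_le.
apply: le_trans (hS _ _); apply: vn_norm_le_form; first exact: vn_norm_ge0.
move=> x y.
pose x' (u : 'I_(p + q)) : K := if fintype.split u is inr j then x j else 0.
pose y' (u : 'I_(p + q)) : K := if fintype.split u is inl j then y j else 0.
have := vn_form (map_mx S (ur_pad v)) x' y'.
have -> : l2norm x' = l2norm x.
  rewrite /l2norm big_split_ord /= big1 ?add0r; last first.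
    by move=> i _; rewrite /x' spl rnorm0 expr0n.
  by congr Num.sqrt; apply: eq_bigr => i _; rewrite /x' spr.
have -> : l2norm y' = l2norm y.
  rewrite /l2norm big_split_ord /= [X in _ + X]big1 ?addr0; last first.
    by move=> i _; rewrite /y' spr rnorm0 expr0n.
  by congr Num.sqrt; apply: eq_bigr => i _; rewrite /y' spl.
have <- // : \sum_i hdot K (\sum_j map_mx S v i j (x j)) (y i) =
   \sum_i hdot K (\sum_j map_mx S (ur_pad v) i j (x' j)) (y' i).
rewrite [RHS]big_split_ord /= [X in _ = _ + X]big1 ?addr0; last first.
  by move=> i _; rewrite /y' spr hdot0r.
apply: eq_bigr => i _; rewrite /y' spl; congr (hdot K _ _).
rewrite [RHS]big_split_ord /= [X in _ = X + _]big1 ?add0r; last first.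
  by move=> j _; rewrite /x' spl blin0.
by apply: eq_bigr => j _; rewrite /x' spr (map_ur_pad _ (linear_zero lS)) ur_padE.
Qed.
End RectangularCb.

Section VnComplete.
Context (R : realType) (K : hilbert R) (N : vnAlg K).
Local Notation C := R[i].

(** A bound for the operator norm, used in place of a norm because [vn_elt N] is only a module
    here. *)
Definition op_bound (b : vn_elt N) (e : R) := forall k, rnorm (b k) <= e * rnorm k.

Lemma vn_BE (a b : vn_elt N) k : (a - b) k = a k - b k. Proof. by []. Qed.
Lemma vn_sumE (I : Type) (r : seq I) (P : pred I) (F : I -> vn_elt N) k :
  (\sum_(i <- r | P i) F i) k = \sum_(i <- r | P i) F i k.
Proof. exact: (big_morph (fun a : vn_elt N => a k)). Qed.

Lemma op_bound_lin c a b d e : op_bound a d -> op_bound b e -> op_bound (c *: a + b) (cabs c * d + e).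
Proof.
move=> ha hb k; rewrite vn_linE (le_trans (rnormD _ _)) // mulrDl -mulrA rnormZ.
by rewrite lerD // ler_wpM2l ?cabs_ge0.
Qed.
Lemma op_boundN a e : op_bound a e -> op_bound (- a) e.
Proof. by move=> ha k; rewrite -[(- a) k]/(- (a k)) rnormN. Qed.

Lemma op_bound_small a : (forall e : R, 0 < e -> op_bound a e) -> a = 0.
Proof.
move=> h; apply: vn_ext => k; apply: small_eq0 => e e0.
have k0 : 0 < rnorm k + 1 by rewrite ltr_wpDl // rnorm_ge0.
apply: le_trans (h _ (divr_gt0 e0 k0) k) _.
by rewrite -mulrA ler_piMr ?(ltW e0) // mulrC ler_pdivrMr // mul1r lerDl.
Qed.

Lemma vn_complete (b : nat -> vn_elt N) :
  (forall e : R, 0 < e -> exists n0, forall m n, (n0 <= m)%N -> (n0 <= n)%N ->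
    op_bound (b m - b n) e) ->
  exists l, forall e : R, 0 < e -> exists n0, forall n, (n0 <= n)%N -> op_bound (l - b n) e.
Proof.
move=> cb.
have lim k : exists l, forall e : R, 0 < e -> exists n0, forall n, (n0 <= n)%N -> rnorm (b n k - l) < e.
  apply: complete_seq => e e0; have k0 : 0 < rnorm k + 1 by rewrite ltr_wpDl // rnorm_ge0.
  have [n0 h] := cb _ (divr_gt0 e0 k0); exists n0 => m n hm hn.
  rewrite -vn_BE; apply: le_lt_trans (h m n hm hn k) _.
  by rewrite -mulrA gtr_pMr // mulrC ltr_pdivrMr // mul1r ltrDl.
have [l hl] := choice lim.
have hl2 (e : R) : 0 < e -> exists n0, forall n, (n0 <= n)%N -> forall k,
    rnorm (l k - b n k) <= e * rnorm k.
  move=> e0; have [n0 hn0] := cb _ e0; exists n0 => n hn k.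
  apply/ler_addgt0Pr => d d0; have [n1 h1] := hl k _ d0.
  have := h1 _ (leq_maxr n0 n1); have := hn0 _ _ hn (leq_maxl n0 n1) k.
  rewrite vn_BE.
  set m := maxn n0 n1 => hx hy.
  have -> : l k - b n k = - (b n k - b m k) - (b m k - l k).
    by rewrite !opprB [RHS]addrC addrA subrK.
  by apply: le_trans (rnormB _ _) _; rewrite rnormN; lra.
have ll : linear l.
  move=> c u v; apply/eqP; rewrite -subr_eq0; apply/eqP/small_eq0 => e e0.
  have e3 : 0 < e / (cabs c + 2).
    by rewrite divr_gt0 // ltr_wpDl ?cabs_ge0.
  have [n1 h1] := hl (c *: u + v) _ e3; have [n2 h2] := hl u _ e3; have [n3 h3] := hl v _ e3.
  pose n := maxn n1 (maxn n2 n3).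
  have {}h1 := h1 n (leq_maxl _ _).
  have {}h2 : rnorm (b n u - l u) < e / (cabs c + 2).
    by apply: h2; rewrite !leq_max leqnn !orbT.
  have {}h3 : rnorm (b n v - l v) < e / (cabs c + 2).
    by apply: h3; rewrite !leq_max leqnn !orbT.
  have -> : l (c *: u + v) - (c *: l u + l v) =
    c *: (b n u - l u) + (b n v - l v) - (b n (c *: u + v) - l (c *: u + v)).
    rewrite blin_linear scalerBr addrACA -opprD.
    set X := c *: b n u + _; set Y := c *: l u + _; set Z := l _.
    by rewrite opprB [RHS]addrC addrA subrK.
  apply: le_trans (rnormB _ _) _; apply: le_trans (lerD (rnormD _ _) (lexx _)) _.
  rewrite rnormZ.
  have : cabs c * rnorm (b n u - l u) <= cabs c * (e / (cabs c + 2)).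
    by rewrite ler_wpM2l ?cabs_ge0 // ltW.
  have : cabs c * (e / (cabs c + 2)) + e / (cabs c + 2) + e / (cabs c + 2) = e.
    by field; rewrite gt_eqF // ltr_wpDl ?cabs_ge0.
  move: h1 h2 h3; set q := e / _; lra.
have [n0 hn0] := hl2 _ ltr01.
have [c c0 hc] := blin_bounded (b n0).
have bl k : rnorm (l k) <= (1 + c) * rnorm k.
  have -> : l k = (l k - b n0 k) + b n0 k by rewrite subrK.
  by apply: le_trans (rnormD _ _) _; rewrite mulrDl lerD // hn0.
have [L hL] := blin_build ll bl.
suff LN : L \in vn_pred N.
  exists (VNElt LN) => e /hl2[n1 h1]; exists n1 => n /h1 hn k.
  by rewrite vn_BE /= hL hn.
apply/asboolP; rewrite -vn_bicommutant => u uN k; rewrite !hL.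
apply/eqP; rewrite -subr_eq0; apply/eqP/small_eq0 => e e0.
have [d d0 hd] := blin_bounded u.
have e2 : 0 < e / (d + 1) by rewrite divr_gt0 // ltr_wpDl.
have [n1 h1] := hl k _ e2; have [n2 h2] := hl (u k) _ e2.
pose n := maxn n1 n2; have {}h1 := h1 n (leq_maxl _ _); have {}h2 := h2 n (leq_maxr _ _).
have ub : u (b n k) = b n (u k).
  by symmetry; apply: uN; have /asboolP := vn_eltP (b n).
have -> : u (l k) - l (u k) = (b n (u k) - l (u k)) - u (b n k - l k).
  by rewrite blinB ub opprB [RHS]addrC addrA subrK.
apply: le_trans (rnormB _ _) _.
have : rnorm (u (b n k - l k)) <= d * (e / (d + 1)).
  by apply: le_trans (hd _) _; rewrite ler_wpM2l // ltW.
have : d * (e / (d + 1)) + e / (d + 1) = e by field; rewrite gt_eqF // ltr_wpDl.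
move: h1 h2; set q := e / _; lra.
Qed.
End VnComplete.

(** * The right factor *)

Section HaagerupExtension.
Context (R : realType) (X Y : opSpace R) (XY : haagerup_tensor X Y).
Local Notation C := R[i].
Local Notation t := (ht_tens XY).

Lemma ht_linl c u v y : t (c *: u + v) y = c *: t u y + t v y.
Proof. by rewrite linearPl. Qed.
Lemma ht_linr c u v x : t x (c *: u + v) = c *: t x u + t x v.
Proof. by rewrite linearPr. Qed.
Lemma ht0l y : t 0 y = 0. Proof. by rewrite linear0l. Qed.
Lemma ht0r x : t x 0 = 0. Proof. by rewrite linear0r. Qed.

(* If the x i are dependent, one of them can be eliminated, which shortens both
   sums; if they are independent, ht_inj makes all y i vanish. *)
Lemma ht_zero (W : lmodType C) (mul_map : X -> Y -> W) :
  (forall c u v y, mul_map (c *: u + v) y = c *: mul_map u y + mul_map v y) ->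
  (forall c u v x, mul_map x (c *: u + v) = c *: mul_map x u + mul_map x v) ->
  forall n (x : 'I_n -> X) (y : 'I_n -> Y),
  \sum_i t (x i) (y i) = 0 -> \sum_i mul_map (x i) (y i) = 0.
Proof.
move=> bl br.
have b0r x : mul_map x 0 = 0 by apply: linear_zero => c u v; exact: br.
have elim (W' : lmodType C) (g : X -> Y -> W') :
    (forall c u v y, g (c *: u + v) y = c *: g u y + g v y) ->
    (forall c u v x, g x (c *: u + v) = c *: g x u + g x v) ->
    forall n (x : 'I_n.+1 -> X) (y : 'I_n.+1 -> Y) (i0 : 'I_n.+1) (c : 'I_n -> C),
    x i0 = \sum_j c j *: x (lift i0 j) ->
    \sum_i g (x i) (y i) = \sum_j g (x (lift i0 j)) (c j *: y i0 + y (lift i0 j)).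
  move=> gl gr n x y i0 c hx.
  have g0l y' : g 0 y' = 0 by apply: (linear_zero (f := g^~ y')) => a u v; exact: gl.
  rewrite (bigD1_ord i0) //= hx.
  have -> : g (\sum_j c j *: x (lift i0 j)) (y i0) = \sum_j c j *: g (x (lift i0 j)) (y i0).
    rewrite (big_morph (fun u => g u (y i0)) (id1 := 0) (op1 := +%R)) //.
      by apply: eq_bigr => j _; rewrite -[c j *: x _]addr0 gl g0l addr0.
    by move=> u v; rewrite -[u in LHS]scale1r gl scale1r.
  by rewrite -big_split; apply: eq_bigr => j _ /=; rewrite gr.
elim=> [x y _|n IH x y sum0]; first by rewrite big_ord0.
have [indep|] := pselect (forall c : 'I_n.+1 -> C, \sum_i c i *: x i = 0 -> forall i, c i = 0).
  by apply: big1 => i _; rewrite (ht_inj indep sum0) b0r.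
move=> /existsNP[c /not_implyP[c0 /existsNP[i0 /eqP ci0]]].
pose d j := - (c i0)^-1 * c (lift i0 j).
have hx : x i0 = \sum_j d j *: x (lift i0 j).
  under eq_bigr do rewrite -scalerA.
  rewrite -scaler_sumr.
  move/eqP: c0; rewrite (bigD1_ord i0) //= addrC addr_eq0 => /eqP ->.
  by rewrite scalerN scaleNr opprK scalerA mulVf // scale1r.
rewrite (elim W mul_map bl br _ _ _ _ _ hx); apply: IH.
by rewrite -(elim XY t ht_linl (fun c u v x => ht_linr c u v x) _ _ _ _ _ hx).
Qed.

Lemma ht_le m r n (v : 'M[X]_(m, r)) (w : 'M[Y]_(r, n)) :
  os_norm (haagerup_mul t v w) <= os_norm v * os_norm w.
Proof.
rewrite ht_norm; apply: ge_inf.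
  by exists 0 => _ [r' [v' [w' [_ ->]]]]; rewrite mulr_ge0 ?os_norm_ge0.
by exists r, v, w.
Qed.

Context (K : hilbert R) (N : vnAlg K).
Context (Sx : X -> vn_elt N) (Sy : Y -> vn_elt N) (cx cy : R).
Hypothesis (cx0 : 0 < cx) (cy0 : 0 < cy).
Hypothesis lSx : linear Sx.
Hypothesis lSy : linear Sy.
Hypothesis hSx : forall n (v : 'M[X]_n), vn_norm (map_mx Sx v) <= cx * os_norm v.
Hypothesis hSy : forall n (v : 'M[Y]_n), vn_norm (map_mx Sy v) <= cy * os_norm v.

Definition mul_map x y := vn_mul (Sx x) (Sy y).
Lemma mul_map_linl c u v y : mul_map (c *: u + v) y = c *: mul_map u y + mul_map v y.
Proof. by apply: vn_ext => k; rewrite /mul_map lSx vn_linE. Qed.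
Lemma mul_map_linr c u v x : mul_map x (c *: u + v) = c *: mul_map x u + mul_map x v.
Proof. by apply: vn_ext => k; rewrite /mul_map lSy /=; exact: (blin_linear (Sx x) c (Sy u k) (Sy v k)). Qed.

Definition bmul m r n (v : 'M[X]_(m, r)) (w : 'M[Y]_(r, n)) : 'M[vn_elt N]_(m, n) :=
  \matrix_(i, j) \sum_k mul_map (v i k) (w k j).

(** [bmul v w] is the product of the operator matrices [map_mx Sx v] and [map_mx Sy w], so the norms
    of these two multiply. *)
Lemma bmul_le m r n (v : 'M[X]_(m, r)) (w : 'M[Y]_(r, n)) :
  vn_norm (bmul v w) <= cx * os_norm v * (cy * os_norm w).
Proof.
apply: vn_norm_le.
  by rewrite !mulr_ge0 ?os_norm_ge0 // ltW.
move=> x.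
have E : (fun i => \sum_j bmul v w i j (x j)) =
    fun i => \sum_k map_mx Sx v i k (\sum_j map_mx Sy w k j (x j)).
  apply/funext => i.
  under [RHS]eq_bigr do rewrite blin_sum; rewrite exchange_big.
  apply: eq_bigr => j _; rewrite mxE vn_sumE; apply: eq_bigr => k _.
  by rewrite !mxE.
rewrite E; apply: le_trans (vn_norm_ub (map_mx Sx v) _) _.
rewrite -mulrA; apply: ler_pM; rewrite ?vn_norm_ge0 ?l2norm_ge0 //.
  by apply: cb_vn_rect => //; exact: ltW.
apply: le_trans (vn_norm_ub (map_mx Sy w) _) _.
by rewrite ler_wpM2r ?l2norm_ge0 //; apply: cb_vn_rect => //; exact: ltW.
Qed.

(** In each entry the two representations are concatenated, the second with a sign, into a tensor
    that vanishes, and [ht_zero] applies. Since [bmul] depends only on the represented tensors, the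
    bound of [bmul_le] passes to the infimum that defines the Haagerup norm. *)
Lemma bmul_eq m n r r' (v : 'M[X]_(m, r)) (w : 'M[Y]_(r, n))
   (v' : 'M[X]_(m, r')) (w' : 'M[Y]_(r', n)) :
  haagerup_mul t v w = haagerup_mul t v' w' -> bmul v w = bmul v' w'.
Proof.
move=> /matrixP E; apply/matrixP => i j; have := E i j; rewrite !mxE => {}E.
pose x (k : 'I_(r + r')) := match fintype.split k with inl a => v i a | inr b => v' i b end.
pose y (k : 'I_(r + r')) := match fintype.split k with inl a => w a j | inr b => - w' b j end.
have spl (k : 'I_r) : fintype.split (lshift r' k) = inl k := unsplitK (inl k).
have spr (k : 'I_r') : fintype.split (rshift r k) = inr k := unsplitK (inr k).
have gen (W : lmodType C) (g : X -> Y -> W) : (forall a b, g a (- b) = - g a b) ->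
   \sum_k g (x k) (y k) = \sum_k g (v i k) (w k j) - \sum_k g (v' i k) (w' k j).
  move=> gN; rewrite big_split_ord /= -sumrN; congr (_ + _).
    by apply: eq_bigr => k _; rewrite /x /y spl.
  by apply: eq_bigr => k _; rewrite /x /y spr gN.
apply/eqP; rewrite -subr_eq0 -(gen _ mul_map); last first.
  by move=> a b; apply: vn_ext => k; rewrite /mul_map -scaleN1r -[_ *: b]addr0 lSy
     (linear_zero lSy) addr0 scaleN1r /=; exact: (blinN (Sx a)).
apply/eqP/(ht_zero mul_map_linl (fun c u v x => mul_map_linr c u v x)).
rewrite (gen _ t) ?E ?subrr // => a b.
by rewrite -scaleN1r -[_ *: b]addr0 ht_linr ht0r addr0 scaleN1r.
Qed.

Lemma bmul_ht m r n (v : 'M[X]_(m, r)) (w : 'M[Y]_(r, n)) :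
  vn_norm (bmul v w) <= cx * cy * os_norm (haagerup_mul t v w).
Proof.
have c0 : 0 < cx * cy by exact: mulr_gt0.
rewrite mulrC -ler_pdivrMr // ht_norm; apply: lb_le_inf.
  by exists (os_norm v * os_norm w), r, v, w.
move=> _ [r' [v' [w' [E ->]]]]; rewrite ler_pdivrMr // -(bmul_eq E).
apply: le_trans (bmul_le _ _) _; apply: le_of_eq; ring.
Qed.

(** The vectors are indexed by all integers, with [x] vanishing from [r] on, so that several
    representations can be given a common length. *)
Definition alg_mul_rep (r : nat) (x : nat -> X) (y : nat -> Y) (z : XY) (b : vn_elt N) :=
  [/\ forall k, (r <= k)%N -> x k = 0, z = \sum_(k < r) t (x k) (y k) &
      b = \sum_(k < r) mul_map (x k) (y k)].
Definition alg_mul z b := exists r x y, alg_mul_rep r x y z b.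

Lemma alg_mul_widen r x y z b r' : (r <= r')%N -> alg_mul_rep r x y z b -> alg_mul_rep r' x y z b.
Proof.
move=> rr [x0 -> ->]; split; first by move=> k rk; apply: x0; exact: leq_trans rk.
  rewrite -(subnKC rr) big_split_ord /= [X in _ = _ + X]big1 ?addr0 //.
  by move=> i _; rewrite x0 ?leq_addr // ht0l.
rewrite -(subnKC rr) big_split_ord /= [X in _ = _ + X]big1 ?addr0 //.
move=> i _; rewrite x0 ?leq_addr //; apply: vn_ext => k.
by rewrite /mul_map (linear_zero lSx).
Qed.

(** Separately represented entries become one Haagerup product. The inner index runs over the
    positions (i, j) together with the summation index; the block of (i, j) sits in row [i] of [v]
    and in column [j] of [w], so distinct entries do not mix. *)
Lemma alg_mul_mx m n (z : 'M[XY]_(m, n)) (b : 'M[vn_elt N]_(m, n)) :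
  (forall i j, alg_mul (z i j) (b i j)) ->
  exists r (v : 'M[X]_(m, r)) (w : 'M[Y]_(r, n)), z = haagerup_mul t v w /\ b = bmul v w.
Proof.
move=> zb.
have ex (ij : 'I_m * 'I_n) : exists p : nat * (nat -> X) * (nat -> Y),
    alg_mul_rep p.1.1 p.1.2 p.2 (z ij.1 ij.2) (b ij.1 ij.2).
  by have [r [x [y h]]] := zb ij.1 ij.2; exists (r, x, y).
have [p hp] := choice ex.
pose s := (\max_ij (p ij).1.1)%N.
have hs ij : alg_mul_rep s (p ij).1.2 (p ij).2 (z ij.1 ij.2) (b ij.1 ij.2).
  by apply: alg_mul_widen (hp ij); exact: (leq_bigmax ij).
pose T := ('I_m * 'I_n * 'I_s)%type.
pose v := \matrix_(i < m, a < #|{: T}|)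
  let e := enum_val a : T in if e.1.1 == i then (p e.1).1.2 e.2 else 0.
pose w := \matrix_(a < #|{: T}|, j < n)
  let e := enum_val a : T in if e.1.2 == j then (p e.1).2 e.2 else 0.
have gen (W : lmodType C) (g : X -> Y -> W) : (forall a, g a 0 = 0) -> (forall a, g 0 a = 0) ->
    forall i j, \sum_a g (v i a) (w a j) = \sum_(k < s) g ((p (i, j)).1.2 k) ((p (i, j)).2 k).
  move=> g0r g0l i j.
  transitivity (\sum_(e : T) g (if e.1.1 == i then (p e.1).1.2 e.2 else 0)
                               (if e.1.2 == j then (p e.1).2 e.2 else 0)).
    rewrite (reindex (fun a : 'I_#|{: T}| => enum_val a : T)) /=; last first.
      exists (fun e => enum_rank e) => a _; first by rewrite enum_valK.
      by rewrite enum_rankK.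
    by apply: eq_bigr => a _; rewrite !mxE.
  rewrite -(pair_bigA _ (fun ij (k : 'I_s) => g (if ij.1 == i then (p ij).1.2 k else 0)
                               (if ij.2 == j then (p ij).2 k else 0))) /=.
  rewrite (bigD1 (i, j)) //= !eqxx [X in _ + X]big1 ?addr0 // => -[i' j'].
  rewrite xpair_eqE negb_and /= => /orP[/negbTE ->|/negbTE ->];
    by apply: big1 => k _; rewrite ?g0l ?g0r.
exists #|{: T}|, v, w; split; apply/matrixP => i j; rewrite mxE.
  rewrite gen ?(fun a => ht0l a) //; [by case: (hs (i, j))|exact: ht0r|exact: ht0l].
rewrite gen; first by case: (hs (i, j)).
  by move=> a; apply: vn_ext => k; rewrite /mul_map (linear_zero lSy) /=; exact: (blin0 (Sx a)).
by move=> a; apply: vn_ext => k; rewrite /mul_map (linear_zero lSx).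
Qed.

(* (u, b) lies in the closure of the graph of x (x) y |-> Sx x * Sy y. *)
Definition mul_closure (u : XY) (b : vn_elt N) := forall e : R, 0 < e ->
  exists z b', [/\ alg_mul z b', rnorm (z - u) <= e & op_bound (b' - b) e].

Let c := cx * cy.
Let c0 : 0 < c. Proof. exact: mulr_gt0. Qed.

Lemma alg_mul_lin a z b z' b' : alg_mul z b -> alg_mul z' b' -> alg_mul (a *: z + z') (a *: b + b').
Proof.
move=> [r [x [y [x0 -> ->]]]] [r' [x' [y' [x0' -> ->]]]].
exists (r + r')%N, (fun k => if (k < r)%N then a *: x k else x' (k - r)%N),
  (fun k => if (k < r)%N then y k else y' (k - r)%N); split.
- move=> k rk; have h : (r <= k)%N by exact: leq_trans (leq_addr _ _) rk.
  by rewrite ltnNge h /= x0' // leq_subRL.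
- rewrite big_split_ord scaler_sumr /=; congr (_ + _); apply: eq_bigr => k _.
    by rewrite ltn_ord -[a *: x k]addr0 ht_linl ht0l addr0.
  by rewrite ltnNge leq_addr /= addKn.
- rewrite big_split_ord scaler_sumr /=; congr (_ + _); apply: eq_bigr => k _.
    rewrite ltn_ord -[a *: x k]addr0 mul_map_linl.
    have -> : mul_map 0 (y k) = 0.
      by apply: vn_ext => h; rewrite /mul_map (linear_zero lSx).
    by rewrite addr0.
  by rewrite ltnNge leq_addr /= addKn.
Qed.

Lemma alg_mul_bound z b : alg_mul z b -> op_bound b (c * rnorm z).
Proof.
move=> zb; have [|r [v [w [ez eb]]]] := @alg_mul_mx 1 1 (const_mx z) (const_mx b).
  by move=> i j; rewrite !mxE.
have := bmul_ht v w; rewrite -ez -eb os_norm1 => h k.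
have := vn_norm_ub (const_mx b : 'M[vn_elt N]_1) (fun=> k).
rewrite /l2norm !big_ord1 !sqrtr_sqr mxE !ger0_norm ?rnorm_ge0 // => h2.
by apply: le_trans h2 _; rewrite ler_wpM2r ?rnorm_ge0.
Qed.

(** Images of approximating tensors form a Cauchy sequence by [alg_mul_bound], and [N] is complete
    for the operator norm. *)
Lemma mul_closure_ex u : exists b, mul_closure u b.
Proof.
have app n : exists zb : XY * vn_elt N, alg_mul zb.1 zb.2 /\ rnorm (zb.1 - u) < n.+1%:R^-1.
  have [z [r [x [y ->]]] hz] := dense_near u (@ht_dense _ _ _ XY) (e := n.+1%:R^-1)
     (ltac:(by rewrite invr_gt0)).
  exists (\sum_i t (x i) (y i), \sum_i mul_map (x i) (y i)); split; last by rewrite rnorm_distC.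
  exists r, (fun k => if insub k is Some i then x i else 0),
     (fun k => if insub k is Some i then y i else 0); split => /=.
  - by move=> k rk; rewrite insubF // ltnNge rk.
  - by apply: eq_bigr => i _; rewrite valK.
  - by apply: eq_bigr => i _; rewrite valK.
have [zb hzb] := choice app.
have dif m n : op_bound ((zb m).2 - (zb n).2) (c * rnorm ((zb m).1 - (zb n).1)).
  apply: alg_mul_bound; rewrite -[(zb n).2]opprK -[(zb n).1]opprK !opprK.
  have := alg_mul_lin (-1) (hzb n).1 (hzb m).1.
  by rewrite !scaleN1r addrC [X in alg_mul _ X]addrC.
have [|b hb] := @vn_complete R K N (fun n => (zb n).2).
  move=> e e0; have e2 : 0 < e / (2 * c) by rewrite divr_gt0 // mulr_gt0.
  have [n0 _ hn0] := near_infty_natSinv_lt (PosNum e2).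
  exists n0 => m n hm hn k; apply: le_trans (dif m n k) _.
  rewrite ler_wpM2r ?rnorm_ge0 // mulrC -ler_pdivlMr //.
  have -> : (zb m).1 - (zb n).1 = ((zb m).1 - u) - ((zb n).1 - u).
    by rewrite opprB addrA subrK.
  apply: le_trans (rnormB _ _) _.
  have h1 := (hzb m).2; have h2 := (hzb n).2.
  have h3 : m.+1%:R^-1 < e / (2 * c) := hn0 _ hm.
  have h4 : n.+1%:R^-1 < e / (2 * c) := hn0 _ hn.
  have -> : e / c = e / (2 * c) + e / (2 * c) by field; rewrite gt_eqF.
  by apply: lerD; apply: ltW; [apply: lt_trans h3|apply: lt_trans h4].
exists b => e e0; have [n0 h0] := hb _ e0.
have [n1 _ hn1] := near_infty_natSinv_lt (PosNum e0).
pose n := maxn n0 n1; exists (zb n).1, (zb n).2; split.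
- by case: (hzb n).
- apply: le_trans (ltW (hzb n).2) _.
  by apply: ltW; exact: (hn1 n (leq_maxr _ _)).
- by rewrite -opprB; apply: op_boundN; apply: h0; exact: leq_maxl.
Qed.

Lemma mul_closure_bound u b : mul_closure u b -> op_bound b (c * rnorm u).
Proof.
move=> ub k; apply/ler_addgt0Pr => e e0.
have k1 : 0 < rnorm k + 1 by rewrite ltr_wpDl // rnorm_ge0.
(* The error in [z] contributes at most c d ||k|| and the error in [b'] at most d ||k||; this choice
   of d keeps their sum below [e]. *)
have d0 : 0 < e / (rnorm k + 1) / (c + 1) by rewrite !divr_gt0 // ltr_wpDl // ltW.
have [z [b' [zb zu bb]]] := ub _ d0.
have h1 := alg_mul_bound zb k; have h2 := bb k.
have -> : b k = b' k - (b' - b) k by rewrite vn_BE opprB addrC subrK.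
apply: le_trans (rnormB _ _) _.
set d := e / _ / _ in zu h2 d0.
have h3 : rnorm z <= rnorm u + d.
  by have := rnormD (z - u) u; rewrite subrK; lra.
have h4 : c * rnorm z * rnorm k <= c * (rnorm u + d) * rnorm k.
  by rewrite ler_wpM2r ?rnorm_ge0 // ler_wpM2l // ltW.
have h5 : (c + 1) * d * rnorm k <= e.
  rewrite (_ : _ * _ = e * (rnorm k / (rnorm k + 1))); last first.
    by rewrite /d; field; rewrite !gt_eqF // ltr_wpDl // ltW.
  by rewrite ler_piMr ?(ltW e0) // ler_pdivrMr // mul1r lerDl.
have : c * (rnorm u + d) * rnorm k + d * rnorm k = c * rnorm u * rnorm k + (c + 1) * d * rnorm k.
  by ring.
lra.
Qed.

Lemma mul_closure_lin a u b u' b' : mul_closure u b -> mul_closure u' b' ->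
  mul_closure (a *: u + u') (a *: b + b').
Proof.
move=> h h' e e0.
have a1 : 0 < cabs a + 1 by rewrite ltr_wpDl // cabs_ge0.
have d0 : 0 < e / (cabs a + 1) by rewrite divr_gt0.
have [z [y [zy zu yb]]] := h _ d0; have [z' [y' [zy' zu' yb']]] := h' _ d0.
have E : cabs a * (e / (cabs a + 1)) + e / (cabs a + 1) = e by field; rewrite gt_eqF.
exists (a *: z + z'), (a *: y + y'); split; first exact: alg_mul_lin.
  rewrite opprD addrACA -scalerBr (le_trans (rnormD _ _)) // rnormZ.
  have : cabs a * rnorm (z - u) <= cabs a * (e / (cabs a + 1)) by rewrite ler_wpM2l ?cabs_ge0.
  lra.
rewrite opprD addrACA -scalerBr -E; exact: op_bound_lin.
Qed.

Lemma mul_closure_unique u b b' : mul_closure u b -> mul_closure u b' -> b = b'.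
Proof.
move=> h h'; apply/eqP; rewrite -subr_eq0; apply/eqP/op_bound_small => e e0 k.
have := mul_closure_bound (mul_closure_lin (-1) h' h).
rewrite !scaleN1r [- u + u]addNr rnorm0 mulr0 => /(_ k).
rewrite mul0r [- b' + b]addrC => /le_trans; apply.
by rewrite mulr_ge0 ?rnorm_ge0 // ltW.
Qed.

Lemma haagerup_extension : exists S : XY -> vn_elt N,
  [/\ linear S, (forall x y, S (t x y) = mul_map x y),
     (forall u, op_bound (S u) (c * rnorm u)) &
     forall n (v : 'M[XY]_n), vn_norm (map_mx S v) <= c * os_norm v].
Proof.
have [S hS] := choice mul_closure_ex; exists S; split.
- move=> a u v; apply: mul_closure_unique (hS _) _; exact: mul_closure_lin.
- move=> x y; apply: mul_closure_unique (hS _) _ => e e0; exists (t x y), (mul_map x y); split.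
  + exists 1%N, (fun k => if k == 0%N then x else 0), (fun=> y).
    by split; [case|rewrite big_ord1|rewrite big_ord1].
  + by rewrite subrr rnorm0 ltW.
  + by move=> k; rewrite subrr rnorm0 mulr_ge0 ?rnorm_ge0 // ltW.
- by move=> u; apply: mul_closure_bound.
move=> n u; apply/ler_addgt0Pr => e e0.
(* [n2] is n^2, the number of entries. Entrywise errors [d] change the norm of [u] and that of its
   image by at most n^2 d each, and the first change is multiplied by [c]. *)
pose n2 : R := \sum_(i < n) \sum_(j < n) 1.
have n20 : 0 <= n2 by do 2 apply: sumr_ge0 => ? _.
have [d d0 h1] : exists2 d : R, 0 < d & (c + 1) * (n2 * d) <= e.
  have c1 : 0 < c + 1 by rewrite ltr_wpDl // ltW.
  have n21 : 0 < n2 + 1 by rewrite ltr_wpDl.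
  exists (e / ((n2 + 1) * (c + 1))); first by rewrite divr_gt0 // mulr_gt0.
  have -> : (c + 1) * (n2 * (e / ((n2 + 1) * (c + 1)))) = e * (n2 / (n2 + 1)).
    by field; rewrite !gt_eqF.
  by rewrite ler_piMr ?(ltW e0) // ler_pdivrMr // mul1r lerDl.
have ex (ij : 'I_n * 'I_n) : exists p : XY * vn_elt N,
    [/\ alg_mul p.1 p.2, rnorm (p.1 - u ij.1 ij.2) <= d & op_bound (p.2 - S (u ij.1 ij.2)) d].
  by have [z [b [g1 g2 g3]]] := hS (u ij.1 ij.2) _ d0; exists (z, b).
have [p hp] := choice ex.
have [|r [v [w [ez eb]]]] := @alg_mul_mx n n (\matrix_(i, j) (p (i, j)).1) (\matrix_(i, j) (p (i, j)).2).
  by move=> i j; rewrite !mxE; case: (hp (i, j)).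
set z := \matrix_(i, j) (p (i, j)).1 in ez; set b := \matrix_(i, j) (p (i, j)).2 in eb.
have bz : vn_norm b <= c * os_norm z by rewrite eb ez; exact: bmul_ht.
have zu : os_norm z <= os_norm u + n2 * d.
  have : os_norm (z - u) <= n2 * d.
    apply: le_trans (os_le_sum _) _; rewrite mulr_suml; apply: ler_sum => i _.
    rewrite mulr_suml; apply: ler_sum => j _; rewrite mul1r !mxE.
    by case: (hp (i, j)).
  by have := os_normD (z - u) u; rewrite subrK; lra.
have Sb : vn_norm (map_mx S u) <= vn_norm b + n2 * d.
  apply: vn_norm_le_form.
    by rewrite addr_ge0 ?vn_norm_ge0 // mulr_ge0 // ltW.
  move=> x y.
  have -> : \sum_i hdot K (\sum_j map_mx S u i j (x j)) (y i) =
     \sum_i hdot K (\sum_j b i j (x j)) (y i) -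
     \sum_i \sum_j hdot K ((b i j - S (u i j)) (x j)) (y i).
    rewrite -sumrB; apply: eq_bigr => i _; rewrite !hdot_suml -sumrB.
    by apply: eq_bigr => j _; rewrite -hdotBl vn_BE opprB addrC subrK mxE.
  apply: le_trans (cabsB _ _) _; rewrite !mulrDl lerD ?vn_form //.
  rewrite -!mulrA mulr_suml; apply: le_trans (cabs_sum _ _ _) _; apply: ler_sum => i _.
  rewrite mulr_suml; apply: le_trans (cabs_sum _ _ _) _; apply: ler_sum => j _.
  rewrite mul1r [leRHS](mulrA d); apply: le_trans (hdot_CS _ _) _.
  apply: ler_pM; rewrite ?rnorm_ge0 ?l2norm_coord //.
  have [_ _ h] := hp (i, j); rewrite [b i j]mxE; apply: le_trans (h (x j)) _.
  by rewrite ler_wpM2l ?l2norm_coord // ltW.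
have h : c * os_norm z <= c * (os_norm u + n2 * d) by rewrite ler_wpM2l // ltW.
have : c * (os_norm u + n2 * d) + n2 * d = c * os_norm u + (c + 1) * (n2 * d) by ring.
lra.
Qed.

End HaagerupExtension.

(** * Traces along orthonormal families *)

Section OrthonormalFamilies.
Context (R : realType) (H : hilbert R).
Local Notation C := R[i].
Local Notation "<| x , y |>" := (hdot H x y) (at level 0, x at level 69, y at level 69).

Definition fcat n m (v : 'I_n -> H) (w : 'I_m -> H) (i : 'I_(n + m)) : H :=
  match fintype.split i with inl a => v a | inr b => w b end.
Lemma fcatl n m (v : 'I_n -> H) (w : 'I_m -> H) i : fcat v w (lshift m i) = v i.
Proof. by rewrite /fcat -[lshift m i]/(unsplit (inl i)) unsplitK. Qed.
Lemma fcatr n m (v : 'I_n -> H) (w : 'I_m -> H) i : fcat v w (rshift n i) = w i.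
Proof. by rewrite /fcat -[rshift n i]/(unsplit (inr i)) unsplitK. Qed.

Definition ortho n (v : 'I_n -> H) := forall i j, <|v i, v j|> = (i == j)%:R.
Definition fproj n (v : 'I_n -> H) x := \sum_i <|x, v i|> *: v i.
(* The synthesis operator c |-> sum_i c i h i has norm at most b. *)
Definition bessel n (h : 'I_n -> H) (b : R) := forall c : 'I_n -> C,
  rnorm (\sum_i c i *: h i) ^+ 2 <= b ^+ 2 * \sum_i cabs (c i) ^+ 2.

Section Ortho.
Context (n : nat) (v : 'I_n -> H).
Hypothesis ov : ortho v.

Lemma fproj_fix j : fproj v (v j) = v j.
Proof.
rewrite /fproj (bigD1 j) //= ov eqxx scale1r big1 ?addr0 // => i ij.
by rewrite ov eq_sym (negbTE ij) scale0r.
Qed.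
Lemma fproj_lin c x y : fproj v (c *: x + y) = c *: fproj v x + fproj v y.
Proof.
rewrite scaler_sumr -big_split; apply: eq_bigr => i _.
by rewrite hdot_lin scalerDl scalerA.
Qed.
Lemma fprojB x y : fproj v (x - y) = fproj v x - fproj v y.
Proof. by rewrite -scaleN1r addrC fproj_lin scaleN1r addrC. Qed.
Lemma fproj_sym x y : <|fproj v x, y|> = <|x, fproj v y|>.
Proof.
rewrite hdot_suml hdot_sumr; apply: eq_bigr => i _.
by rewrite hdotZl hdotZr -hdot_conj mulrC.
Qed.
Lemma fproj_coord x i : <|fproj v x, v i|> = <|x, v i|>.
Proof. by rewrite fproj_sym fproj_fix. Qed.
Lemma fproj_idem x : fproj v (fproj v x) = fproj v x.
Proof. by rewrite /fproj; apply: eq_bigr => i _; rewrite fproj_coord. Qed.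
Lemma fproj_perp x : <|x - fproj v x, fproj v x|> = 0.
Proof. by rewrite -fproj_sym fprojB fproj_idem subrr hdot0l. Qed.
Lemma fprojC_le x : rnorm (x - fproj v x) <= rnorm x.
Proof.
rewrite -(ler_pXn2r (n := 2)) ?nnegrE ?rnorm_ge0 //.
by rewrite -[x in leRHS](subrK (fproj v x)) (rnorm2D (x - fproj v x)) fproj_perp mulr0 addr0 lerDl sqr_ge0.
Qed.
Lemma ortho_bessel : bessel v 1.
Proof.
move=> c; rewrite expr1n mul1r rnorm2E hdot_suml Re_sum; apply: ler_sum => i _.
rewrite hdot_sumr (bigD1 i) //= big1 ?addr0; last first.
  by move=> j ji; rewrite hdotZl hdotZr ov eq_sym (negbTE ji) !mulr0.
by rewrite hdotZl hdotZr ov eqxx mulr1 mulJ.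
Qed.
End Ortho.

Lemma gram_schmidt (L : seq H) : exists n (v : 'I_n -> H), ortho v /\
  forall x, x \in L -> fproj v x = x.
Proof.
elim: L => [|x L [n [v [ov hv]]]].
  by exists 0%N, (fun=> 0); split=> // -[].
pose r := x - fproj v x.
have rv i : <|r, v i|> = 0 by rewrite hdotBl fproj_coord // subrr.
have [r0|r0] := eqVneq (rnorm r) 0.
  exists n, v; split => // y; rewrite inE => /orP[/eqP ->|/hv//].
  by move/rnorm_eq0/eqP : r0; rewrite subr_eq0 => /eqP <-.
pose u := ((rnorm r)^-1)%:C%C *: r.
have uv i : <|u, v i|> = 0 by rewrite hdotZl rv mulr0.
have vu i : <|v i, u|> = 0 by rewrite hdot_conj uv conjC0.
have uu : <|u, u|> = 1.
  rewrite hdotZl hdotZr hdot_nrm conjR mulrA -!rmorphM /=.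
  by rewrite expr2 mulrACA mulVf // mulr1.
have ow : ortho (fcat v (fun _ : 'I_1 => u)).
  move=> p q; rewrite -[p]splitK -[q]splitK.
  case: (fintype.split p) => a; case: (fintype.split q) => b /=;
    rewrite ?fcatl ?fcatr ?eq_lshift ?eq_rshift ?eq_lrshift ?eq_rlshift //;
    by rewrite ?vu ?uv // uu !ord1 eqxx.
exists (n + 1)%N, (fcat v (fun=> u)); split => // y.
have prE z : fproj (fcat v (fun _ : 'I_1 => u)) z = fproj v z + <|z, u|> *: u.
  rewrite /fproj big_split_ord big_ord1 fcatr; congr (_ + _).
  by apply: eq_bigr => i _; rewrite fcatl.
rewrite inE prE => /orP[/eqP ->|yL]; last first.
  rewrite hv // (_ : <|y, u|> = 0) ?scale0r ?addr0 //.
  rewrite -(hv _ yL) hdot_suml big1 // => i _.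
  by rewrite hdotZl vu mulr0.
have -> : <|x, u|> = (rnorm r)%:C%C.
  rewrite -[x in <|x, _|>](subrK (fproj v x)) -/r hdotDl.
  rewrite (_ : <|fproj v x, u|> = 0); last first.
    rewrite hdot_suml big1 // => i _.
    by rewrite hdotZl vu mulr0.
  rewrite addr0 hdotZr hdot_nrm conjR -rmorphM /=.
  by rewrite expr2 mulrA mulVf // mul1r.
rewrite /u scalerA -rmorphM /= divff // scale1r /r addrC subrK //.
Qed.

Record fam := Fam { fam_size : nat; fam_vec : 'I_fam_size -> H }.
(* Orthonormal families, directed by the finite sets that their span contains. *)
Definition bases : set_system fam := [set A | exists L : seq H,
  [set G | ortho (@fam_vec G) /\ forall x, x \in L -> fproj (@fam_vec G) x = x] `<=` A].

#[global] Instance bases_proper : ProperFilter bases.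
Proof.
apply: Build_ProperFilter.
  by move=> [L hL]; have [n [v hv]] := gram_schmidt L; apply: (hL (@Fam n v)).
split.
- by exists [::].
- move=> A B [L LA] [L' LB]; exists (L ++ L') => G [oG hG]; split.
    by apply: LA; split => // x xL; apply: hG; rewrite mem_cat xL.
  by apply: LB; split => // x xL; apply: hG; rewrite mem_cat xL orbT.
- by move=> A B AB [L LA]; exists L => G /LA /AB.
Qed.

Lemma bases_near (L : seq H) : \forall G \near bases,
  ortho (@fam_vec G) /\ forall x, x \in L -> fproj (@fam_vec G) x = x.
Proof. by exists L. Qed.

Lemma bessel_map n (h : 'I_n -> H) b (T : H -> H) (k : R) : linear T -> 0 <= k -> 0 <= b ->
  (forall x, rnorm (T x) <= k * rnorm x) -> bessel h b -> bessel (T \o h) (k * b).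
Proof.
move=> lT k0 b0 hT hb c.
have T0 := linear_zero lT.
have -> : \sum_i c i *: (T \o h) i = T (\sum_i c i *: h i).
  rewrite (big_morph T (id1 := 0) (op1 := +%R)) //.
    by apply: eq_bigr => i _; rewrite -[c i *: h i]addr0 lT T0 addr0.
  by move=> x y; rewrite -[x in LHS]scale1r lT scale1r.
apply: le_trans (_ : (k * rnorm (\sum_i c i *: h i)) ^+ 2 <= _).
  by rewrite ler_pXn2r ?nnegrE ?mulr_ge0 ?rnorm_ge0.
by rewrite !exprMn -[leRHS]mulrA ler_wpM2l ?sqr_ge0 ?hb.
Qed.

Lemma sum_fcat n m (c : 'I_(n + m) -> C) (v : 'I_n -> H) (w : 'I_m -> H) :
  \sum_i c i *: fcat v w i =
  \sum_i c (lshift m i) *: v i + \sum_i c (rshift n i) *: w i.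
Proof.
rewrite big_split_ord; congr (_ + _); apply: eq_bigr => i _.
  by rewrite fcatl.
by rewrite fcatr.
Qed.

Lemma bessel_cat_perp n m (v : 'I_n -> H) (w : 'I_m -> H) : bessel v 1 -> bessel w 1 ->
  (forall i j, <|w j, v i|> = 0) -> bessel (fcat v w) 1.
Proof.
move=> hv hw vw c; rewrite sum_fcat rnorm2D big_split_ord mulrDr /=.
rewrite (_ : <|_, _|> = 0) ?mulr0 ?addr0 ?lerD ?hv ?hw //.
rewrite hdot_suml big1 // => i _; rewrite hdot_sumr big1 // => j _.
by rewrite hdotZl hdotZr hdot_conj vw conjC0 !mulr0.
Qed.

Lemma bessel_cat n m (v : 'I_n -> H) (w : 'I_m -> H) (b d : R) : 0 <= b -> 0 <= d ->
  bessel v b -> bessel w d -> bessel (fcat v w) (Num.sqrt (b ^+ 2 + d ^+ 2)).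
Proof.
move=> b0 d0 hv hw c; rewrite sum_fcat big_split_ord /= sqr_sqrtr ?addr_ge0 ?sqr_ge0 //.
set x := \sum_i c (lshift m i) *: _; set y := \sum_i c (rshift n i) *: _.
set s := \sum_i cabs (c (lshift m i)) ^+ 2; set r := \sum_i cabs (c (rshift n i)) ^+ 2.
have s0 : 0 <= s by apply: sumr_ge0 => i _; exact: sqr_ge0.
have r0 : 0 <= r by apply: sumr_ge0 => i _; exact: sqr_ge0.
have hx : rnorm x <= b * Num.sqrt s.
  rewrite -(ler_pXn2r (n := 2)) ?nnegrE ?rnorm_ge0 ?mulr_ge0 ?sqrtr_ge0 //.
  by rewrite exprMn sqr_sqrtr // hv.
have hy : rnorm y <= d * Num.sqrt r.
  rewrite -(ler_pXn2r (n := 2)) ?nnegrE ?rnorm_ge0 ?mulr_ge0 ?sqrtr_ge0 //.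
  by rewrite exprMn sqr_sqrtr // hw.
apply: le_trans (_ : (b * Num.sqrt s + d * Num.sqrt r) ^+ 2 <= _).
  rewrite ler_pXn2r ?nnegrE ?rnorm_ge0 ?addr_ge0 ?mulr_ge0 ?sqrtr_ge0 //.
  by apply: le_trans (rnormD _ _) _; rewrite lerD.
rewrite -[s in leRHS]sqr_sqrtr // -[r in leRHS]sqr_sqrtr //.
have := sqr_ge0 (b * Num.sqrt r - d * Num.sqrt s).
set p := Num.sqrt s; set q := Num.sqrt r => h.
rewrite -subr_ge0; apply: le_trans h _; apply: le_of_eq; ring.
Qed.

Section Trace.
Context (B : H -> H -> C) (K : R).
Hypothesis Bl : forall c x y z, B (c *: x + y) z = c * B x z + B y z.
Hypothesis Br : forall c x y z, B z (c *: x + y) = c^* * B z x + B z y.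
Hypothesis K0 : 0 <= K.
Hypothesis BK : forall n (h k : 'I_n -> H) (b d : R), 0 <= b -> 0 <= d ->
  bessel h b -> bessel k d -> cabs (\sum_i B (h i) (k i)) <= K * b * d.

Lemma B0l z : B 0 z = 0.
Proof. by have := Bl (-1) 0 0 z; rewrite scaler0 addr0 mulN1r addNr. Qed.
Lemma B0r z : B z 0 = 0.
Proof. by have := Br (-1) 0 0 z; rewrite scaler0 addr0 rmorphN rmorph1 mulN1r addNr. Qed.
Lemma BZl c x z : B (c *: x) z = c * B x z.
Proof. by rewrite -[c *: x]addr0 Bl B0l addr0. Qed.
Lemma BZr c x z : B z (c *: x) = c^* * B z x.
Proof. by rewrite -[c *: x]addr0 Br B0r addr0. Qed.
Lemma BBl x y z : B (x - y) z = B x z - B y z.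
Proof. by rewrite -scaleN1r addrC Bl mulN1r addrC. Qed.
Lemma BBr x y z : B z (x - y) = B z x - B z y.
Proof. by rewrite -scaleN1r addrC Br rmorphN rmorph1 mulN1r addrC. Qed.
Lemma Bsuml (I : Type) (s : seq I) (P : pred I) (F : I -> H) z :
  B (\sum_(i <- s | P i) F i) z = \sum_(i <- s | P i) B (F i) z.
Proof.
apply: (big_morph (B^~ z)) => [x y|]; last exact: B0l.
by rewrite -[x in LHS]scale1r Bl mul1r.
Qed.
Lemma Bsumr (I : Type) (s : seq I) (P : pred I) (F : I -> H) z :
  B z (\sum_(i <- s | P i) F i) = \sum_(i <- s | P i) B z (F i).
Proof.
apply: (big_morph (B z)) => [x y|]; last exact: B0r.
by rewrite -[x in LHS]scale1r Br conjC1 mul1r.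
Qed.

(* If every finite-codimensional tail carried mass e, N mutually orthogonal
   pieces would have total mass N e, against the bound K sqrt N. *)
Lemma trace_tail1 (e : R) : 0 < e -> exists L : seq H, forall n (h k : 'I_n -> H),
  (forall i x, x \in L -> <|h i, x|> = 0) -> bessel h 1 -> bessel k 1 ->
  cabs (\sum_i B (h i) (k i)) <= e.
Proof.
move=> e0; apply: contrapT => /forallNP noL.
(* The first families are orthogonal to all earlier ones, so together they keep the Bessel bound 1.
   Nothing relates the second families, whose joint bound grows to sqrt N. Phases make the masses
   add up instead of cancelling. *)
have step N : exists n (h k : 'I_n -> H), [/\ bessel h 1, bessel k (Num.sqrt N%:R) &
    N%:R * e <= Re (\sum_i B (h i) (k i))].
  elim: N => [|N [n [h [k [bh bk hN]]]]].
    exists 0%N, (fun=> 0), (fun=> 0); split.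
    - by move=> c; rewrite !big_ord0 rnorm0 expr0n mulr0.
    - by move=> c; rewrite !big_ord0 rnorm0 expr0n mulr0.
    - by rewrite mul0r big_ord0.
  pose L := [seq h i | i <- enum 'I_n].
  have := noL L; move=> /existsNP[m /existsNP[h' /existsNP[k' H1]]].
  move: H1 => /not_implyP[hL /not_implyP[bh' /not_implyP[bk' /negP]]].
  rewrite -ltNge => ge.
  have [w [w1 wE]] := phase (\sum_i B (h' i) (k' i)).
  have w0 : forall x, rnorm (w *: x : H) <= 1 * rnorm x.
    by move=> x; rewrite rnormZ w1.
  exists (n + m)%N, (fcat h (fun i => w *: h' i)), (fcat k k'); split.
  - apply: bessel_cat_perp => //.
      rewrite -[X in bessel _ X]mul1r.
      apply: (bessel_map (T := fun x => w *: x)) => // a x y.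
      by rewrite scalerDr !scalerA mulrC.
    move=> i j; rewrite hdotZl hL ?mulr0 //.
    by apply/mapP; exists i => //; rewrite mem_enum.
  - have := bessel_cat (sqrtr_ge0 N%:R) ler01 bk bk'.
    by rewrite sqr_sqrtr ?ler0n // expr1n -natr1.
  - rewrite big_split_ord /= ReD -natr1 mulrDl mul1r lerD //.
      by under eq_bigr do rewrite !fcatl.
    under eq_bigr do rewrite !fcatr BZl.
    by rewrite -mulr_sumr wE /= ltW.
pose N := (Num.truncn ((K / e) ^+ 2)).+1.
have hN : (K / e) ^+ 2 < N%:R by rewrite /N Num.Theory.truncnS_gt.
have [n [h [k [bh bk hh]]]] := step N.
have := BK ler01 (sqrtr_ge0 _) bh bk; rewrite mulr1 => h2.
have N0 : 0 < N%:R :> R by rewrite ltr0n.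
have h3 : N%:R * e <= K * Num.sqrt N%:R.
  by apply: le_trans hh _; apply: le_trans (Re_le _) h2.
have sN : 0 < Num.sqrt N%:R :> R by rewrite sqrtr_gt0.
have h4 : Num.sqrt N%:R <= K / e.
  rewrite ler_pdivlMr // -(ler_pM2l sN) mulrA -expr2 sqr_sqrtr ?ler0n //.
  by rewrite [leRHS]mulrC.
have : N%:R <= (K / e) ^+ 2.
  rewrite -[N%:R]sqr_sqrtr ?ler0n // ler_pXn2r ?nnegrE ?sqrtr_ge0 //.
  by rewrite divr_ge0 // ltW.
by rewrite leNgt hN.
Qed.

Lemma trace_tail (e : R) : 0 < e -> exists L : seq H, forall n (h k : 'I_n -> H) (b d : R),
  0 < b -> 0 < d ->
  (forall i x, x \in L -> <|h i, x|> = 0) -> bessel h b -> bessel k d ->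
  cabs (\sum_i B (h i) (k i)) <= e * b * d.
Proof.
move=> /trace_tail1[L hL]; exists L => n h k b d b0 d0 hperp hb hd.
have sc (a : R) : 0 < a -> forall f : 'I_n -> H, bessel f a -> bessel (fun i => (a^-1)%:C%C *: f i) 1.
  move=> a0 f fa; rewrite -[X in bessel _ X](mulVf (lt0r_neq0 a0)).
  apply: (bessel_map (T := fun x => (a^-1)%:C%C *: x)) => //.
  - by move=> s x y; rewrite scalerDr !scalerA mulrC.
  - by rewrite invr_ge0 ltW.
  - exact: ltW.
  - by move=> x; rewrite rnormZ cabsR ger0_norm // invr_ge0 ltW.
have := hL n _ _ _ (sc b b0 h hb) (sc d d0 k hd).
move=> /(_ (ltac:(by move=> i x xL; rewrite hdotZl hperp // mulr0))).
under eq_bigr do rewrite BZl BZr conjR mulrA -rmorphM.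
have bd0 : 0 <= b^-1 * d^-1 by rewrite mulr_ge0 // invr_ge0 ltW.
rewrite -mulr_sumr cabsM cabsR (ger0_norm bd0) -invfM.
by rewrite ler_pdivrMl ?mulr_gt0 // mulrC mulrA.
Qed.

Definition ftrace (G : fam) := \sum_i B (@fam_vec G i) (@fam_vec G i).

(** Let [v] be an orthonormal family whose span contains the list [L] of [trace_tail]. Refining [v]
    to [w] changes the trace by the sum of B (w_i - p w_i) w_i, with p the projection onto the span
    of [v]; the first entries are orthogonal to [L], so the change is a small tail. *)
Lemma ftrace_lim : exists l : C, forall e : R, 0 < e -> \forall G \near bases, cabs (ftrace G - l) < e.
Proof.
apply: complex_cauchy => e e0.
have e2 : 0 < e / 2 by rewrite divr_gt0.
have [L hL] := trace_tail e2.
have [n [v [ov hv]]] := gram_schmidt L.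
exists (ftrace (Fam v)).
apply: filterS (bases_near [seq v i | i <- enum 'I_n]) => -[m w] /= [ow hw].
have -> : ftrace (Fam w) - ftrace (Fam v) = \sum_i B (w i - fproj v (w i)) (w i).
  under eq_bigr do rewrite BBl.
  rewrite sumrB; congr (_ - _); rewrite /ftrace /=.
  (* Each [v i] is fixed by the projection of [w] and may be expanded in [w]. Exchanging the sums
     yields the trace of [B (fproj v _) _] over [w]. *)
  transitivity (\sum_i B (v i) (fproj w (v i))).
    apply: eq_bigr => i _; rewrite hw //.
    by apply/mapP; exists i => //; rewrite mem_enum.
  transitivity (\sum_i \sum_j B (v i) (<|v i, w j|> *: w j)).
    by apply: eq_bigr => i _; rewrite /fproj Bsumr.
  rewrite exchange_big; apply: eq_bigr => j _ /=.
  rewrite /fproj Bsuml; apply: eq_bigr => i _.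
  by rewrite BZr BZl -hdot_conj.
apply: le_lt_trans (_ : e / 2 * 1 * 1 < _); last by rewrite !mulr1 ltr_pdivrMr // ltr_pMr // ltr1n.
apply: hL => //; last exact: ortho_bessel.
  by move=> i x xL; rewrite -(hv _ xL) -fproj_sym // fprojB // fproj_idem // subrr hdot0l.
rewrite -[X in bessel _ X]mulr1.
apply: (bessel_map (T := fun x => x - fproj v x)) => //; last exact: ortho_bessel.
- by move=> c x y; rewrite fproj_lin opprD addrACA scalerBr.
- by move=> x; rewrite mul1r fprojC_le.
Qed.

End Trace.

(** Cyclicity of the trace. Compressed to the span of a finite family the two traces agree exactly
    ([key]). What remains are the components of [u (w i)] and [u' (w i)] outside the span, which are
    tails in the first and in the second variable. *)
Lemma ftrace_comm (B : H -> H -> C) (K : R) (u u' : blin H H) :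
  (forall c x y z, B (c *: x + y) z = c * B x z + B y z) ->
  (forall c x y z, B z (c *: x + y) = c^* * B z x + B z y) ->
  0 <= K ->
  (forall n (h k : 'I_n -> H) (b d : R), 0 <= b -> 0 <= d ->
    bessel h b -> bessel k d -> cabs (\sum_i B (h i) (k i)) <= K * b * d) ->
  is_adjoint u u' ->
  forall e : R, 0 < e -> \forall G \near bases,
    cabs (ftrace (fun x y => B (u x) y) G - ftrace (fun x y => B x (u' y)) G) < e.
Proof.
move=> Bl Br K0 BK uu e e0.
have [c c0 hc] := blin_bounded u; have [c' c0' hc'] := blin_bounded u'.
pose d := c + c' + 1.
have d0 : 0 < d by rewrite ltr_wpDl // addr_ge0.
have hd x : rnorm (u x) <= d * rnorm x.
  by apply: le_trans (hc _) _; rewrite ler_wpM2r ?rnorm_ge0 // /d -addrA lerDl addr_ge0.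
have hd' x : rnorm (u' x) <= d * rnorm x.
  by apply: le_trans (hc' _) _; rewrite ler_wpM2r ?rnorm_ge0 // /d addrAC lerDr addr_ge0.
have e3 : 0 < e / (3 * d) by rewrite divr_gt0 // mulr_gt0.
(* [trace_tail] controls the first variable only; the adjoint form exchanges the two. *)
pose B' x y := (B y x)^*.
have Bl' s x y z : B' (s *: x + y) z = s * B' x z + B' y z.
  by rewrite /B' Br rmorphD rmorphM /= conjCK.
have Br' s x y z : B' z (s *: x + y) = s^* * B' z x + B' z y.
  by rewrite /B' Bl rmorphD rmorphM.
have BK' n (h k : 'I_n -> H) (b a : R) : 0 <= b -> 0 <= a ->
    bessel h b -> bessel k a -> cabs (\sum_i B' (h i) (k i)) <= K * b * a.
  by move=> b0 a0 hh hk; rewrite -rmorph_sum cabsJ mulrAC; exact: BK.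
have [L hL] := trace_tail Bl Br K0 BK e3.
have [L' hL'] := trace_tail Bl' Br' K0 BK' e3.
apply: filterS (bases_near (L ++ L')) => -[m w] /= [ow hw].
have hwL x : x \in L -> fproj w x = x by move=> xL; apply: hw; rewrite mem_cat xL.
have hwL' x : x \in L' -> fproj w x = x by move=> xL; apply: hw; rewrite mem_cat xL orbT.
have bc (T : blin H H) : (forall x, rnorm (T x) <= d * rnorm x) -> bessel (fun i => T (w i) - fproj w (T (w i))) d.
  move=> hT; rewrite -[X in bessel _ X]mulr1.
  apply: (bessel_map (T := fun x => T x - fproj w (T x))) => //; last exact: ortho_bessel.
  - by move=> s x y; rewrite blin_linear fproj_lin // opprD addrACA scalerBr.
  - exact: ltW.
  - by move=> x; apply: le_trans (fprojC_le ow _) (hT x).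
have h1 : cabs (\sum_i B (u (w i) - fproj w (u (w i))) (w i)) <= e / (3 * d) * d * 1.
  apply: hL => //; last 2 first.
  - exact: bc.
  - exact: ortho_bessel.
  by move=> i x /hwL <-; rewrite -fproj_sym // fprojB // fproj_idem // subrr hdot0l.
have h2 : cabs (\sum_i B (w i) (u' (w i) - fproj w (u' (w i)))) <= e / (3 * d) * d * 1.
  rewrite -cabsJ rmorph_sum; apply: hL' => //; last 2 first.
  - exact: bc.
  - exact: ortho_bessel.
  by move=> i x /hwL' <-; rewrite -fproj_sym // fprojB // fproj_idem // subrr hdot0l.
have -> : ftrace (fun x y => B (u x) y) (Fam w) - ftrace (fun x y => B x (u' y)) (Fam w) =
   \sum_i B (u (w i) - fproj w (u (w i))) (w i) - \sum_i B (w i) (u' (w i) - fproj w (u' (w i))).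
  have key : \sum_i B (fproj w (u (w i))) (w i) = \sum_i B (w i) (fproj w (u' (w i))).
    under eq_bigr do rewrite /fproj (Bsuml Bl).
    rewrite exchange_big; apply: eq_bigr => j _ /=.
    rewrite /fproj (Bsumr Br); apply: eq_bigr => i _.
    by rewrite (BZl Bl) (BZr Br) -hdot_conj uu.
  under [X in _ = X - _]eq_bigr do rewrite (BBl Bl).
  under [X in _ = _ - X]eq_bigr do rewrite (BBr Br).
  by rewrite !sumrB key opprB addrA subrK.
apply: le_lt_trans (cabsB _ _) _.
have : e / (3 * d) * d * 1 = e / 3 by field; rewrite gt_eqF.
move: h1 h2 => /le_trans h1 /le_trans h2 E; rewrite E in h1 h2.
have := h1 _ (lexx _); have := h2 _ (lexx _); lra.
Qed.
End OrthonormalFamilies.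

(** * Hahn-Banach and the dual description of the predual norms *)

Section HahnBanach.
Context (R : realType) (V : lmodType R[i]).
Local Notation C := R[i].

Definition sublinear (q : V -> R) := (forall u v, q (u + v) <= q u + q v) /\
  forall (t : R) v, 0 < t -> q (t%:C%C *: v) <= t * q v.

Lemma sublinearZ q t v : sublinear q -> 0 < t -> q (t%:C%C *: v) = t * q v.
Proof.
move=> [_ hq] t0; apply/eqP; rewrite eq_le hq //=.
have ti : 0 < t^-1 by rewrite invr_gt0.
have := hq _ (t%:C%C *: v) ti.
rewrite scalerA -rmorphM /= mulVf ?gt_eqF // scale1r.
by rewrite ler_pdivlMl.
Qed.

Lemma sublinear0 q : sublinear q -> q 0 = 0.
Proof.
move=> sq; have := @sublinearZ q 2 0 sq (ltr0Sn _ 1); rewrite scaler0; lra.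
Qed.

Lemma sublinear_opp q v : sublinear q -> - q (- v) <= q v.
Proof. by move=> sq; have := sq.1 v (- v); rewrite subrr sublinear0 //; lra. Qed.

(** The infimum over t >= 0 of q (v + t x) - t q x is again sublinear and below [q], and t = 1
    bounds its value at - x. Consequently a minimal sublinear functional is odd, and therefore
    linear. *)
Lemma sublinear_tilt q x : sublinear q -> exists q', [/\ sublinear q',
  forall v, q' v <= q v & q' (- x) <= - q x].
Proof.
move=> sq; have [qD qZ] := sq.
pose D v := [set q (v + t%:C%C *: x) - t * q x | t in [set t : R | 0 <= t]].
have qZ0 (t : R) v : 0 <= t -> q (t%:C%C *: v) = t * q v.
  rewrite le_eqVlt => /orP[/eqP <-|]; last exact: sublinearZ.
  by rewrite scale0r sublinear0 // mul0r.
have lbD v : has_lbound (D v).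
  exists (- q (- v)) => _ [t t0 <-].
  rewrite -(qZ0 _ _ t0); have := qD (v + t%:C%C *: x) (- v).
  by rewrite addrAC subrr add0r; lra.
have nD v : D v !=set0 by exists (q (v + 0%:C%C *: x) - 0 * q x), 0 => //=.
have hD v : has_inf (D v) by [].
have le_D v (t : R) : 0 <= t -> inf (D v) <= q (v + t%:C%C *: x) - t * q x.
  by move=> t0; apply: ge_inf => //; exists t.
exists (fun v => inf (D v)); split.
- split=> [u v|t v t0].
    apply/ler_addgt0Pr => e e0; have e2 : 0 < e / 2 by rewrite divr_gt0.
    have [_ [s s0 <-] hs] := inf_adherent e2 (hD u).
    have [_ [r r0 <-] hr] := inf_adherent e2 (hD v).
    have := le_D (u + v) (s + r) (addr_ge0 s0 r0).
    have := qD (u + s%:C%C *: x) (v + r%:C%C *: x).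
    by rewrite addrACA -scalerDl -rmorphD; lra.
  rewrite mulrC -ler_pdivrMr //; apply: lb_le_inf => // _ [s s0 <-].
  rewrite ler_pdivrMr //.
  have := le_D (t%:C%C *: v) (t * s) (mulr_ge0 (ltW t0) s0).
  rewrite rmorphM -scalerA -scalerDr (sublinearZ _ sq t0).
  by rewrite mulrBl (mulrC t) -mulrA (mulrC (s * _)) mulrA.
- move=> v; have := le_D v 0 (lexx _).
  by rewrite scale0r addr0 mul0r subr0.
- have := le_D (- x) 1 ler01.
  by rewrite scale1r addNr (sublinear0 sq) mul1r sub0r.
Qed.

(** Minimal sublinear functionals are linear, and Zorn's lemma for the reversed pointwise order
    provides one below [p]. Tilting [p] at [v0] beforehand fixes the value at [v0]. *)
Lemma hahn_banach (p : V -> R) (v0 : V) : sublinear p -> exists l : V -> R,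
  [/\ forall u v, l (u + v) = l u + l v, forall (t : R) v, l (t%:C%C *: v) = t * l v,
      forall v, l v <= p v & l v0 = p v0].
Proof.
move=> sp; have [p' [sp' p'p p'v0]] := sublinear_tilt v0 sp.
pose good (q : V -> R) := sublinear q /\ forall v, q v <= p' v.
pose T := {q : V -> R | good q}.
pose r (q s : T) := `[< forall v, sval s v <= sval q v >].
have [||||[q [sq qp]] qmin] := @Zorn T r.
- by move=> q; apply/asboolP.
- by move=> q s t /asboolP h1 /asboolP h2; apply/asboolP => v; exact: le_trans (h2 v) (h1 v).
- move=> [q hq] [s hs] /asboolP /= h1 /asboolP /= h2.
  have E : q = s by apply/funext => v; apply/eqP; rewrite eq_le h1 h2.
  by case: _ / E hs {h1 h2} => hs; congr exist; exact: Prop_irrelevance.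
- move=> A tA.
  have [[a0 Aa0]|nA] := pselect (exists a, A a); last first.
    exists (exist good p' (conj sp' (fun v => lexx _))) => s As.
    by case: nA; exists s.
  pose D v := [set sval q v | q in A].
  have lbD v : has_lbound (D v).
    (* A sublinear q below [p'] satisfies q v >= - q (- v) >= - p' (- v), so infima over chains are
       finite. *)
    exists (- p' (- v)) => _ [[q [sq qp]] _ <-] /=.
    by apply: le_trans (sublinear_opp v sq); rewrite lerN2.
  have nD v : D v !=set0 by exists (sval a0 v), a0.
  have hD v : has_inf (D v) by [].
  have le_D v a : A a -> inf (D v) <= sval a v.
    by move=> Aa; apply: ge_inf => //; exists a.
  have st : sublinear (fun v => inf (D v)).
    split=> [u v|t v t0].
      apply/ler_addgt0Pr => e e0; have e2 : 0 < e / 2 by rewrite divr_gt0.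
      have [_ [a Aa <-] ha] := inf_adherent e2 (hD u).
      have [_ [b Ab <-] hb] := inf_adherent e2 (hD v).
      have [/asboolP ab|/asboolP ba] := tA a b Aa Ab.
        have := le_D (u + v) b Ab; have := (svalP b).1.1 u v; have := ab u; lra.
      have := le_D (u + v) a Aa; have := (svalP a).1.1 u v; have := ba v; lra.
    rewrite mulrC -ler_pdivrMr //; apply: lb_le_inf => // _ [a Aa <-].
    rewrite ler_pdivrMr // mulrC -(sublinearZ v (svalP a).1 t0).
    exact: le_D.
  have stp v : inf (D v) <= p' v.
    by apply: le_trans (le_D v a0 Aa0) _; exact: (svalP a0).2.
  by exists (exist good _ (conj st stp)) => s As; apply/asboolP => v /=; exact: le_D.
have odd x : q (- x) = - q x.
  have [q' [sq' q'q q'x]] := sublinear_tilt x sq.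
  have := qmin (exist good q' (conj sq' (fun v => le_trans (q'q v) (qp v)))).
  move=> /(_ (asboolT q'q)) [E]; rewrite E in q'x.
  by apply/eqP; rewrite eq_le q'x lerNl sublinear_opp.
have qD u v : q (u + v) = q u + q v.
  apply/eqP; rewrite eq_le sq.1 /=.
  have := sq.1 (- u) (- v); rewrite -opprD !odd; lra.
exists q; split => //.
- move=> t v; case: (ltgtP t 0) => [t0|t0|->].
  + have tn : 0 < - t by rewrite oppr_gt0.
    rewrite -[t]opprK rmorphN scaleNr odd (sublinearZ _ sq tn) opprK; lra.
  + exact: sublinearZ.
  + by rewrite scale0r sublinear0 // mul0r.
- by move=> v; exact: le_trans (qp v) (p'p v).
- apply/eqP; rewrite eq_le (le_trans (qp _) (p'p _)) /=.
  have := le_trans (qp (- v0)) p'v0; rewrite odd; lra.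
Qed.

(* The complex-linear functional with given real part l is l v - i l (i v). *)
Lemma hahn_banach_complex (p : V -> R) (v0 : V) : (forall u v, p (u + v) <= p u + p v) ->
  (forall (c : C) v, p (c *: v) = cabs c * p v) -> exists f : V -> C,
  [/\ forall c u v, f (c *: u + v) = c * f u + f v,
      forall v, cabs (f v) <= p v & Re (f v0) = p v0].
Proof.
move=> pD pZ.
have [l [lD lZ lp lv0]] : exists l : V -> R,
  [/\ forall u v, l (u + v) = l u + l v, forall (t : R) v, l (t%:C%C *: v) = t * l v,
      forall v, l v <= p v & l v0 = p v0].
  apply: hahn_banach; split => // t v t0.
  by rewrite pZ cabsR ger0_norm // ltW.
pose f v : C := (l v -i* l ('i%C *: v))%C.
have fD u v : f (u + v) = f u + f v.
  by apply: complexP; rewrite ?ReD ?ImD /= ?scalerDr lD // opprD.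
have fZr (t : R) v : f (t%:C%C *: v) = t%:C%C * f v.
  apply: complexP => /=; rewrite ?mul0r ?subr0 ?addr0 ?lZ //.
  by rewrite scalerA mulrC -scalerA lZ mulrN.
have fi v : f ('i%C *: v) = 'i%C * f v.
  apply: complexP => /=.
    by rewrite mul0r mul1r sub0r opprK.
  rewrite mul0r mul1r add0r scalerA.
  rewrite (_ : 'i%C * 'i%C = (- 1 : R)%:C%C) ?lZ ?mulN1r ?opprK //.
  by apply: complexP => /=; lra.
have fZ c v : f (c *: v) = c * f v.
  rewrite (complexE c) scalerDl fD fZr mulrDl -scalerA fi fZr mulrA //.
have flin c u v : f (c *: u + v) = c * f u + f v by rewrite fD fZ.
exists f; split => //.
move=> v; have [w [w1 hw]] := phase (f v).
have -> : cabs (f v) = Re (f (w *: v)) by rewrite fZ hw.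
by apply: le_trans (lp _) _; rewrite pZ w1 mul1r.
Qed.
End HahnBanach.

(** * Positive functionals on scalar matrices *)

Section States.
Context (R : realType) (n : nat).
Local Notation C := R[i].
Implicit Types (A B P : 'M[C]_n) (x y : 'I_n -> C).

Definition sqnorm x : R := \sum_i cabs (x i) ^+ 2.
Definition herm_val A x : R := Re (\sum_i \sum_j A i j * (x j * (x i)^*)).
Definition herm_set A := [set herm_val A x | x in [set x | sqnorm x <= 1]].
(** The positive part of the largest eigenvalue of the hermitian part of [A]: the supremum runs over
    the whole ball, including 0. Functionals that it dominates are positive, with value at most 1 at
    the identity. *)
Definition herm_sup A : R := sup (herm_set A).

Lemma sqnorm_ge0 x : 0 <= sqnorm x. Proof. by apply: sumr_ge0 => i _; exact: sqr_ge0. Qed.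
Lemma sqnorm_coord x i : cabs (x i) ^+ 2 <= sqnorm x.
Proof. by rewrite /sqnorm (bigD1 i) //= lerDl sumr_ge0 // => j _; exact: sqr_ge0. Qed.
Lemma sqnormZ (t : C) x : sqnorm (fun i => t * x i) = cabs t ^+ 2 * sqnorm x.
Proof. by rewrite mulr_sumr; apply: eq_bigr => i _; rewrite cabsM exprMn. Qed.

Lemma herm_val_bound A x : herm_val A x <= (\sum_i \sum_j cabs (A i j)) * sqnorm x.
Proof.
apply: le_trans (Re_le _) _; apply: le_trans (cabs_sum _ _ _) _.
rewrite mulr_suml; apply: ler_sum => i _; apply: le_trans (cabs_sum _ _ _) _.
rewrite mulr_suml; apply: ler_sum => j _; rewrite !cabsM cabsJ.
rewrite ler_wpM2l ?cabs_ge0 //.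
have := sqr_ge0 (cabs (x j) - cabs (x i)); rewrite sqrrB.
have := sqnorm_coord x i; have := sqnorm_coord x j.
set a := cabs (x i); set b := cabs (x j); lra.
Qed.

Lemma herm_valZ A (t : C) x : herm_val A (fun i => t * x i) = cabs t ^+ 2 * herm_val A x.
Proof.
rewrite /herm_val -Re_realM; congr Re; rewrite mulr_sumr; apply: eq_bigr => i _.
rewrite mulr_sumr; apply: eq_bigr => j _.
by rewrite rmorphM /= mulrACA mulJ; exact: mulrCA.
Qed.

Lemma herm_val0 A : herm_val A (fun=> 0) = 0.
Proof. by rewrite /herm_val big1 // => i _; rewrite big1 // => j _; rewrite mul0r mulr0. Qed.

Lemma herm_set_ub A : has_ubound (herm_set A).
Proof.
exists (\sum_i \sum_j cabs (A i j)) => _ [x /= x1 <-].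
apply: le_trans (herm_val_bound _ _) _; rewrite ler_piMr //.
by do 2 apply: sumr_ge0 => ? _; exact: cabs_ge0.
Qed.

Lemma sqnorm0 : sqnorm (fun=> 0) = 0.
Proof. by rewrite /sqnorm big1 // => i _; rewrite cabs0 expr0n. Qed.

Lemma herm_sup_ge0 A : 0 <= herm_sup A.
Proof. by apply: (ub_le_sup (herm_set_ub A)); exists (fun=> 0); rewrite ?herm_val0 //= sqnorm0. Qed.

Lemma herm_sup_ub A x : herm_val A x <= herm_sup A * sqnorm x.
Proof.
have [x0|x0] := eqVneq (sqnorm x) 0.
  by rewrite x0 mulr0; have := herm_val_bound A x; rewrite x0 mulr0.
have xp : 0 < sqnorm x by rewrite lt_neqAle eq_sym x0 sqnorm_ge0.
have sp : 0 < Num.sqrt (sqnorm x) by rewrite sqrtr_gt0.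
rewrite -ler_pdivrMr //; apply: (ub_le_sup (herm_set_ub A)).
have ti : cabs ((Num.sqrt (sqnorm x))^-1)%:C%C ^+ 2 = (sqnorm x)^-1.
  by rewrite cabsR ger0_norm ?invr_ge0 ?ltW // exprVn sqr_sqrtr // ltW.
exists (fun i => ((Num.sqrt (sqnorm x))^-1)%:C%C * x i).
  by rewrite /= sqnormZ ti mulVf.
by rewrite herm_valZ ti mulrC.
Qed.

Lemma herm_sup_le A b : 0 <= b -> (forall x, herm_val A x <= b * sqnorm x) -> herm_sup A <= b.
Proof.
move=> b0 hb; apply: ge_sup; first by exists (herm_val A (fun=> 0)), (fun=> 0); rewrite //= sqnorm0.
by move=> _ [x /= x1 <-]; apply: le_trans (hb x) _; rewrite ler_piMr.
Qed.

Lemma herm_valD A B x : herm_val (A + B) x = herm_val A x + herm_val B x.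
Proof.
rewrite /herm_val -ReD -big_split; congr Re; apply: eq_bigr => i _.
by rewrite -big_split; apply: eq_bigr => j _; rewrite mxE mulrDl.
Qed.
Lemma herm_valZm (t : R) A x : herm_val (t%:C%C *: A) x = t * herm_val A x.
Proof.
rewrite /herm_val -Re_realM; congr Re; rewrite mulr_sumr; apply: eq_bigr => i _.
by rewrite mulr_sumr; apply: eq_bigr => j _; rewrite mxE -mulrA.
Qed.

Lemma herm_supD A B : herm_sup (A + B) <= herm_sup A + herm_sup B.
Proof.
apply: herm_sup_le => [|x]; first by rewrite addr_ge0 ?herm_sup_ge0.
by rewrite herm_valD mulrDl lerD ?herm_sup_ub.
Qed.
Lemma herm_supZ (t : R) A : 0 <= t -> herm_sup (t%:C%C *: A) <= t * herm_sup A.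
Proof.
move=> t0; apply: herm_sup_le => [|x]; first by rewrite mulr_ge0 ?herm_sup_ge0.
by rewrite herm_valZm -mulrA ler_wpM2l ?herm_sup_ub.
Qed.
Lemma herm_sup0 : herm_sup 0 = 0.
Proof.
apply/eqP; rewrite eq_le herm_sup_ge0 andbT; apply: herm_sup_le => // x.
by rewrite /herm_val big1 ?mul0r // => i _; rewrite big1 // => j _; rewrite mxE mul0r.
Qed.

(* Positive definiteness, rather than semi-definiteness, makes the factor
   invertible. *)
Lemma pd_factor P (e : R) : 0 < e -> (forall i j, P j i = (P i j)^*) ->
  (forall y, e * sqnorm y <= Re (\sum_i \sum_j P i j * (y i * (y j)^*))) ->
  exists2 b : 'M[C]_n, b \in unitmx & forall i j, P i j = \sum_k b k j * (b k i)^*.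
Proof.
move=> e0 Ph Ppos.
have Pn : P \is normalmx.
  have PT : map_mx Num.conj P^T = P by apply/matrixP => i j; rewrite !mxE Ph conjCK.
  by apply/normalmxP; rewrite PT.
pose U := spectralmx P; pose s := spectral_diag P.
have UU : U \is unitarymx by exact: spectral_unitarymx.
have PE : P = invmx U *m diag_mx s *m U := elimT (@orthomx_spectralP _ _ P) Pn.
have Uunit : U \in unitmx by exact: unitarymx_unit.
(* The eigenvalue is the value of the form at row [k] of the unitary, a unit vector, so its real
   part is at least [e]. *)
have sE k : s 0 k = \sum_i \sum_j P i j * (U k i * (U k j)^*).
  have : (U *m P *m map_mx Num.conj U^T) k k = s 0 k.
    rewrite -(invmx_unitary UU) {1}PE !mulmxA mulmxV // mul1mx -mulmxA mulmxV // mulmx1.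
    by rewrite mxE eqxx mulr1n.
  move=> <-; rewrite !mxE.
  under eq_bigr do rewrite !mxE mulr_suml.
  rewrite exchange_big; apply: eq_bigr => i _; apply: eq_bigr => j _ /=.
  by rewrite mulrCA mulrA.
have Usq k : sqnorm (fun i => U k i) = 1.
  have /unitarymxP /matrixP /(_ k k) := UU; rewrite !mxE eqxx => h.
  apply: complexI; rewrite rmorph1 -[RHS]h rmorph_sum; apply: eq_bigr => i _.
  by rewrite !mxE mulJ.
have sre k : e <= Re (s 0 k).
  by have := Ppos (fun i => U k i); rewrite Usq mulr1 -sE.
have sim k : Im (s 0 k) = 0.
  have : (s 0 k)^* = s 0 k.
    rewrite sE rmorph_sum exchange_big; apply: eq_bigr => i _.
    rewrite rmorph_sum; apply: eq_bigr => j _; rewrite !rmorphM /= conjCK -Ph.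
    by congr (_ * _); rewrite mulrC.
  by move/(congr1 (@complex.Im R)); rewrite ImJ; lra.
pose r k := Num.sqrt (Re (s 0 k)).
have r0 k : 0 < r k by rewrite sqrtr_gt0 (lt_le_trans e0).
(* The square root of the diagonal part times the unitary, which makes P equal to b^* b. *)
pose b := diag_mx (\row_k (r k)%:C%C) *m U.
have bE k j : b k j = (r k)%:C%C * U k j.
  by rewrite /b mul_diag_mx !mxE.
have bu : b \in unitmx.
  rewrite unitmx_mul Uunit andbT unitmxE det_diag unitfE; apply/prodf_neq0 => k _.
  by rewrite mxE; apply/eqP => /complexI /eqP; rewrite gt_eqF.
clearbody b; exists b => // i j; rewrite PE (invmx_unitary UU) -mulmxA mul_diag_mx !mxE.
apply: eq_bigr => k _; rewrite !mxE !bE rmorphM /= conjR.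
have -> : s 0 k = ((r k)%:C%C) * (r k)%:C%C.
  rewrite -rmorphM -expr2 sqr_sqrtr; last by rewrite (le_trans (ltW e0)).
  by apply: complexP => //=; rewrite sim.
ring.
Qed.

Context (H : hilbert R).
Definition gram s (xi : 'I_n -> 'I_s -> H) : 'M[C]_n :=
  \matrix_(i, j) \sum_k hdot H (xi j k) (xi i k).

(** The squared norm of the family transformed by [b]. It equals Re sum_ij (gram xi)_ij P_ij for P =
    b^* b, so it is the value at [gram xi] of the positive functional with density P. *)
Definition dnorm s (xi : 'I_n -> 'I_s -> H) (b : 'M[C]_n) : R :=
  \sum_l \sum_k rnorm (\sum_j b l j *: xi j k) ^+ 2.

Lemma herm_val_gram s (xi : 'I_n -> 'I_s -> H) x :
  herm_val (gram xi) x = \sum_k rnorm (\sum_j x j *: xi j k) ^+ 2.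
Proof.
rewrite /herm_val.
under [RHS]eq_bigr do rewrite rnorm2E; rewrite -Re_sum; congr Re.
under [LHS]eq_bigr do under eq_bigr do rewrite mxE mulr_suml.
under [LHS]eq_bigr do rewrite exchange_big; rewrite exchange_big; apply: eq_bigr => k _ /=.
rewrite hdot_sumr; apply: eq_bigr => i _; rewrite hdot_suml; apply: eq_bigr => j _.
by rewrite hdotZl hdotZr; ring.
Qed.

(** Domination by [herm_sup] makes [rho] positive, zero on skew-hermitian matrices and at most 1 at
    the identity. Its density [r] is shifted by a multiple [d] of the identity to become positive
    definite; [e] pays for the trace n d of the shift. *)
Lemma state_factor (rho : 'M[C]_n -> R) (e : R) : 0 < e ->
  (forall A B, rho (A + B) = rho A + rho B) ->
  (forall (t : R) A, rho (t%:C%C *: A) = t * rho A) ->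
  (forall A, rho A <= herm_sup A) ->
  exists b : 'M[C]_n, [/\ b \in unitmx, \sum_l \sum_j cabs (b l j) ^+ 2 <= 1 + e &
    forall s (xi : 'I_n -> 'I_s -> H), rho (gram xi) <= dnorm xi b].
Proof.
move=> e0 rD rZ rM.
have rN A : rho (- A) = - rho A.
  have := rZ (-1) A; rewrite rmorphN1 scaleN1r => ->; lra.
have r0 : rho 0 = 0 by have := rZ 0 0; rewrite scaler0 mul0r.
have rsum (I : Type) (L : seq I) (Q : pred I) (F : I -> 'M[C]_n) :
    rho (\sum_(i <- L | Q i) F i) = \sum_(i <- L | Q i) rho (F i).
  by apply: (big_morph rho) => // A B; rewrite rD.
(* The imaginary part is chosen so that the real-linear [rho] becomes A |-> Re sum_ij A_ij r_ij. *)
pose r i j : C := (rho (delta_mx i j) -i* rho ('i%C *: delta_mx i j))%C.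
have rE (z : C) i j : rho (z *: delta_mx i j) = Re (z * r i j).
  rewrite {1}(complexE z) scalerDl rD rZ (mulrC 'i%C) -scalerA rZ.
  by rewrite /r Re_mul /=; ring.
have rA A : rho A = Re (\sum_i \sum_j A i j * r i j).
  rewrite {1}(matrix_sum_delta A) rsum Re_sum; apply: eq_bigr => i _.
  by rewrite rsum Re_sum; apply: eq_bigr => j _; rewrite rE.
have rneg A : (forall x, herm_val A x <= 0) -> rho A <= 0.
  by move=> h; apply: le_trans (rM A) _; apply: herm_sup_le => // x; rewrite mul0r.
have rh i j : r j i = (r i j)^*.
  have h z : Re (z * (r i j - (r j i)^*)) = 0.
    (* A skew-hermitian test matrix: [herm_val] vanishes on it, hence so does [rho], which makes [r]
       hermitian. *)
    pose A : 'M[C]_n := z *: delta_mx i j - z^* *: delta_mx j i.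
    have fA x : herm_val A x = 0.
      have -> : herm_val A x = Re (z * (x j * (x i)^*) - z^* * (x i * (x j)^*)).
        have dl (w : C) k l : \sum_a \sum_b (w *: delta_mx k l : 'M[C]_n) a b * (x b * (x a)^*)
           = w * (x l * (x k)^*).
          rewrite (sum2_delta (i := k) (j := l)) => [|a b]; rewrite !mxE ?eqxx ?mulr1 //.
          by move=> /orP[] /negbTE ->; rewrite ?andbF mulr0 mul0r.
        congr Re; rewrite -(dl z i j) -(dl z^* j i) -sumrB; apply: eq_bigr => a _.
        by rewrite -sumrB; apply: eq_bigr => b _; rewrite !mxE; ring.
      rewrite ReB -[X in _ - X]ReJ !rmorphM /= !conjCK [x j * _]mulrC subrr //.
    have h1 : rho A <= 0 by apply: rneg => x; rewrite fA.
    have h2 : rho (- A) <= 0.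
      apply: rneg => x; have := herm_valD A (- A) x; rewrite subrr fA add0r => <-.
      by have := herm_valZm 0 0 x; rewrite scaler0 mul0r => ->.
    have : rho A = 0 by move: h2; rewrite rN; lra.
    rewrite /A rD rN !rE mulrBr ReB -[Re (z * (r j i)^*)]ReJ rmorphM /= conjCK //.
  have h1 := h 1; have := h 'i%C; rewrite mul1r in h1.
  rewrite Re_mul /= mul0r mul1r sub0r => /eqP; rewrite oppr_eq0 => /eqP h2.
  have : r i j - (r j i)^* = 0 by exact: complexP.
  by move/eqP; rewrite subr_eq0 => /eqP ->; rewrite conjCK.
have rpos (y : 'I_n -> C) : 0 <= Re (\sum_i \sum_j r i j * (y i * (y j)^*)).
  (* A negative matrix of rank one. That [rho] is at most 0 on it is the positivity of [r] at
     [y]. *)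
  pose A := \matrix_(i, j) - (y i * (y j)^*).
  have : rho A <= 0.
    apply: rneg => x; rewrite /herm_val.
    have -> : \sum_i \sum_j A i j * (x j * (x i)^*) =
       - ((\sum_i y i * (x i)^*) * (\sum_i y i * (x i)^*)^*).
      rewrite mulr_suml -sumrN; apply: eq_bigr => i _.
      rewrite rmorph_sum mulr_sumr -sumrN; apply: eq_bigr => j _.
      by rewrite mxE rmorphM /= conjCK; ring.
    by rewrite mulJ ReN /= oppr_le0 sqr_ge0.
  rewrite rA -oppr_ge0 -ReN -sumrN => h; apply: le_trans h _.
  apply: le_of_eq; congr Re; apply: eq_bigr => i _.
  by rewrite -sumrN; apply: eq_bigr => j _; rewrite mxE mulNr opprK mulrC.
have [d d0 nd] : exists2 d : R, 0 < d & n%:R * d <= e.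
  exists (e / n.+1%:R); first by rewrite divr_gt0.
  by rewrite mulrA ler_pdivrMr // mulrC ler_pM2l // ler_nat.
pose P := \matrix_(i, j) (r i j + (i == j)%:R * d%:C%C).
have [||b bu bP] := @pd_factor P d d0.
- move=> i j; rewrite !mxE rmorphD rmorphM /= conjR rh eq_sym.
  by congr (_ + _ * _); case: (_ == _); rewrite ?conjC1 ?conjC0.
- move=> y.
  have -> : \sum_i \sum_j P i j * (y i * (y j)^*) =
     \sum_i \sum_j r i j * (y i * (y j)^*) + (d * sqnorm y)%:C%C.
    rewrite rmorphM rmorph_sum mulr_sumr -big_split; apply: eq_bigr => i _ /=.
    rewrite -mulJ [X in _ = _ + X](_ : _ = \sum_j (i == j)%:R * d%:C%C * (y i * (y j)^*)).
      by rewrite -big_split; apply: eq_bigr => j _; rewrite mxE mulrDl.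
    rewrite (bigD1 i) //= eqxx mul1r big1 ?addr0 // => j ji.
    by rewrite eq_sym (negbTE ji) !mul0r.
  by rewrite ReD /= lerDr.
have form A : Re (\sum_i \sum_j A i j * P i j) = rho A + d * Re (\tr A).
  rewrite rA /mxtrace -Re_realM -ReD mulr_sumr -big_split; congr Re; apply: eq_bigr => i _ /=.
  rewrite [X in _ = _ + X](_ : _ = \sum_j A i j * ((i == j)%:R * d%:C%C)).
    by rewrite -big_split; apply: eq_bigr => j _; rewrite mxE mulrDr.
  rewrite (bigD1 i) //= eqxx mul1r big1 ?addr0 1?mulrC // => j ji.
  by rewrite eq_sym (negbTE ji) mul0r mulr0.
have tr1 (Q : 'I_n -> 'I_n -> C) :
    \sum_i \sum_j (1%:M : 'M[C]_n) i j * Q i j = \sum_i Q i i.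
  have one i j : (1%:M : 'M[C]_n) i j = (i == j)%:R by rewrite mxE.
  apply: eq_bigr => i _; rewrite (bigD1 i) //= one eqxx mul1r big1 ?addr0 // => j ji.
  by rewrite one eq_sym (negbTE ji) mul0r.
exists b; split=> //.
  have -> : \sum_l \sum_j cabs (b l j) ^+ 2 = Re (\sum_i \sum_j (1%:M : 'M[C]_n) i j * P i j).
    rewrite exchange_big tr1 Re_sum; apply: eq_bigr => i _ /=.
    by rewrite bP Re_sum; apply: eq_bigr => k _; rewrite mulJ.
  rewrite form mxtrace1 -[n%:R]/(n%:R : C).
  have -> : Re (n%:R : C) = n%:R.
    by rewrite -(rmorph_nat (real_complex R)).
  rewrite mulrC lerD //.
  apply: le_trans (rM _) _; apply: herm_sup_le => // x; rewrite mul1r /herm_val.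
  rewrite (tr1 (fun i j => x j * (x i)^*)) Re_sum; apply: ler_sum => i _.
  by rewrite mulJ.
move=> s xi.
have -> : dnorm xi b = Re (\sum_i \sum_j gram xi i j * P i j).
  rewrite /dnorm; under eq_bigr do rewrite -herm_val_gram /herm_val; rewrite -Re_sum; congr Re.
  rewrite exchange_big; apply: eq_bigr => i _; rewrite exchange_big; apply: eq_bigr => j _ /=.
  by rewrite bP mulr_sumr.
rewrite form lerDl mulr_ge0 ?(ltW d0) // Re_sum; apply: sumr_ge0 => i _.
rewrite mxE Re_sum; apply: sumr_ge0 => k _.
by rewrite -rnorm2E sqr_ge0.
Qed.
End States.

Lemma sum4 (V : nmodType) (I J K L : finType) (F : I -> J -> K -> L -> V) :
  \sum_i \sum_j \sum_k \sum_l F i j k l = \sum_k \sum_l \sum_i \sum_j F i j k l.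
Proof.
rewrite pair_bigA [RHS]pair_bigA /=.
under eq_bigr do rewrite pair_bigA; rewrite exchange_big; apply: eq_bigr => kl _ /=.
by rewrite pair_bigA.
Qed.

Section Minimax.
Context (R : realType) (H : hilbert R) (M : vnAlg H) (n : nat).
Local Notation C := R[i].
Context (c : 'M[vn_elt M]_n).

(** Each [xi j] is a vector in the direct sum of [s] copies of [H], and [b] bounds the synthesis
    operator of these [n] vectors. *)
Definition bessel2 s (xi : 'I_n -> 'I_s -> H) (b : R) := forall x : 'I_n -> C,
  \sum_k rnorm (\sum_j x j *: xi j k) ^+ 2 <= b ^+ 2 * sqnorm x.

Definition pairing s (xi eta : 'I_n -> 'I_s -> H) : C :=
  \sum_i \sum_j \sum_k hdot H (c i j (xi j k)) (eta i k).

Hypothesis hc : forall s (xi eta : 'I_n -> 'I_s -> H) (b d : R), 0 <= b -> 0 <= d ->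
  bessel2 xi b -> bessel2 eta d -> cabs (pairing xi eta) <= b * d.

Lemma bessel2_gram s (xi : 'I_n -> 'I_s -> H) : bessel2 xi (Num.sqrt (herm_sup (gram xi))).
Proof. by move=> x; rewrite -herm_val_gram sqr_sqrtr ?herm_sup_ge0 // herm_sup_ub. Qed.

(** The best Bessel bounds are square roots of [herm_sup] at the Gram matrices, and the product of
    the bounds is replaced by half the sum of their squares. Gram matrices and pairings both add up
    under concatenation, which gives the convexity that the separation argument needs. *)
Lemma pairing_gram s (xi eta : 'I_n -> 'I_s -> H) :
  Re (pairing xi eta) <= 2^-1 * (herm_sup (gram xi) + herm_sup (gram eta)).
Proof.
apply: le_trans (Re_le _) _.
apply: le_trans (hc (sqrtr_ge0 _) (sqrtr_ge0 _) (bessel2_gram xi) (bessel2_gram eta)) _.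
have := sqr_ge0 (Num.sqrt (herm_sup (gram xi)) - Num.sqrt (herm_sup (gram eta))).
rewrite sqrrB !sqr_sqrtr ?herm_sup_ge0 //; lra.
Qed.

Definition vcat s s' (xi : 'I_n -> 'I_s -> H) (xi' : 'I_n -> 'I_s' -> H) :=
  fun j => fcat (xi j) (xi' j).
Lemma gram_cat s s' (xi : 'I_n -> 'I_s -> H) (xi' : 'I_n -> 'I_s' -> H) :
  gram (vcat xi xi') = gram xi + gram xi'.
Proof.
apply/matrixP => i j; rewrite !mxE big_split_ord; congr (_ + _);
  by apply: eq_bigr => k _; rewrite /vcat ?fcatl ?fcatr.
Qed.
Lemma pairing_cat s s' (xi eta : 'I_n -> 'I_s -> H) (xi' eta' : 'I_n -> 'I_s' -> H) :
  pairing (vcat xi xi') (vcat eta eta') = pairing xi eta + pairing xi' eta'.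
Proof.
rewrite /pairing -big_split; apply: eq_bigr => i _; rewrite -big_split; apply: eq_bigr => j _.
rewrite /= big_split_ord; congr (_ + _);
  by apply: eq_bigr => k _; rewrite /vcat ?fcatl ?fcatr.
Qed.

Definition vscale (t : R) s (xi : 'I_n -> 'I_s -> H) := fun j k => t%:C%C *: xi j k.
Lemma gram_scale t s (xi : 'I_n -> 'I_s -> H) : gram (vscale t xi) = (t ^+ 2)%:C%C *: gram xi.
Proof.
apply/matrixP => i j; rewrite !mxE mulr_sumr; apply: eq_bigr => k _.
by rewrite hdotZl hdotZr conjR mulrA -rmorphM.
Qed.
Lemma pairing_scale t s (xi eta : 'I_n -> 'I_s -> H) :
  pairing (vscale t xi) (vscale t eta) = (t ^+ 2)%:C%C * pairing xi eta.
Proof.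
rewrite mulr_sumr; apply: eq_bigr => i _; rewrite mulr_sumr; apply: eq_bigr => j _.
rewrite mulr_sumr; apply: eq_bigr => k _.
by rewrite blinZ hdotZl hdotZr conjR mulrA -rmorphM.
Qed.

Let V := ('M[C]_n * 'M[C]_n)%type.
Record test := Test { tsize : nat; txi : 'I_n -> 'I_tsize -> H; teta : 'I_n -> 'I_tsize -> H }.
Definition tval (v : V) (T : test) : R :=
  2^-1 * (herm_sup (v.1 + gram (@txi T)) + herm_sup (v.2 + gram (@teta T))) - Re (pairing (@txi T) (@teta T)).
Definition tset (v : V) := [set tval v T | T in setT].

Lemma tset_lb v : has_lbound (tset v).
Proof.
exists (- (2^-1 * (herm_sup (- v.1) + herm_sup (- v.2)))) => _ [[s xi eta] _ <-]; rewrite /tval /=.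
have := pairing_gram xi eta.
have := herm_supD (v.1 + gram xi) (- v.1); rewrite addrAC subrr add0r.
have := herm_supD (v.2 + gram eta) (- v.2); rewrite addrAC subrr add0r.
lra.
Qed.
Lemma tset_inf v : has_inf (tset v).
Proof.
split; last exact: tset_lb.
by exists (tval v (@Test 0 (fun _ _ => 0) (fun _ _ => 0))); eexists.
Qed.
Lemma tset_le v T : inf (tset v) <= tval v T.
Proof. by apply: ge_inf; [exact: tset_lb|exists T]. Qed.

(* The sublinear functional whose dominated linear functionals are the pairs of
   states (rho, sigma) with
   Re <c xi, eta> <= (rho (gram xi) + sigma (gram eta)) / 2. *)
Lemma tinf_sublinear : sublinear (fun v : V => inf (tset v)).
Proof.
split=> [u v|t v t0].
  apply/ler_addgt0Pr => e e0; have e2 : 0 < e / 2 by rewrite divr_gt0.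
  have [_ [[s xi eta] _ <-] h1] := inf_adherent e2 (tset_inf u).
  have [_ [[s' xi' eta'] _ <-] h2] := inf_adherent e2 (tset_inf v).
  have := tset_le (u + v) (Test (vcat xi xi') (vcat eta eta')).
  move: h1 h2; rewrite /tval /= !gram_cat pairing_cat ReD.
  have := herm_supD (u.1 + gram xi) (v.1 + gram xi').
  have := herm_supD (u.2 + gram eta) (v.2 + gram eta').
  rewrite ![_ + gram _ + (_ + _)]addrACA; lra.
rewrite mulrC -ler_pdivrMr //; apply: lb_le_inf; first by case: (tset_inf v).
move=> _ [[s xi eta] _ <-]; rewrite ler_pdivrMr //.
(* Gram matrices and pairings are quadratic in the vectors, so a factor [t] is realized by scaling
   with its square root. *)
pose r := Num.sqrt t.
have r2 : r ^+ 2 = t by rewrite sqr_sqrtr // ltW.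
apply: le_trans (tset_le _ (Test (vscale r xi) (vscale r eta))) _.
rewrite /tval /= !gram_scale pairing_scale r2 -!scalerDr Re_realM.
rewrite mulrBl [Re _ * t]mulrC lerB // -mulrA ler_pM2l ?invr_gt0 // mulrDl.
by rewrite lerD // mulrC herm_supZ // ltW.
Qed.

(** A linear functional below the infimum of the tests is compared with two of them. The empty test
    shows that its two components, doubled to undo the factor 1/2 in [tval], are dominated by
    [herm_sup], so [state_factor] applies. The test (xi, eta) at the point (- gram xi, - gram eta)
    gives the inequality for the pairing. *)
Lemma minimax (e : R) : 0 < e -> exists a b : 'M[C]_n,
  [/\ a \in unitmx, b \in unitmx, \sum_l \sum_j cabs (a l j) ^+ 2 <= 1 + e,
      \sum_l \sum_j cabs (b l j) ^+ 2 <= 1 + e &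
   forall s (xi eta : 'I_n -> 'I_s -> H),
     Re (pairing xi eta) <= 2^-1 * (dnorm xi b + dnorm eta a)].
Proof.
move=> e0; have [l [lD lZ lp _]] := hahn_banach 0 tinf_sublinear.
have lpp (v : V) : l v <= 2^-1 * (herm_sup v.1 + herm_sup v.2).
  apply: le_trans (lp v) _; apply: le_trans (tset_le _ (@Test 0 (fun _ _ => 0) (fun _ _ => 0))) _.
  have g0 : gram (fun (_ : 'I_n) (_ : 'I_0) => 0 : H) = 0.
    by apply/matrixP => i j; rewrite !mxE big_ord0.
  rewrite /tval /= g0 !addr0 /pairing big1 ?subr0 //= => i _.
  by rewrite big1 // => j _; rewrite big_ord0.
have lpair s (xi eta : 'I_n -> 'I_s -> H) : l (- gram xi, - gram eta) <= - Re (pairing xi eta).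
  apply: le_trans (lp _) _; apply: le_trans (tset_le _ (Test xi eta)) _.
  by rewrite /tval /= !addNr herm_sup0 addr0 mulr0 add0r.
have lN v : l (- v) = - l v.
  have := lZ (-1) v; rewrite rmorphN1 scaleN1r => ->; lra.
pose rho A := 2 * l (A, 0); pose sigma A := 2 * l (0, A).
have pD1 (A B : 'M[C]_n) : (A + B, 0) = (A, 0) + (B, 0) :> V.
  by apply/pair_equal_spec; split=> //=; rewrite addr0.
have pD2 (A B : 'M[C]_n) : (0, A + B) = (0, A) + (0, B) :> V.
  by apply/pair_equal_spec; split=> //=; rewrite addr0.
have pZ1 (t : R) (A : 'M[C]_n) : (t%:C%C *: A, 0) = t%:C%C *: (A, 0) :> V.
  by apply/pair_equal_spec; split=> //=; rewrite scaler0.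
have pZ2 (t : R) (A : 'M[C]_n) : (0, t%:C%C *: A) = t%:C%C *: (0, A) :> V.
  by apply/pair_equal_spec; split=> //=; rewrite scaler0.
have [||A|b [bu bn hb]] := @state_factor R n H rho e e0.
- by move=> A B; rewrite /rho pD1 lD mulrDr.
- by move=> t A; rewrite /rho pZ1 lZ mulrCA.
- by have := lpp (A, 0); rewrite /rho /= herm_sup0 addr0; lra.
have [||A|a [au an ha]] := @state_factor R n H sigma e e0.
- by move=> A B; rewrite /sigma pD2 lD mulrDr.
- by move=> t A; rewrite /sigma pZ2 lZ mulrCA.
- by have := lpp (0, A); rewrite /sigma /= herm_sup0 add0r; lra.
exists a, b; split => // s xi eta.
have := lpair s xi eta; have := hb _ xi; have := ha _ eta; rewrite /rho /sigma.
have -> : (- gram xi, - gram eta) = - ((gram xi, 0) + (0, gram eta)) :> V.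
  by apply/pair_equal_spec; split=> /=; rewrite ?addr0 ?add0r.
by rewrite lN lD; lra.
Qed.

(** [B] is the matrix (a^-1)^* c b^-1. Its form at (x, y) is the pairing at (b^-1 x, a^-1 y), where
    [dnorm] returns the squared norms of [x] and [y], so [minimax] bounds it by half the sum of
    these squares. *)
Lemma minimax_factor (e : R) : 0 < e -> exists (a b : 'M[C]_n) (B : 'M[vn_elt M]_n),
  [/\ vn_norm B <= 1,
      forall i j, c i j = \sum_k \sum_l ((a k i)^* * b l j) *: B k l,
      \sum_l \sum_j cabs (a l j) ^+ 2 <= 1 + e &
      \sum_l \sum_j cabs (b l j) ^+ 2 <= 1 + e].
Proof.
move=> /minimax[a [b [au bu an bn hab]]].
pose g := invmx a; pose d := invmx b.
pose B : 'M[vn_elt M]_n := \matrix_(k, l) \sum_i \sum_j ((g i k)^* * d j l) *: c i j.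
exists a, b, B; split => //; last first.
  move=> i j.
  under eq_bigr do under eq_bigr do rewrite mxE scaler_sumr.
  under eq_bigr do under eq_bigr do under eq_bigr do rewrite scaler_sumr.
  rewrite -(sum4 (fun i' j' k l => ((a k i)^* * b l j) *: (((g i' k)^* * d j' l) *: c i' j'))).
  have ga i1 i2 : \sum_k (a k i1)^* * (g i2 k)^* = (i1 == i2)%:R.
    have /matrixP /(_ i2 i1) := mulVmx au; rewrite !mxE => h.
    have -> : (i1 == i2)%:R = ((i2 == i1)%:R : C)^*.
      by rewrite eq_sym; case: eqP; rewrite ?conjC1 ?conjC0.
    rewrite -h rmorph_sum; apply: eq_bigr => k _.
    by rewrite rmorphM mulrC.
  have db j1 j2 : \sum_l b l j1 * d j2 l = (j1 == j2)%:R.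
    have /matrixP /(_ j2 j1) := mulVmx bu; rewrite !mxE => h.
    by rewrite eq_sym -h; apply: eq_bigr => l _; rewrite mulrC.
  have coef i' j' : \sum_k \sum_l ((a k i)^* * b l j) *: (((g i' k)^* * d j' l) *: c i' j') =
     ((i == i')%:R * (j == j')%:R) *: c i' j'.
    rewrite -ga -db mulr_suml scaler_suml; apply: eq_bigr => k _.
    rewrite mulr_sumr scaler_suml; apply: eq_bigr => l _.
    by rewrite scalerA mulrACA.
  rewrite (sum2_delta (i := i) (j := j)) => [|i' j']; rewrite coef ?eqxx ?mulr1 ?scale1r //.
  by rewrite (eq_sym i) (eq_sym j) => /orP[] /negbTE ->; rewrite ?mul0r ?mulr0 scale0r.
have half (x y : 'I_n -> H) : Re (\sum_k hdot H (\sum_l B k l (x l)) (y k)) <=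
    2^-1 * (l2norm x ^+ 2 + l2norm y ^+ 2).
  pose xi j (_ : 'I_1) := \sum_l d j l *: x l.
  pose eta i (_ : 'I_1) := \sum_k g i k *: y k.
  have dn (u : 'I_n -> H) (m : 'M[C]_n) : m \in unitmx ->
      dnorm (fun j (_ : 'I_1) => \sum_l invmx m j l *: u l) m = l2norm u ^+ 2.
    move=> mu; rewrite l2norm2; apply: eq_bigr => l _; rewrite big_ord1; congr (rnorm _ ^+ 2).
    under eq_bigr do rewrite scaler_sumr; rewrite exchange_big (bigD1 l) //=.
    have mm i1 i2 : \sum_j m i1 j * invmx m j i2 = (i1 == i2)%:R.
      by have /matrixP /(_ i1 i2) := mulmxV mu; rewrite !mxE.
    under eq_bigr do rewrite scalerA; rewrite -scaler_suml mm eqxx scale1r.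
    rewrite big1 ?addr0 // => l' ll; under eq_bigr do rewrite scalerA.
    by rewrite -scaler_suml mm eq_sym (negbTE ll) scale0r.
  have := hab 1%N xi eta; rewrite (dn x b bu) (dn y a au).
  have -> // : pairing xi eta = \sum_k hdot H (\sum_l B k l (x l)) (y k).
  rewrite /pairing.
  transitivity (\sum_i \sum_j \sum_k \sum_l ((g i k)^* * d j l) * hdot H (c i j (x l)) (y k)).
    apply: eq_bigr => i _; apply: eq_bigr => j _; rewrite big_ord1 /xi /eta.
    rewrite hdot_sumr; apply: eq_bigr => k _; rewrite blin_sum hdot_suml.
    by apply: eq_bigr => l _; rewrite blinZ hdotZl hdotZr mulrCA mulrA.
  transitivity (\sum_k \sum_l \sum_i \sum_j ((g i k)^* * d j l) * hdot H (c i j (x l)) (y k)); last first.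
    apply: eq_bigr => k _; rewrite hdot_suml; apply: eq_bigr => l _.
    rewrite mxE vn_sumE hdot_suml; apply: eq_bigr => i _.
    by rewrite vn_sumE hdot_suml; apply: eq_bigr => j _; rewrite -hdotZl.
  exact: sum4.
apply: vn_norm_le_form => // x y; rewrite mul1r.
pose F u v := \sum_k hdot H (\sum_l B k l (u l)) (v k).
have FZ (z t : C) u v : F (fun l => z *: u l) (fun k => t *: v k) = z * t^* * F u v.
  rewrite mulr_sumr; apply: eq_bigr => k _.
  under eq_bigr do rewrite blinZ; rewrite -scaler_sumr hdotZl hdotZr; ring.
have F0 u v : l2norm u = 0 \/ l2norm v = 0 -> F u v = 0.
  case=> /l2norm_eq0 h; rewrite /F big1 // => k _; last by rewrite h hdot0r.
  by rewrite big1 ?hdot0l // => l _; rewrite h blin0.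
have [x0|x0] := eqVneq (l2norm x) 0.
  by rewrite -/(F x y) F0 ?cabs0 ?mulr_ge0 ?l2norm_ge0 //; left.
have [y0|y0] := eqVneq (l2norm y) 0.
  by rewrite -/(F x y) F0 ?cabs0 ?mulr_ge0 ?l2norm_ge0 //; right.
have xp : 0 < l2norm x by rewrite lt_neqAle eq_sym x0 l2norm_ge0.
have yp : 0 < l2norm y by rewrite lt_neqAle eq_sym y0 l2norm_ge0.
(* By homogeneity, normalizing both vectors and rotating the phase turns half the sum of squares
   into the product of the norms. *)
have [w [w1 wF]] := phase (F x y).
have := half (fun l => (w * ((l2norm x)^-1)%:C%C) *: x l) (fun k => ((l2norm y)^-1)%:C%C *: y k).
rewrite -/(F _ _) FZ conjR !l2normZ cabsM w1 mul1r !cabsR !ger0_norm ?invr_ge0 ?l2norm_ge0 //.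
rewrite !mulVf // expr1n.
have -> : w * ((l2norm x)^-1)%:C%C * ((l2norm y)^-1)%:C%C * F x y =
    ((l2norm x)^-1 * (l2norm y)^-1)%:C%C * (w * F x y) by rewrite rmorphM /=; ring.
rewrite wF -rmorphM /= -/(F x y) -invfM => h.
have : (l2norm x * l2norm y)^-1 * cabs (F x y) <= 1 by lra.
by rewrite ler_pdivrMl ?mulr_gt0 // mulr1.
Qed.

(** The hypothesis [hc] tests [c] only against finite systems of vector functionals. The
    factorization of [c] extends the bound to every [f]: the entries of a and b become the two test
    vectors of [predual_norm_form], at the cost of a factor 1 + e / (||f|| + 1). *)
Lemma minimax_pairing (f : 'M[predual M]_n) :
  cabs (\sum_i \sum_j f i j (c i j)) <= predual_norm f.
Proof.
have f0 := predual_norm_ge0 f.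
apply/ler_addgt0Pr => e e0.
have p1 : 0 < predual_norm f + 1 by rewrite ltr_wpDl.
have [a [b [B [B1 cE ha hb]]]] := minimax_factor (divr_gt0 e0 p1).
have -> : \sum_i \sum_j f i j (c i j) =
    \sum_i \sum_j \sum_k \sum_l f i j (B k l) * (b l j * (a k i)^*).
  apply: eq_bigr => i _; apply: eq_bigr => j _.
  have /asboolP[lf _] := predualP (f i j).
  have fD u v : f i j (u + v) = f i j u + f i j v.
    by have := lf 1 u v; rewrite !scale1r.
  have f00 : f i j 0 = 0 by apply: linear_zero.
  have fZ z u : f i j (z *: u) = z * f i j u.
    by have := lf z u 0; rewrite f00 !addr0.
  have fsum (I : finType) (F : I -> vn_elt M) : f i j (\sum_k F k) = \sum_k f i j (F k).
    by apply: (big_morph (f i j)).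
  rewrite cE fsum; apply: eq_bigr => k _; rewrite fsum; apply: eq_bigr => l _.
  by rewrite fZ mulrC [b l j * _]mulrC.
apply: le_trans (predual_norm_form f (fun j l => b l j) (fun i k => a k i) B1) _.
rewrite -mulrA.
have sq_le (m : 'M[C]_n) : \sum_l \sum_j cabs (m l j) ^+ 2 <= 1 + e / (predual_norm f + 1) ->
    Num.sqrt (\sum_j \sum_l cabs (m l j) ^+ 2) <= Num.sqrt (1 + e / (predual_norm f + 1)).
  by move=> h; rewrite ler_wsqrtr // exchange_big.
apply: le_trans (_ : predual_norm f * (1 + e / (predual_norm f + 1)) <= _).
  rewrite ler_wpM2l // -[leRHS]sqr_sqrtr; last by rewrite addr_ge0 // ltW // divr_gt0.
  by rewrite expr2 ler_pM ?sqrtr_ge0 ?sq_le.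
rewrite mulrDr mulr1 lerD2l mulrCA ler_piMr ?(ltW e0) //.
by rewrite ler_pdivrMr // mul1r lerDl.
Qed.
End Minimax.

(** * The left factor *)

Section Embedding.
Context (R : realType) (H : hilbert R).
Local Notation C := R[i].

Definition emb_fun s (x : 'I_s -> H) (n : nat) : H := if insub n is Some k then x k else 0.
Lemma emb_in s (x : 'I_s -> H) (k : 'I_s) : emb_fun x k = x k.
Proof. by rewrite /emb_fun valK. Qed.
Lemma emb_out s (x : 'I_s -> H) n : (s <= n)%N -> emb_fun x n = 0.
Proof. by move=> sn; rewrite /emb_fun insubF // ltnNge sn. Qed.
Lemma emb_sum s (x : 'I_s -> H) n :
  \sum_(i < n) rnorm (emb_fun x i) ^+ 2 <= \sum_k rnorm (x k) ^+ 2.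
Proof.
apply: le_trans (_ : \sum_(i < maxn n s) rnorm (emb_fun x i) ^+ 2 <= _).
  by apply: (psum_homo (fun i => sqr_ge0 (rnorm (emb_fun x i)))); exact: leq_maxl.
rewrite -(subnKC (leq_maxr n s)) big_split_ord /= [X in _ + X]big1 ?addr0; last first.
  by move=> i _; rewrite emb_out ?leq_addr // rnorm0 expr0n.
by apply: ler_sum => k _; rewrite emb_in.
Qed.
Lemma emb_proof s (x : 'I_s -> H) : emb_fun x \in @l2_pred R H.
Proof. by apply/l2P; eexists; exact: emb_sum. Qed.
Definition emb s (x : 'I_s -> H) : l2 H := L2 (emb_proof x).

Lemma emb_dot s (x y : 'I_s -> H) (a : blin H H) :
  l2ip H (amp a (emb x)) (emb y) = \sum_k hdot H (a (x k)) (y k).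
Proof.
apply: csum_unique (l2_dotP (amp a (emb x)) (emb y)) _.
rewrite -[X in csum _ X](_ : \sum_(k < s) hdot H (a (emb_fun x k)) (emb_fun y k) = _).
  apply: (@csum_fin R (fun n => hdot H (a (emb_fun x n)) (emb_fun y n))) => n sn.
  by rewrite (emb_out y sn) hdot0r.
by apply: eq_bigr => k _; rewrite !emb_in.
Qed.

Lemma emb_nrm s (x : 'I_s -> H) : nrm (l2ip H) (emb x) ^+ 2 <= \sum_k rnorm (x k) ^+ 2.
Proof. by apply: l2_nrm_le => n; exact: emb_sum. Qed.

Lemma emb_lincomb s n (z : 'I_n -> C) (x : 'I_n -> 'I_s -> H) :
  \sum_j z j *: emb (x j) = emb (fun k => \sum_j z j *: x j k).
Proof.
apply: l2_ext => i.
have -> : (\sum_j z j *: emb (x j)) i = \sum_j z j *: emb_fun (x j) i.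
  exact: (big_morph (fun g : l2 H => g i)).
rewrite /= /emb_fun; case: insubP => // _.
by rewrite big1 // => j _; rewrite scaler0.
Qed.
End Embedding.

Section VectorFunctionals.
Context (R : realType) (H : hilbert R) (M : vnAlg H).
Local Notation C := R[i].

Lemma predual_ext (f g : predual M) : (forall a, f a = g a) -> f = g.
Proof. by move=> h; apply/val_inj/funext. Qed.

Lemma vstate_ex (xi eta : H) : exists f : predual M, forall a, f a = hdot H (a xi) eta.
Proof.
have [f hf] := @vec_predual R H M (emb (fun _ : 'I_1 => xi)) (emb (fun _ : 'I_1 => eta)).
by exists f => a; rewrite hf emb_dot big_ord1.
Qed.
Definition vstate xi eta : predual_matNormed M := sval (cid (vstate_ex xi eta)).
Lemma vstateE xi eta a : (vstate xi eta : predual M) a = hdot H (a xi) eta.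
Proof. by rewrite /vstate; case: cid => /= f ->. Qed.

Lemma vstate_linl c u v eta : vstate (c *: u + v) eta = c *: vstate u eta + vstate v eta.
Proof.
apply: predual_ext => a; rewrite vstateE blin_linear hdot_lin.
by rewrite -[RHS]/(c * (vstate u eta : predual M) a + (vstate v eta : predual M) a) !vstateE.
Qed.
Lemma vstate_linr c u v xi : vstate xi (c *: u + v) = c^* *: vstate xi u + vstate xi v.
Proof.
apply: predual_ext => a; rewrite vstateE hdotDr hdotZr.
by rewrite -[RHS]/(c^* * (vstate xi u : predual M) a + (vstate xi v : predual M) a) !vstateE.
Qed.
Lemma vstate_comm (u u' : blin H H) xi eta : commutant (vn_set M) u -> is_adjoint u u' ->
  vstate (u xi) eta = vstate xi (u' eta).
Proof.
move=> uM uu; apply: predual_ext => a; rewrite !vstateE -uu uM //.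
by have /asboolP := vn_eltP a.
Qed.
End VectorFunctionals.

Section SliceLimit.
Context (R : realType) (H K : hilbert R) (HK : hilbert_tensor H K).
Local Notation C := R[i].
Local Notation tens := (hit_tens HK).

(** By the second hypothesis the sum of v_i (x) ke_i is the orthogonal projection of [w] onto
    span(v) (x) K, which contains all h_j (x) k_j; it is therefore the best approximation of this
    kind. *)
Lemma tens_proj n (v : 'I_n -> H) (ke : 'I_n -> K) (w : HK) m (h : 'I_m -> H) (k : 'I_m -> K) :
  ortho v -> (forall i l, hdot K (ke i) l = hdot HK w (tens (v i) l)) ->
  (forall j, fproj v (h j) = h j) ->
  rnorm (w - \sum_i tens (v i) (ke i)) <= rnorm (w - \sum_j tens (h j) (k j)).
Proof.
move=> ov hke hv; set q := \sum_i _; set z := \sum_j _.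
have perp i l : hdot HK (w - q) (tens (v i) l) = 0.
  rewrite hdotBl hdot_suml (bigD1 i) //= hit_dot ov eqxx mul1r -hke big1 ?addr0 ?subrr //.
  by move=> j ji; rewrite hit_dot ov (negbTE ji) mul0r.
have qz : hdot HK (w - q) (q - z) = 0.
  rewrite hdotBr hdot_sumr big1 // hdot_sumr big1 ?subrr // => j _.
  rewrite -hv; have -> : tens (fproj v (h j)) (k j) = \sum_i hdot H (h j) (v i) *: tens (v i) (k j).
    rewrite (big_morph (fun x => tens x (k j)) (id1 := 0) (op1 := +%R)).
    - by apply: eq_bigr => i _; rewrite -[_ *: v i]addr0 tens_linl tens0l addr0.
    - by move=> x y; rewrite -[x in LHS]scale1r tens_linl scale1r.
    - exact: tens0l.
  by rewrite hdot_sumr big1 // => i _; rewrite hdotZr perp mulr0.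
rewrite -(ler_pXn2r (n := 2)) ?nnegrE ?rnorm_ge0 //.
have -> : w - z = (w - q) + (q - z) by rewrite addrA subrK.
by rewrite (rnorm2D (w - q)) qz mulr0 addr0 lerDl sqr_ge0.
Qed.

Lemma tens_proj_lim (ke : H -> K) (w : HK) :
  (forall e l, hdot K (ke e) l = hdot HK w (tens e l)) ->
  forall d : R, 0 < d -> \forall G \near @bases R H,
    rnorm (w - \sum_i tens (@fam_vec _ _ G i) (ke (@fam_vec _ _ G i))) < d.
Proof.
move=> hke d d0.
have [_ [m [h [k ->]]] hz] := dense_near w (@hit_dense _ _ _ HK) d0.
apply: filterS (bases_near [seq h i | i <- enum 'I_m]) => -[n v] /= [ov hv].
apply: le_lt_trans hz; apply: tens_proj => // j; apply: hv.
by apply/mapP; exists j => //; rewrite mem_enum.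
Qed.
End SliceLimit.

Section Factorization.
Context (R : realType) (H : hilbert R) (M : vnAlg H).
Context (X Y : opSpace R) (XY : haagerup_tensor X Y).
Local Notation C := R[i].
Local Notation t := (ht_tens XY).
Context (Rx : predual_matNormed M -> X) (Ry : predual_matNormed M -> Y) (cx cy : R).
Hypothesis (cx0 : 0 < cx) (cy0 : 0 < cy).
Hypothesis lRx : linear Rx.
Hypothesis lRy : linear Ry.
Hypothesis hRx : forall n (v : 'M[predual_matNormed M]_n), os_norm (map_mx Rx v) <= cx * predual_norm v.
Hypothesis hRy : forall n (v : 'M[predual_matNormed M]_n), os_norm (map_mx Ry v) <= cy * predual_norm v.

Definition elem_tens (h eta xi g : H) : XY := t (Rx (vstate M h eta)) (Ry (vstate M xi g)).

(** The matrix is the Haagerup product of an n by s r and an s r by n matrix whose inner index is a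
    pair (k, a). Each factor is the image of a matrix of vector functionals, to which
    [cb_predual_rect] applies with bounds [b], [be] on the left and [bx], [d] on the right. *)
Lemma haagerup_vec_bound n s r (xi eta : 'I_n -> 'I_s -> H) (h g : 'I_r -> H) (b d bx be : R) :
  0 <= b -> 0 <= d -> 0 <= bx -> 0 <= be ->
  bessel h b -> bessel g d -> bessel2 xi bx -> bessel2 eta be ->
  os_norm (\matrix_(i < n, j < n) \sum_k \sum_a elem_tens (h a) (eta i k) (xi j k) (g a) : 'M[XY]_n)
   <= cx * cy * (b * d) * (bx * be).
Proof.
move=> b0 d0 bx0 be0 hb hd hxi heta.
pose fV : 'M[predual_matNormed M]_(n, s * r) :=
  \matrix_(i, u) vstate M (h (mxtens_unindex u).2) (eta i (mxtens_unindex u).1).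
pose fW : 'M[predual_matNormed M]_(s * r, n) :=
  \matrix_(u, j) vstate M (xi j (mxtens_unindex u).1) (g (mxtens_unindex u).2).
have E : \matrix_(i, j) \sum_k \sum_a elem_tens (h a) (eta i k) (xi j k) (g a) =
   haagerup_mul t (map_mx Rx fV) (map_mx Ry fW).
  apply/matrixP => i j; rewrite !mxE.
  rewrite -(sum_tens (fun k a => elem_tens (h a) (eta i k) (xi j k) (g a))).
  by apply: eq_bigr => u _; rewrite !mxE.
(* The vector f_a placed in slot k of the direct sum of [s] copies of [H]. The synthesis operator of
   these vectors is [s] orthogonal copies of that of [f], so its bound does not depend on [s]. *)
pose col (f : 'I_r -> H) (u : 'I_(s * r)) (k : 'I_s) : H :=
  if k == (mxtens_unindex u).1 then f (mxtens_unindex u).2 else 0.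
have colb (f : 'I_r -> H) (p : R) : bessel f p -> forall z : 'I_(s * r) -> C,
    nrm (l2ip H) (\sum_u z u *: emb (col f u)) ^+ 2 <= p ^+ 2 * \sum_u cabs (z u) ^+ 2.
  move=> hp z; rewrite emb_lincomb; apply: le_trans (emb_nrm _) _.
  have -> : \sum_u cabs (z u) ^+ 2 = \sum_k \sum_a cabs (z (mxtens_index (k, a))) ^+ 2.
    rewrite -(sum_tens (fun k a => cabs (z (mxtens_index (k, a))) ^+ 2)).
    by apply: eq_bigr => u _; rewrite -surjective_pairing mxtens_unindexK.
  rewrite mulr_sumr; apply: ler_sum => k _.
  rewrite (_ : \sum_u z u *: col f u k = \sum_a z (mxtens_index (k, a)) *: f a).
    exact: hp.
  transitivity (\sum_k' \sum_a z (mxtens_index (k', a)) *: (if k == k' then f a else 0)).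
    rewrite -(sum_tens (fun k' a => z (mxtens_index (k', a)) *: (if k == k' then f a else 0))).
    by apply: eq_bigr => u _; rewrite -surjective_pairing mxtens_unindexK.
  rewrite (bigD1 k) //= eqxx [X in _ + X]big1 ?addr0 // => k' kk.
  by apply: big1 => a _; rewrite eq_sym (negbTE kk) scaler0.
have rowb (x : 'I_n -> 'I_s -> H) (p : R) : bessel2 x p -> forall z : 'I_n -> C,
    nrm (l2ip H) (\sum_j z j *: emb (x j)) ^+ 2 <= p ^+ 2 * \sum_j cabs (z j) ^+ 2.
  by move=> hp z; rewrite emb_lincomb; apply: le_trans (emb_nrm _) _; exact: hp.
have hV : os_norm (map_mx Rx fV) <= cx * (b * be).
  apply: (cb_predual_rect lRx hRx (xi := fun u => emb (col h u)) (eta := fun i => emb (eta i))) => //.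
  - exact: ltW.
  - move=> i u a; rewrite mxE vstateE emb_dot (bigD1 (mxtens_unindex u).1) //= /col eqxx.
    by rewrite big1 ?addr0 // => k ku; rewrite (negbTE ku) blin0 hdot0l.
  - exact: colb.
  - exact: rowb.
have hW : os_norm (map_mx Ry fW) <= cy * (bx * d).
  apply: (cb_predual_rect lRy hRy (xi := fun i => emb (xi i)) (eta := fun u => emb (col g u))) => //.
  - exact: ltW.
  - move=> u j a; rewrite mxE vstateE emb_dot (bigD1 (mxtens_unindex u).1) //= /col eqxx.
    by rewrite big1 ?addr0 // => k ku; rewrite (negbTE ku) hdot0r.
  - exact: rowb.
  - exact: colb.
rewrite E; apply: le_trans (ht_le XY (map_mx Rx fV) (map_mx Ry fW)) _.
apply: le_trans (ler_pM (os_norm_ge0 _) (os_norm_ge0 _) hV hW) _.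
apply: le_of_eq; ring.
Qed.

Definition kappa := cx * cy.
Lemma kappa_gt0 : 0 < kappa. Proof. exact: mulr_gt0. Qed.

Lemma bessel2_const (x : H) : @bessel2 R H 1 1 (fun _ _ => x) (rnorm x).
Proof. by move=> z; rewrite !big_ord1 /sqnorm big_ord1 rnormZ exprMn mulrC. Qed.

Definition trace_form (theta : blin XY R[i]^o) (xi eta h k : H) : C := theta (elem_tens h eta xi k).

Lemma elem_h c u v eta xi g : elem_tens (c *: u + v) eta xi g = c *: elem_tens u eta xi g + elem_tens v eta xi g.
Proof. by rewrite /elem_tens vstate_linl lRx ht_linl. Qed.
Lemma elem_eta c u v h xi g : elem_tens h (c *: u + v) xi g = c^* *: elem_tens h u xi g + elem_tens h v xi g.
Proof. by rewrite /elem_tens vstate_linr lRx ht_linl. Qed.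
Lemma elem_xi c u v h eta g : elem_tens h eta (c *: u + v) g = c *: elem_tens h eta u g + elem_tens h eta v g.
Proof. by rewrite /elem_tens vstate_linl lRy ht_linr. Qed.
Lemma elem_g c u v h eta xi : elem_tens h eta xi (c *: u + v) = c^* *: elem_tens h eta xi u + elem_tens h eta xi v.
Proof. by rewrite /elem_tens vstate_linr lRy ht_linr. Qed.

Section OneFunctional.
Context (theta : blin XY R[i]^o) (kt : R).
Hypothesis kt0 : 0 <= kt.
Hypothesis hkt : forall z, cabs (theta z) <= kt * rnorm z.
Local Notation B := (trace_form theta).

Lemma trace_form_linl xi eta c u v z : B xi eta (c *: u + v) z = c * B xi eta u z + B xi eta v z.
Proof. by rewrite /trace_form elem_h blin_linear. Qed.
Lemma trace_form_linr xi eta c u v z : B xi eta z (c *: u + v) = c^* * B xi eta z u + B xi eta z v.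
Proof. by rewrite /trace_form elem_g blin_linear. Qed.

Lemma trace_form_bound xi eta n (h k : 'I_n -> H) (b d : R) : 0 <= b -> 0 <= d ->
  bessel h b -> bessel k d ->
  cabs (\sum_i B xi eta (h i) (k i)) <= kt * kappa * rnorm xi * rnorm eta * b * d.
Proof.
move=> b0 d0 hb hd.
have := @haagerup_vec_bound 1 1 n (fun _ _ => xi) (fun _ _ => eta) h k b d _ _ b0 d0
  (rnorm_ge0 xi) (rnorm_ge0 eta) hb hd (@bessel2_const xi) (@bessel2_const eta).
set z := \matrix_(i, j) _ => hz.
have := os_entry z ord0 ord0; rewrite mxE big_ord1 => h1.
have -> : \sum_i B xi eta (h i) (k i) = theta (\sum_i elem_tens (h i) eta xi (k i)).
  by rewrite blin_sum.
apply: le_trans (hkt _) _.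
apply: le_trans (ler_wpM2l kt0 (le_trans h1 hz)) _.
by apply: le_of_eq; rewrite /kappa; ring.
Qed.

Let K0 (xi eta : H) : 0 <= kt * kappa * rnorm xi * rnorm eta.
Proof. by rewrite !mulr_ge0 ?rnorm_ge0 // ltW // kappa_gt0. Qed.

Lemma trace_form_lim xi eta : exists l : C, forall e : R, 0 < e ->
  \forall G \near @bases R H, cabs (ftrace (B xi eta) G - l) < e.
Proof. exact: (ftrace_lim (trace_form_linl xi eta) (trace_form_linr xi eta) (K0 xi eta) (@trace_form_bound xi eta)). Qed.

(* The trace of B xi eta over an orthonormal basis is a form in (xi, eta); by
   ftrace_comm it is invariant under the commutant of M. *)
Lemma trace_op : exists2 a : vn_elt M, forall xi, rnorm (a xi) <= kt * kappa * rnorm xi &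
  forall xi eta (e : R), 0 < e ->
    \forall G \near @bases R H, cabs (ftrace (B xi eta) G - hdot H (a xi) eta) < e.
Proof.
have [l hl] := choice (fun p : H * H => trace_form_lim p.1 p.2).
have lin_tr (x1 x2 x3 e1 e2 e3 : H) c :
    (forall h k, B x1 e1 h k = c * B x2 e2 h k + B x3 e3 h k) ->
    l (x1, e1) = c * l (x2, e2) + l (x3, e3).
  move=> hB; apply: clim_unique (hl (x1, e1)) _ => e e0.
  apply: filterS (clim_lin _ c (hl (x2, e2)) (hl (x3, e3)) e0) => G.
  rewrite (_ : ftrace (B x1 e1) G = c * ftrace (B x2 e2) G + ftrace (B x3 e3) G) //.
  by rewrite mulr_sumr -big_split; apply: eq_bigr => i _; rewrite hB.
have kk : 0 <= kt * kappa by rewrite mulr_ge0 // ltW // kappa_gt0.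
have [c u v k|c u v h|h k|a ab hal] := @form_op R H H (fun xi eta => l (xi, eta)) (kt * kappa) kk.
- by apply: lin_tr => h g; rewrite /trace_form elem_xi blin_linear.
- by apply: lin_tr => x g; rewrite /trace_form elem_eta blin_linear.
- apply/ler_addgt0Pr => e e0.
  have := filter_ex (filterI (hl (h, k) _ e0) (@bases_near R H [::])).
  move=> [[n v] /= [h1 [ov _]]].
  have h2 := trace_form_bound h k ler01 ler01 (ortho_bessel ov) (ortho_bessel ov).
  rewrite !mulr1 in h2.
  have -> : l (h, k) = ftrace (B h k) (Fam v) - (ftrace (B h k) (Fam v) - l (h, k)).
    by rewrite opprB addrC subrK.
  by apply: le_trans (cabsB _ _) _; apply: lerD; [exact: h2|exact: ltW].
suff aM : a \in vn_pred M.
  exists (VNElt aM) => //= xi eta e e0; rewrite hal; exact: (hl (xi, eta) e e0).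
apply/asboolP; rewrite -vn_bicommutant => u uM xi; apply: hdot_eq => eta.
have [u' uu] := adjoint_exists u.
rewrite uu !hal.
apply: clim_unique (hl (xi, u' eta)) _ => e e0.
have e2 : 0 < e / 2 by rewrite divr_gt0.
have tc := ftrace_comm (trace_form_linl xi eta) (trace_form_linr xi eta) (K0 xi eta) (@trace_form_bound xi eta) uu e2.
apply: filterS2 tc (hl (u xi, eta) _ e2) => G h1 h2.
(* For [u] in the commutant, omega_{h, u' eta} = omega_{u h, eta} and omega_{u xi, k} = omega_{xi,
   u' k} on [M]. So [u] moves from the outer vectors to the inner ones, where cyclicity of the trace
   compares the two sides. *)
have E1 : ftrace (B xi (u' eta)) G = ftrace (fun x y => B xi eta (u x) y) G.
  by apply: eq_bigr => i _; rewrite /trace_form /elem_tens (vstate_comm _ _ uM uu).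
have E2 : ftrace (B (u xi) eta) G = ftrace (fun x y => B xi eta x (u' y)) G.
  by apply: eq_bigr => i _; rewrite /trace_form /elem_tens (vstate_comm _ _ uM uu).
rewrite E1; rewrite E2 in h2.
set p := ftrace _ G in h1 h2 *; set q := ftrace _ G in h1 h2.
have -> : p - l (u xi, eta) = (p - q) + (q - l (u xi, eta)) by rewrite addrA subrK.
by apply: le_lt_trans (cabsD _ _) _; lra.
Qed.
End OneFunctional.
End Factorization.

Lemma predual_bounded (R : realType) (H : hilbert R) (M : vnAlg H) (f : predual M) :
  exists2 c : R, 0 <= c & forall (a : vn_elt M) (e : R), 0 <= e ->
    (forall h, rnorm (a h) <= e * rnorm h) -> cabs (f a) <= c * e.
Proof.
have [xi [eta hf]] := predual_vec f.
exists (nrm (l2ip H) xi * nrm (l2ip H) eta); first by rewrite mulr_ge0 ?nrm_ge0.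
move=> a e e0 ae; rewrite hf; apply: le_trans (cauchy_schwarz _ _ _) _.
rewrite mulrAC ler_wpM2r ?nrm_ge0 // mulrC.
rewrite -(ler_pXn2r (n := 2)) ?nnegrE ?mulr_ge0 ?nrm_ge0 //.
apply: l2_nrm_le => n; rewrite exprMn.
rewrite (le_trans _ (ler_wpM2l (sqr_ge0 _) (l2_psum_le xi n))) // mulr_sumr.
apply: ler_sum => i _; rewrite -exprMn.
by rewrite ler_pXn2r ?nnegrE ?mulr_ge0 ?rnorm_ge0 //; exact: ae.
Qed.

Lemma separates (R : realType) (V : normedModType R[i]) (u v : V) :
  (forall f : blin V R[i]^o, f u = f v) -> u = v.
Proof.
move=> huv; apply/eqP; rewrite -subr_eq0; apply/eqP/rnorm_eq0.
have [||f [lf bf fu]] := @hahn_banach_complex R V (@rnorm R V) (u - v).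
- exact: rnormD.
- exact: rnormZ.
have [|w|g hg] := @blin_build R V (R[i]^o) f 1.
- by move=> c x y; rewrite lf.
- by rewrite mul1r; exact: bf.
have := huv g; move/eqP; rewrite -subr_eq0 -blinB hg => /eqP h.
by rewrite -fu h.
Qed.

Section LeftFactor.
Context (R : realType) (H : hilbert R) (M : vnAlg H).
Context (X Y : opSpace R) (XY : haagerup_tensor X Y).
Local Notation C := R[i].
Context (Rx : predual_matNormed M -> X) (Ry : predual_matNormed M -> Y) (cx cy : R).
Hypothesis (cx0 : 0 < cx) (cy0 : 0 < cy).
Hypothesis lRx : linear Rx.
Hypothesis lRy : linear Ry.
Hypothesis hRx : forall n (v : 'M[predual_matNormed M]_n), os_norm (map_mx Rx v) <= cx * predual_norm v.
Hypothesis hRy : forall n (v : 'M[predual_matNormed M]_n), os_norm (map_mx Ry v) <= cy * predual_norm v.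
Hypothesis refl : reflexive_space XY.
Local Notation kappa := (kappa cx cy).
Local Notation trace_form := (@trace_form R H M X Y XY Rx Ry).

Let kp : 0 < kappa. Proof. exact: kappa_gt0. Qed.

Definition is_trace_op (theta : blin XY R[i]^o) (a : vn_elt M) := forall xi eta (e : R),
  0 < e -> \forall G \near @bases R H, cabs (ftrace (trace_form theta xi eta) G - hdot H (a xi) eta) < e.

Lemma is_trace_op_unique theta a b : is_trace_op theta a -> is_trace_op theta b -> a = b.
Proof.
move=> ha hb; apply: vn_ext => xi; apply: hdot_eq => eta.
exact: clim_unique (ha xi eta) (hb xi eta).
Qed.

Lemma is_trace_op_ex theta : exists a, is_trace_op theta a.
Proof.
have [c c0 hc] := blin_bounded theta.
have [a _ ha] := trace_op cx0 cy0 lRx lRy hRx hRy c0 hc.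
by exists a.
Qed.

Definition trace_elt theta : vn_elt M := sval (cid (is_trace_op_ex theta)).
Lemma trace_eltP theta : is_trace_op theta (trace_elt theta).
Proof. by rewrite /trace_elt; case: cid. Qed.

Lemma trace_elt_bound (theta : blin XY R[i]^o) (k : R) : 0 <= k -> (forall z, cabs (theta z) <= k * rnorm z) ->
  forall xi, rnorm (trace_elt theta xi) <= k * kappa * rnorm xi.
Proof.
move=> k0 hk xi.
have [a ba ha] := trace_op cx0 cy0 lRx lRy hRx hRy k0 hk.
by rewrite (is_trace_op_unique (trace_eltP theta) ha).
Qed.

Lemma trace_elt_lin c (theta theta' : blin XY R[i]^o) : trace_elt (c *: theta + theta') = c *: trace_elt theta + trace_elt theta'.
Proof.
apply: (is_trace_op_unique (trace_eltP _)) => xi eta e e0.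
apply: filterS (clim_lin _ c (trace_eltP theta xi eta) (trace_eltP theta' xi eta) e0) => G.
rewrite vn_linE hdot_lin.
rewrite (_ : ftrace (trace_form (c *: theta + theta') xi eta) G =
   c * ftrace (trace_form theta xi eta) G + ftrace (trace_form theta' xi eta) G) //.
by rewrite mulr_sumr -big_split; apply: eq_bigr.
Qed.

Lemma representing (f : predual M) : exists v : XY, forall theta : blin XY R[i]^o, f (trace_elt theta) = theta v.
Proof.
have /asboolP[lf _] := predualP f.
have [c c0 hc] := predual_bounded f.
apply: (refl (phi := fun theta => f (trace_elt theta))).
  by move=> a u v; rewrite trace_elt_lin lf.
(* If the space is zero the condition on [k] is void and [k] may be negative, so a separate constant
   0 is used. Otherwise a nonzero vector forces k >= 0. *)
have [triv|] := pselect (forall v : XY, v = 0).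
  exists 0 => theta k hk; rewrite mul0r.
  have -> : theta = 0 by apply: blin_ext => v; rewrite (triv v) !blin0.
  have -> : trace_elt 0 = 0.
    by have := trace_elt_lin (-1) 0 0; rewrite scaler0 addr0 scaleN1r addNr.
  by rewrite (linear_zero lf) -[complex.Re _]/(cabs 0) cabs0.
move/existsNP => [v /eqP v0].
exists (c * kappa) => theta k hk.
have k0 : 0 <= k.
  have vp : 0 < rnorm v.
    by rewrite lt_neqAle rnorm_ge0 andbT eq_sym; apply: contraNneq v0 => /rnorm_eq0 ->.
  by have := le_trans (rnorm_ge0 _) (hk v); rewrite pmulr_lge0.
rewrite -[complex.Re _]/(cabs _) -mulrA; apply: hc.
  by rewrite mulr_ge0 // ltW.
by move=> h; rewrite (mulrC kappa); apply: trace_elt_bound.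
Qed.

Definition Rxy (f : predual_matNormed M) : XY := sval (cid (representing f)).
Lemma RxyP f (theta : blin XY R[i]^o) : (f : predual M) (trace_elt theta) = theta (Rxy f).
Proof. by rewrite /Rxy; case: cid. Qed.

Lemma Rxy_lin : linear Rxy.
Proof.
move=> c f g; apply: separates => theta.
by rewrite blin_linear -!RxyP.
Qed.

(** A functional F of norm 1 for the matrix norm attains the norm of [map_mx Rxy f]. Its components
    [th] turn F into the pairing of [f] with the matrix of trace operators of the [th]; divided by
    [kappa], this matrix satisfies the hypothesis of [minimax_pairing]. *)
Lemma Rxy_cb n (f : 'M[predual_matNormed M]_n) :
  os_norm (map_mx Rxy f) <= kappa * predual_norm f.
Proof.
(* Functions of two indices form a module over [R[i]], as Hahn-Banach requires; [mat] transports the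
   matrix norm to them. *)
pose V := 'I_n -> 'I_n -> XY.
pose mat (g : V) : 'M[XY]_n := \matrix_(i, j) g i j.
have matE (u : 'M[XY]_n) : mat (fun i j => u i j) = u by apply/matrixP => i j; rewrite mxE.
have [||F [lF bF FR]] := @hahn_banach_complex R V (fun g => os_norm (mat g))
   (fun i j => Rxy (f i j)).
- move=> u v; rewrite (_ : mat (u + v) = mat u + mat v) ?os_normD //.
  by apply/matrixP => i j; rewrite !mxE.
- move=> c v; rewrite (_ : mat (c *: v) = map_mx (GRing.scale c) (mat v)) ?os_normZ //.
  by apply/matrixP => i j; rewrite !mxE.
have F0 : F 0 = 0 := linear_zero (W := R[i]^o) lF.
have FD u v : F (u + v) = F u + F v by have := lF 1 u v; rewrite scale1r mul1r.
pose dl i j (x : XY) : V := fun i' j' => if (i' == i) && (j' == j) then x else 0.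
have dl_ex (ij : 'I_n * 'I_n) : exists th : blin XY R[i]^o, forall x, th x = F (dl ij.1 ij.2 x).
  have [|x|g hg] := @blin_build R XY (R[i]^o) (fun x => F (dl ij.1 ij.2 x)) 1.
  - move=> c x y; rewrite -lF; congr F; apply/funext => i; apply/funext => j.
    rewrite /dl -[RHS]/(c *: (if _ then x else 0) + (if _ then y else 0)).
    by case: ifP => // _; rewrite scaler0 addr0.
  - rewrite mul1r; apply: le_trans (bF _) _; apply: le_trans (os_le_sum _) _.
    rewrite (sum2_delta (i := ij.1) (j := ij.2)) => [|i j]; rewrite mxE /dl ?eqxx //.
    by move=> /orP[] /negbTE ->; rewrite ?andbF rnorm0.
  by exists g.
have [th hth] := choice dl_ex.
have Fsum (g : V) : F g = \sum_i \sum_j th (i, j) (g i j).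
  have gE : g = \sum_i \sum_j dl i j (g i j).
    apply/funext => i; apply/funext => j.
    have ev (I : finType) (L : I -> V) : (\sum_k L k) i j = \sum_k L k i j.
      exact: (big_morph (fun h : V => h i j)).
    rewrite ev; under eq_bigr do rewrite ev.
    rewrite (sum2_delta (i := i) (j := j)) /dl ?eqxx // => i' j'.
    by rewrite (eq_sym i) (eq_sym j) => /orP[] /negbTE ->; rewrite ?andbF.
  have Fs (I : finType) (L : I -> V) : F (\sum_k L k) = \sum_k F (L k).
    by apply: (big_morph F).
  rewrite {1}gE Fs; apply: eq_bigr => i _; rewrite Fs; apply: eq_bigr => j _.
  by rewrite hth.
pose c : 'M[vn_elt M]_n := \matrix_(i, j) ((kappa^-1)%:C%C *: trace_elt (th (i, j))).
have hc s (xi eta : 'I_n -> 'I_s -> H) (b d : R) : 0 <= b -> 0 <= d ->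
    bessel2 xi b -> bessel2 eta d -> cabs (pairing c xi eta) <= b * d.
  move=> b0 d0 hxi heta.
  pose P (G : fam H) := \sum_i \sum_j \sum_k ftrace (trace_form (th (i, j)) (xi j k) (eta i k)) G.
  have sumlim (I : finType) (g : I -> fam H -> C) (l : I -> C) :
      (forall i (e : R), 0 < e -> \forall G \near @bases R H, cabs (g i G - l i) < e) ->
      forall e : R, 0 < e -> \forall G \near @bases R H, cabs (\sum_i g i G - \sum_i l i) < e.
    move=> hg; have : forall (L : seq I) (e : R), 0 < e -> \forall G \near @bases R H,
        cabs (\sum_(i <- L) g i G - \sum_(i <- L) l i) < e.
      elim=> [|i L IH] e e0.
        by near=> G; rewrite !big_nil subr0 cabs0.
      by apply: filterS (clim_lin _ 1 (hg i) IH e0) => G; rewrite !big_cons !mul1r.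
    by move=> h; exact: h.
  have lim : forall e : R, 0 < e -> \forall G \near @bases R H,
      cabs (P G - \sum_i \sum_j \sum_k hdot H (trace_elt (th (i, j)) (xi j k)) (eta i k)) < e.
    apply: (sumlim _ _ _ _) => i; apply: (sumlim _ _ _ _) => j; apply: (sumlim _ _ _ _) => k.
    exact: trace_eltP.
  set L := \sum_i \sum_j \sum_k hdot H (trace_elt _ _) _ in lim.
  have -> : pairing c xi eta = (kappa^-1)%:C%C * L.
    rewrite mulr_sumr; apply: eq_bigr => i _; rewrite mulr_sumr; apply: eq_bigr => j _.
    rewrite mulr_sumr; apply: eq_bigr => k _; rewrite mxE.
    by rewrite -hdotZl.
  (* Before the limit, the sum of traces is the value of F at one matrix of tensors, which
     [haagerup_vec_bound] controls with both inner families equal to an orthonormal one, of Bessel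
     bound 1. *)
  have PB G : ortho (@fam_vec _ _ G) -> cabs (P G) <= kappa * (b * d).
    move=> oG.
    pose u : 'M[XY]_n := \matrix_(i, j) \sum_k \sum_a
      elem_tens XY Rx Ry (@fam_vec _ _ G a) (eta i k) (xi j k) (@fam_vec _ _ G a).
    have -> : P G = F (fun i j => u i j).
      rewrite Fsum; apply: eq_bigr => i _; apply: eq_bigr => j _.
      by rewrite mxE blin_sum; apply: eq_bigr => k _; rewrite blin_sum.
    apply: le_trans (bF _) _; rewrite matE.
    have := haagerup_vec_bound XY cx0 cy0 lRx lRy hRx hRy ler01 ler01 b0 d0
       (ortho_bessel oG) (ortho_bessel oG) hxi heta.
    by rewrite !mulr1.
  rewrite cabsM cabsR ger0_norm ?invr_ge0 ?(ltW kp) // ler_pdivrMl //.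
  apply/ler_addgt0Pr => e e0.
  have [G [h1 [oG _]]] := filter_ex (filterI (lim _ e0) (@bases_near R H [::])).
  have -> : L = P G - (P G - L) by rewrite opprB addrC subrK.
  by apply: le_trans (cabsB _ _) _; apply: lerD; [exact: PB|exact: ltW].
have := minimax_pairing hc f.
have -> : \sum_i \sum_j (f i j : predual M) (c i j) =
    (kappa^-1)%:C%C * F (fun i j => Rxy (f i j)).
  rewrite Fsum mulr_sumr; apply: eq_bigr => i _; rewrite mulr_sumr; apply: eq_bigr => j _.
  rewrite mxE -RxyP; have /asboolP[lf _] := predualP (f i j : predual M).
  by rewrite -[_ *: trace_elt _]addr0 lf (linear_zero lf) addr0.
rewrite cabsM cabsR ger0_norm ?invr_ge0 ?(ltW kp) // ler_pdivrMl // => h.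
have -> : map_mx Rxy f = mat (fun i j => Rxy (f i j)) by apply/matrixP => i j; rewrite !mxE.
by rewrite -FR; apply: le_trans (Re_le _) h.
Unshelve. all: by end_near.
Qed.
End LeftFactor.

(** * The slice map of a product *)

Section Product.
Context (R : realType) (H K : hilbert R) (HK : hilbert_tensor H K) (M : vnAlg H) (N : vnAlg K).
Context (X Y : opSpace R) (XY : haagerup_tensor X Y).
Local Notation C := R[i].
Implicit Types (z : vn_elt (vn_tensor HK M N)) (k l : K).

Lemma Tmap_vstate z xi eta k l : hdot K ((Tmap z (vstate M xi eta) : vn_elt N) k) l =
  hdot HK (z (hit_tens HK xi k)) (hit_tens HK eta l).
Proof.
rewrite (TmapP (xi := emb (fun _ : 'I_1 => xi)) (eta := emb (fun _ : 'I_1 => eta))).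
  have tE h m : tensl2 HK (emb (fun _ : 'I_1 => h)) m = emb (fun _ : 'I_1 => hit_tens HK h m).
    apply/val_inj/funext => n /=; rewrite /emb_fun; case: insubP => //= _.
    by rewrite tens0l.
  by rewrite !tE emb_dot big_ord1.
by move=> a; rewrite vstateE emb_dot big_ord1.
Qed.

(** For a finite orthonormal family the trace equals <x p y (xi (x) k), eta (x) l>, where p projects
    onto the span of the family tensored with K: the vectors [ke] are the coefficients of y (xi (x)
    k) along the family. As the family grows, [tens_proj_lim] removes p. *)
Lemma factor_product (x y : vn_elt (vn_tensor HK M N))
    (Rx : predual_matNormed M -> X) (Sx : X -> vn_elt N)
    (Ry : predual_matNormed M -> Y) (Sy : Y -> vn_elt N)
    (S : XY -> vn_elt N)
    (theta : blin XY R[i]^o) (a : vn_elt M) k l :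
  (forall f, Tmap x f = Sx (Rx f)) -> (forall f, Tmap y f = Sy (Ry f)) ->
  (forall u v, S (ht_tens XY u v) = mul_map Sx Sy u v) ->
  (forall u, theta u = hdot K (S u k) l) ->
  is_trace_op Rx Ry theta a -> forall xi eta,
  hdot H (a xi) eta = hdot HK (vn_mul x y (hit_tens HK xi k)) (hit_tens HK eta l).
Proof.
move=> Tx Ty hS hth ha xi eta.
apply: clim_unique (ha xi eta) _ => e e0.
pose ke h := (Tmap y (vstate M xi h) : vn_elt N) k.
have hke h m : hdot K (ke h) m = hdot HK (y (hit_tens HK xi k)) (hit_tens HK h m).
  exact: Tmap_vstate.
have [b b0 hb] := blin_bounded (x : blin HK HK).
(* An approximation within p of y (xi (x) k) is amplified by at most the bound b of [x] times the
   norm of [w]; adding 1 makes q positive and the final estimate strict. *)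
set w := hit_tens HK eta l; pose q := b * rnorm w + 1.
have q0 : 0 < q by rewrite ltr_wpDl ?mulr_ge0 ?rnorm_ge0.
have [p p0 hp] : exists2 p, 0 < p & p * q = e.
  by exists (e / q); rewrite ?divr_gt0 // divfK // gt_eqF.
apply: filterS (tens_proj_lim hke p0) => G hG.
have -> : ftrace (trace_form Rx Ry theta xi eta) G =
    hdot HK (x (\sum_i hit_tens HK (@fam_vec _ _ G i) (ke (@fam_vec _ _ G i)))) w.
  rewrite blin_sum hdot_suml; apply: eq_bigr => i _.
  by rewrite /trace_form hth hS /mul_map /= -Tx -Ty Tmap_vstate.
rewrite -[vn_mul x y _]/(x (y _)) -hdotBl -blinB.
apply: le_lt_trans (hdot_CS _ _) _.
apply: le_lt_trans (ler_wpM2r (rnorm_ge0 w) (hb _)) _; rewrite rnorm_distC.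
rewrite mulrAC -hp mulrC; apply: le_lt_trans (_ : p * (b * rnorm w) < _).
  by rewrite ler_wpM2r ?mulr_ge0 ?rnorm_ge0 // ltW.
by rewrite ltr_pM2l // ltrDl.
Qed.

Lemma cb_pos (E F : matNormed R) (T : E -> F) :
  (forall n (v : 'M[E]_n), 0 <= mnorm v) -> completely_bounded T ->
  linear T /\ exists2 c : R, 0 < c & forall n (v : 'M[E]_n), mnorm (map_mx T v) <= c * mnorm v.
Proof.
move=> v0 [lT [c hc]]; split=> //; exists (Num.max c 1); first by rewrite lt_max ltr01 orbT.
by move=> n v; apply: le_trans (hc n v) _; rewrite ler_wpM2r // le_max lexx.
Qed.
End Product.

Theorem theorem2p1 (R : realType) (H K : hilbert R) (HK : hilbert_tensor H K)
    (M : vnAlg H) (N : vnAlg K)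
    (X Y : opSpace R) (XY : haagerup_tensor X Y)
    (x y : vn_elt (vn_tensor HK M N)) :
  injective_matNormed (vn_matNormed M) ->
  injective_matNormed (vn_matNormed N) ->
  reflexive_space XY ->
  factors_cb (Tmap x) X ->
  factors_cb (Tmap y) Y ->
  factors_cb (Tmap (vn_mul x y)) XY.
Proof.
move=> _ _ refl [Rx [Sx [cbRx cbSx Tx]]] [Ry [Sy [cbRy cbSy Ty]]].
have p0 n (v : 'M[predual_matNormed M]_n) : 0 <= mnorm v := predual_norm_ge0 v.
have o0 (Z : opSpace R) n (v : 'M[Z]_n) : 0 <= @mnorm R Z n n v := os_norm_ge0 v.
have [lRx [cx cx0 hRx]] := cb_pos p0 cbRx; have [lRy [cy cy0 hRy]] := cb_pos p0 cbRy.
have [lSx [dx dx0 hSx]] := cb_pos (o0 X) cbSx; have [lSy [dy dy0 hSy]] := cb_pos (o0 Y) cbSy.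
have [S [lS St Sb Scb]] := haagerup_extension XY dx0 dy0 lSx lSy hSx hSy.
exists (Rxy cx0 cy0 lRx lRy hRx hRy refl), S; split.
- by split; [exact: Rxy_lin|exists (kappa cx cy) => n v; exact: Rxy_cb].
- by split => //; exists (dx * dy).
apply/funext => f; apply: vn_ext => k; apply: hdot_eq => l.
(* Fixing [k] and [l] makes the coefficient of [S] a bounded functional on [XY], and the defining
   property of [Rxy] evaluates it as [f] at the trace operator of this functional. *)
have [||theta hth] := @blin_build R XY R[i]^o (fun u => hdot K (S u k) l) (dx * dy * rnorm k * rnorm l).
- by move=> c u v; rewrite lS vn_linE hdot_lin.
- move=> u; apply: le_trans (hdot_CS _ _) _.
  by apply: le_trans (ler_wpM2r (rnorm_ge0 l) (Sb u k)) _; apply: le_of_eq; ring.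
have ha := factor_product (fun g => congr1 (@^~ g) Tx) (fun g => congr1 (@^~ g) Ty) St hth (trace_eltP cx0 cy0 lRx lRy hRx hRy theta).
rewrite -[(S \o _) f]/(S _) -hth -RxyP.
(* A general [f] is a series of vector functionals, so both sides are sums of series whose terms
   agree by [factor_product]. *)
have [xi [eta hf]] := predual_vec f.
rewrite (TmapP hf) hf; apply: csum_unique (l2_dotP _ _) _.
move=> e e0; have [n0 hn] := l2_dotP (amp (trace_elt cx0 cy0 lRx lRy hRx hRy theta) xi) eta e0.
exists n0 => n nn; rewrite (eq_bigr (fun i : 'I_n => hdot H (trace_elt cx0 cy0 lRx lRy hRx hRy theta (xi i)) (eta i))).
  exact: hn.
by move=> i _; rewrite ha.
Qed.
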